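(* Consider Activated Random Walks on $\mathbb{Z}$ ($d=1$) with symmetric walks, i.e. $p(+1)=p(-1)=\frac12$, and let $\zeta_c=\zeta_c(\lambda)$ denote the critical density for sleep rate $\lambda\in(0,\infty)$. Then $\zeta_c(\lambda)\to0$ as $\lambda\to0$.
   Context: Activated Random Walk (ARW) on $\mathbb{Z}^d$. Fix $d\geqslant1$, a sleep rate $0<\lambda<\infty$ and a jump distribution $p(\cdot)$, i.e. a probability distribution on $\mathbb{Z}^d$ supported on the nearest neighbors $\{\pm e_1,\dots,\pm e_d\}$ of the origin $\boldsymbol{0}$ and whose support generates the group $\mathbb{Z}^d$. Let $\mathbb{N}_0=\{0,1,2,\dots\}$ and $\mathbb{N}_{\mathfrak{s}}=\mathbb{N}_0\cup\{\mathfrak{s}\}$, ordered by $0<\mathfrak{s}<1<2<\cdots$, with $|\mathfrak{s}|=1$, $|n|=n$, $\mathfrak{s}+1=2$, $1\cdot\mathfrak{s}=\mathfrak{s}$ and $n\cdot\mathfrak{s}=n$ for $n\geqslant2$. A configuration is $\eta\in(\mathbb{N}_{\mathfrak{s}})^{\mathbb{Z}^d}$: site $x$ contains $\eta(x)$ active particles if $\eta(x)\in\mathbb{N}_0$ and one sleeping particle if $\eta(x)=\mathfrak{s}$. Evolution: at each site $x$ a clock rings at rate $(1+\lambda)\,\eta_t(x)\,\mathbf{1}_{\{\eta_t(x)\neq\mathfrak{s}\}}$. When it rings, with probability $\frac{\lambda}{1+\lambda}$ the value $\eta(x)$ is replaced by $\eta(x)\cdot\mathfrak{s}$; otherwise,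 with probability $\frac{p(y-x)}{1+\lambda}$ for each $y$, $\eta(x)$ is replaced by $\eta(x)-1$ and $\eta(y)$ by $\eta(y)+1$. For a translation-ergodic distribution $\nu$ on $(\mathbb{N}_{\mathfrak{s}})^{\mathbb{Z}^d}$ with finite density $\int|\eta(\boldsymbol{0})|\nu(\mathrm{d}\eta)<\infty$ there is a process $(\eta_t)_{t\geqslant0}$ with these rates and $\eta_0\sim\nu$; its law $\mathbf{P}^{\nu}$ is characterized by $\mathbf{P}^{\nu}(\mathcal{A})=\lim_{V\uparrow\mathbb{Z}^d}\mathbf{P}^{\nu}_V(\mathcal{A})$ for every event $\mathcal{A}$ determined by $(\eta_s(x))_{x\in B,\,s\in[0,t]}$ with $B$ finite and $t<\infty$, where $\mathbf{P}^{\nu}_V$ is the law of the (finite) system started from $\eta_0\cdot\mathbf{1}_V$, $V$ finite. The system stays active if, for each site, there are arbitrarily large times at which the site has at least one active particle. It fixates if, for each site, there is a (random) time after which the site is always either vacant or occupied by exactly one sleeping particle. Critical density: given $d$, $p(\cdot)$, $\lambda$, the critical density $\zeta_c$ is the unique number such that, for every translation-ergodic distribution $\nu$ supported on $(\mathbb{N}_0)^{\mathbb{Z}^d}$ (all particles initially active) with finite density $\zeta$, $\mathbf{P}^\nu(\text{system stays active})$ equals $0$ if $\zeta<\zeta_c$ and $1$ if $\zeta>\zeta_c$ (existence of such a number is a known theorem). *)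

(* Defs.v *)
From HB Require Import structures.
From mathcomp Require Import all_boot all_order all_algebra.
From mathcomp Require Import all_classical all_reals all_analysis.

Set Implicit Arguments.
Unset Strict Implicit.
Unset Printing Implicit Defensive.

Import Order.TTheory GRing.Theory Num.Theory.
Import numFieldNormedType.Exports.

Local Open Scope classical_set_scope.
Local Open Scope ring_scope.

Variant occupation := Active of nat | Sleeping.

HB.instance Definition _ := gen_eqMixin occupation.
HB.instance Definition _ := gen_choiceMixin occupation.
HB.instance Definition _ := isPointed.Build occupation (Active 0).

Definition particles (a : occupation) : nat :=
  if a is Active n then n else 1.

Definition active_particles (a : occupation) : nat :=
  if a is Active n then n else 0.

(* A particle that jumps onto a sleeping one wakes it up: s + 1 = 2. *)
Definition add_particle (a : occupation) : occupation :=
  if a is Active n then Active n.+1 else Active 2.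

(* [remove_particle] and [sleep] are only ever used at sites whose clock may
   ring, that is, at [Active n] with 0 < n; their other values are junk. *)
Definition remove_particle (a : occupation) : occupation :=
  if a is Active n then Active n.-1 else Sleeping.

Definition sleep (a : occupation) : occupation :=
  if a is Active 1 then Sleeping else a.

(* Configurations carry the product sigma-algebra of the discrete ones. *)
Definition config_cylinders : set (set (int -> occupation)) :=
  [set C | exists x a, C = [set eta | eta x = a]].

Definition config := g_sigma_algebraType config_cylinders.

Definition update (eta : config) (x : int) (a : occupation) : config :=
  fun y => if y == x then a else eta y.

Definition sleep_at (x : int) (eta : config) : config :=
  update eta x (sleep (eta x)).

Definition jump (x y : int) (eta : config) : config :=
  let eta' := update eta x (remove_particle (eta x)) in
  update eta' y (add_particle (eta' y)).

Definition restrict (V : set int) (eta : config) : config :=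
  fun x => if x \in V then eta x else Active 0.

Definition shift (z : int) (eta : config) : config := fun x => eta (x + z).

Section InitialDistribution.
Variable R : realType.
Implicit Type nu : probability config R.

Definition translation_invariant nu :=
  forall (z : int) (A : set config), measurable A -> nu (shift z @^-1` A) = nu A.

Definition translation_ergodic nu :=
  translation_invariant nu /\
  forall A : set config, measurable A ->
    (forall z : int, shift z @^-1` A = A) -> nu A = 0%E \/ nu A = 1%E.

Definition initially_active nu :=
  nu [set eta | forall x, eta x <> Sleeping] = 1%E.

Definition density nu : \bar R := (\int[nu]_eta ((particles (eta 0))%:R)%:E)%E.

End InitialDistribution.

Section Paths.
Variable R : realType.

(* Only times t >= 0 matter: the values of a path at negative times are junk,
   unconstrained and not observed by the sigma-algebra below.  Each coordinate
   is cadlag for the discrete topology on [occupation]. *)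
Definition cadlag (w : R -> config) : Prop :=
  forall x : int,
    (forall t, 0 <= t -> \forall s \near t^'+, w s x = w t x) /\
    (forall t, 0 < t -> exists a, \forall s \near t^'-, w s x = a).

Record raw_path := RawPath { path_val :> R -> config ; _ : cadlag path_val }.

Lemma cadlag_cst (eta : config) : cadlag (fun=> eta).
Proof.
move=> x; split=> [t _|t _]; first exact: nearW.
by exists (eta x); exact: nearW.
Qed.

HB.instance Definition _ := gen_eqMixin raw_path.
HB.instance Definition _ := gen_choiceMixin raw_path.
HB.instance Definition _ :=
  isPointed.Build raw_path (RawPath (cadlag_cst (fun=> Active 0))).

Definition path_cylinders (B : set int) (I : set R) : set (set raw_path) :=
  [set C | exists x t a, [/\ B x, I t & C = [set w : raw_path | w t x = a]]].

Definition path := g_sigma_algebraType (path_cylinders setT [set t | 0 <= t]).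

(* The events determined by (eta_s(x)) for x in B and s in [0, T]. *)
Definition determined_by (B : set int) (T : R) (A : set path) : Prop :=
  <<s path_cylinders B `[0, T] >> A.

Definition stays_active : set path :=
  [set w | forall (x : int) (T : R), 0 <= T ->
    exists2 t, T <= t & (0 < active_particles (w t x))%N].

End Paths.

Section Dynamics.
Variables (R : realType) (p : int -> R) (lambda : R).

(* The sums below are over the finite support of the summand: at a
   configuration with finitely many particles, only finitely many sites have a
   positive clock rate, and a jump distribution has finite support.  The
   generator is only meaningful at such configurations. *)
Definition generator (f : config -> R) (eta : config) : R :=
  \sum_(x \in [set: int])
    (1 + lambda) * (active_particles (eta x))%:R *
    (lambda / (1 + lambda) * (f (sleep_at x eta) - f eta) +
     \sum_(y \in [set: int])
       p (y - x) / (1 + lambda) * (f (jump x y eta) - f eta)).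

(* exp (t L), for L the generator.  The number of particles is conserved and
   bounds the total clock rate, hence the series converges for f bounded. *)
Definition semigroup (t : R) (f : config -> R) (eta : config) : R :=
  limn (series (fun n => t ^+ n / n`!%:R * iter n generator f eta)).

Definition transition (t : R) (eta eta' : config) : R :=
  semigroup t (\1_[set eta']) eta.

(* P is the law of the continuous-time Markov chain with the above generator,
   started from eta_0 1_V with eta_0 distributed as nu.  As V is finite, this
   chain lives on the countable set of configurations with finitely many
   particles, so its law is given by the following point masses. *)
Definition finite_ARW_law (nu : probability config R) (V : set int)
    (P : probability (path R) R) : Prop :=
  forall (n : nat) (t : nat -> R) (eta : nat -> config),
    t 0%N = 0 -> (forall i, t i <= t i.+1) ->
    P [set w | forall i, (i <= n)%N -> w (t i) = eta i] =
    (nu (restrict V @^-1` [set eta 0%N]) *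
     (\prod_(i < n) transition (t i.+1 - t i) (eta i) (eta i.+1))%:E)%E.

Definition finite_sets_up : set_system (set int) :=
  filter_from finite_set (fun V0 => [set V | finite_set V /\ V0 `<=` V]).

Definition ARW_law (nu : probability config R) (P : probability (path R) R) :
    Prop :=
  exists PV : set int -> probability (path R) R,
    (forall V, finite_set V -> finite_ARW_law nu V (PV V)) /\
    forall (B : set int) (T : R) (A : set (path R)),
      finite_set B -> determined_by B T A ->
      PV V A @[V --> finite_sets_up] --> P A.

(* The law of the process started from nu exists and is unique; it is the P
   below. *)
Definition critical_density (zc : R) : Prop :=
  forall (nu : probability config R) (z : R),
    translation_ergodic nu -> initially_active nu -> density nu = z%:E ->
    exists2 P, ARW_law nu P &
      (z < zc -> P (@stays_active R) = 0%E) /\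
      (zc < z -> P (@stays_active R) = 1%E).

End Dynamics.

Definition symmetric_walk (R : realType) (z : int) : R :=
  if `|z|%N == 1%N then 2^-1 else 0.

(* Main.v *)
(** Let K >= 1 and let lam be so small that 32 * 6^(8K) * lam <= 1; the claim is
    that zeta_c <= 1/K.  Otherwise the process started from a uniformly shifted
    copy of the lattice KZ does not stay active, and a conditional
    Borel-Cantelli argument shows that the probability that the origin is active
    at time n tends to 0.  Consider N = 2M particles, on a stretch of v = KN
    sites of KZ, in an otherwise empty line.  By comparison with the infinite
    system, each site away from the ends is active with a small probability at
    all times in [n0, 2 n0 + 1].  The squared L2 distance between the current
    and the initial distribution function of the particles is nonnegative, and
    its drift is at most minus the sum of the squares of the numbers of active
    particles, up to a linear term; so many active particles cannot be stacked
    on few sites during the whole of [n0, 2 n0 + 1].  Hence at some time in this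
    interval, with positive probability, at least M particles sleep and all
    particles are within distance O(v).

    On the other hand, a given configuration with sleepers at
    a_0 < ... < a_m is reached at time t with probability at most
    e (2 + c t) \prod_i (2 lam (a_(i+1) - a_i)).  This bounds the value of a game
    in which a player chooses the order of the topplings.  As topplings commute,
    an order that settles the sleepers from left to right is optimal; whenever
    sleep is declined, the walker may be followed until it wakes the previous
    sleeper or comes back, which gives the factors.  The product is at most
    (2 lam)^m 2^O(v), and there are at most 2^N 3^O(v) target configurations: for
    small lam and large M this contradicts the first part. *)

From HB Require Import structures.
Require Import Defs.
From mathcomp Require Import all_boot all_order all_algebra.
From mathcomp Require Import all_classical all_reals all_analysis.
From mathcomp Require Import measurable_realfun.
From mathcomp Require Import zify ring lra.
Import Order.TTheory GRing.Theory Num.Theory.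
Import numFieldNormedType.Exports.

Set Implicit Arguments.
Unset Strict Implicit.
Unset Printing Implicit Defensive.

Local Open Scope classical_set_scope.
Local Open Scope ring_scope.

(** * Sites, supports and topplings *)

(** The order of the quantifiers makes the two halves meet. The activity level delta obtained from
    the lattice depends on K and lambda alone. Fixation then determines n0, the approximation of the
    infinite process at the finitely many integer times up to 2 n0 + 2 determines a margin b, and
    only afterwards is the block taken long. A site at distance at least b from the ends can be
    carried to the origin by a shift; the shifted block is the trace of one of the K translates of
    KZ and so has probability at least 1/K. The finite system is given only through power series and
    point masses. Positivity of the semigroup, finiteness of the support at all times and the Markov
    property for general events therefore have to be derived: the first by uniformization, the
    others from the tightness that the spread supplies. *)

Definition active (eta : config) (x : int) : bool :=
  (0 < active_particles (eta x))%N.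

(** [A] is the set of sites where sleep is accepted: [predT] gives the true dynamics, the sleepers
    of a target give the game in which sleep is declined elsewhere. *)
Definition nap (A : pred int) (x : int) (eta : config) : config :=
  if A x then sleep_at x eta else eta.

Lemma nap_predT x eta : nap predT x eta = sleep_at x eta.
Proof. by []. Qed.

Lemma napE A x eta w :
  nap A x eta w = if (w == x) && A x then sleep (eta x) else eta w.
Proof.
by rewrite /nap /sleep_at /update; case: (A x); rewrite ?andbT ?andbF //.
Qed.

Lemma jumpE x y eta w : y != x ->
  jump x y eta w = if w == x then remove_particle (eta x)
                   else if w == y then add_particle (eta y) else eta w.
Proof.
move=> yx; rewrite /jump /update (negbTE yx).
case: (eqVneq w y) => [->|//]; by rewrite (negbTE yx).
Qed.

Lemma activeP eta x : reflect (exists k, eta x = Active k.+1) (active eta x).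
Proof.
rewrite /active; case: (eta x) => [[|k]|] /=; apply: (iffP idP) => //.
- by case.
- by move=> _; exists k.
- by case.
Qed.

Lemma active_nap A x y eta : x != y -> active (nap A x eta) y = active eta y.
Proof. by move=> xy; rewrite /active napE eq_sym (negbTE xy). Qed.

Lemma active_jump x z y eta :
  z != x -> x != y -> active eta y -> active (jump x z eta) y.
Proof.
move=> zx xy; rewrite /active jumpE// (eq_sym y x) (negbTE xy).
case: (eqVneq y z) => [<-|//]; by case: (eta y).
Qed.

Lemma napC A x y eta : nap A x (nap A y eta) = nap A y (nap A x eta).
Proof.
case: (eqVneq x y) => [->//|xy]; apply/funext => w; rewrite !napE.
have yx : y == x = false by rewrite eq_sym (negbTE xy).
rewrite (negbTE xy) yx /=.
case: (eqVneq w x) => [->|_] /=; first by rewrite (negbTE xy).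
by [].
Qed.

(** The delicate case is a jump onto x with one particle there: falling asleep and being woken by s
    + 1 = 2 has the same result as the arrival first, after which sleep has no effect. An empty x
    must be excluded, since the arriving particle could then fall asleep. *)
Lemma nap_jumpC A x y z eta : z != y -> x != y -> active eta x ->
  nap A x (jump y z eta) = jump y z (nap A x eta).
Proof.
move=> zy xy /activeP[k ek]; apply/funext => w.
rewrite napE !jumpE// !napE (eq_sym y x) (negbTE xy) /=.
case: (eqVneq w x) => [->|wx] /=.
  rewrite (negbTE xy) (eq_sym z x).
  case: (eqVneq x z) => [<-|//]; rewrite ek /=.
  by case: (A x) => //; case: k {ek}.
case: (eqVneq w y) => // wy; case: (eqVneq w z) => // wz.
by rewrite -wz (negbTE wx).
Qed.

Lemma jumpC x x' y y' eta : x' != x -> y' != y -> x != y ->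
  active eta x -> active eta y ->
  jump x x' (jump y y' eta) = jump y y' (jump x x' eta).
Proof.
move=> x'x y'y xy /activeP[k ek] /activeP[l el]; apply/funext => w.
have yx : y != x by rewrite eq_sym.
rewrite !jumpE// (negbTE xy) (negbTE yx).
case: (eqVneq w x) => [->|wx].
  rewrite (negbTE xy) /=.
  case: (eqVneq x y') => [xy'|xy']; last by [].
  by rewrite -xy' ek.
case: (eqVneq w y) => [->|wy].
  case: (eqVneq y x') => [yx'|yx']; last by rewrite /=.
  by rewrite -yx' el.
case: (eqVneq w x') => [wx'|wx'].
  rewrite -wx' (negbTE wy).
  case: (eqVneq w y') => [wy'|wy']; last by [].
  by rewrite -wy' (negbTE wx) ?eqxx.
case: (eqVneq w y') => // wy'.
by rewrite -wy' (negbTE wx) (negbTE wx').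
Qed.

Lemma addr1_neq (x : int) : x + 1 != x. Proof. by lia. Qed.
Lemma subr1_neq (x : int) : x - 1 != x. Proof. by lia. Qed.
#[local] Hint Resolve addr1_neq subr1_neq : core.

Section Topple.
Variables (R : realType) (lam : R).
Hypothesis lam_gt0 : 0 < lam.
Implicit Types (f g : config -> R) (A : pred int).

(** The mean of [f] after one ring at an active x of the symmetric walk; a declined sleep is a ring
    without effect. *)
Definition topple A (x : int) f (eta : config) : R :=
  lam / (1 + lam) * f (nap A x eta) +
  (2 * (1 + lam))^-1 * (f (jump x (x + 1) eta) + f (jump x (x - 1) eta)).

Lemma topple_weight : lam / (1 + lam) + (2 * (1 + lam))^-1 * 2 = 1.
Proof.
have h : 1 + lam != 0 by apply: lt0r_neq0; move: lam_gt0; lra.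
by field.
Qed.

Lemma topple_w1 : 0 <= lam / (1 + lam).
Proof. by apply: divr_ge0; move: lam_gt0; lra. Qed.

Lemma topple_w2 : 0 <= (2 * (1 + lam))^-1.
Proof. by rewrite invr_ge0; move: lam_gt0; lra. Qed.

Lemma topple_le A x f g eta :
  f (nap A x eta) <= g (nap A x eta) ->
  f (jump x (x + 1) eta) <= g (jump x (x + 1) eta) ->
  f (jump x (x - 1) eta) <= g (jump x (x - 1) eta) ->
  topple A x f eta <= topple A x g eta.
Proof.
move=> h0 h1 h2; rewrite /topple lerD// ler_wpM2l// ?topple_w1 ?topple_w2//.
by rewrite lerD.
Qed.

Lemma topple_cst A x k eta : topple A x (fun=> k) eta = k.
Proof.
transitivity ((lam / (1 + lam) + (2 * (1 + lam))^-1 * 2) * k).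
  by rewrite /topple; ring.
by rewrite topple_weight mul1r.
Qed.

Lemma toppleZ A x k f eta :
  topple A x (fun xi => k * f xi) eta = k * topple A x f eta.
Proof. by rewrite /topple; ring. Qed.

Lemma toppleD A x f g eta :
  topple A x (fun xi => f xi + g xi) eta = topple A x f eta + topple A x g eta.
Proof. by rewrite /topple; ring. Qed.

(** The abelian property in mean: each of the nine pairs of outcomes at x and y commutes. *)
Lemma toppleC A x y f eta : x != y -> active eta x -> active eta y ->
  topple A x (topple A y f) eta = topple A y (topple A x f) eta.
Proof.
move=> xy ax ay; have yx : y != x by rewrite eq_sym.
rewrite /topple (@napC A x y).
rewrite !(@nap_jumpC A x y)// !(@nap_jumpC A y x)//.
rewrite !(@jumpC x _ y)//.
set a := lam / _; set b := _^-1; ring.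
Qed.

End Topple.

(** * Finitely supported configurations and linear statistics *)

Definition supp_in (s : seq int) (eta : config) : Prop :=
  forall x, x \notin s -> eta x = Active 0.

Definition finsupp (eta : config) : Prop := exists s, supp_in s eta.

Lemma fsumE (R : nmodType) (F : int -> R) (s : seq int) :
  uniq s -> (forall x, x \notin s -> F x = 0) ->
  \sum_(x \in [set: int]) F x = \sum_(x <- s) F x.
Proof.
move=> us Fs; rewrite [RHS]fsbig_seq//; apply/esym; apply: fsbig_widen => //.
by move=> x [_ /= /negP /Fs].
Qed.

Lemma sum_delta (R : pzSemiRingType) (F : int -> R) (s : seq int) x :
  uniq s -> x \in s -> \sum_(w <- s) F w * (w == x)%:R = F x.
Proof.
move=> us xs; rewrite (bigD1_seq x)//= eqxx mulr1 big1 ?addr0// => w wx.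
by rewrite (negbTE wx) mulr0.
Qed.

Lemma supp_in_sub {s s' eta} :
  {subset s <= s'} -> supp_in s eta -> supp_in s' eta.
Proof. by move=> ss' h x xs'; apply: h; apply: contra xs'; apply: ss'. Qed.

Lemma supp_in_undup {s eta} : supp_in s eta -> supp_in (undup s) eta.
Proof. by apply: supp_in_sub => x; rewrite mem_undup. Qed.

Lemma supp_in_nap A x s eta :
  supp_in s eta -> supp_in s (nap A x eta).
Proof.
move=> h w ws; rewrite napE; case: (eqVneq w x) => /= [<-|_]; last exact: h.
by case: (A w); rewrite ?h.
Qed.

Lemma supp_in_jump x y s eta : x \in s ->
  supp_in s eta -> supp_in (y :: s) (jump x y eta).
Proof.
move=> xs h w; rewrite inE negb_or => /andP[wy ws].
rewrite /jump /update (negbTE wy) ifN ?h//.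
by apply: contra ws => /eqP ->.
Qed.

Lemma active_supp x s eta : supp_in s eta -> active eta x -> x \in s.
Proof.
by move=> h; apply: contraLR => /h; rewrite /active => ->.
Qed.

Section Lin.
Variable R : realType.
Implicit Types chi : int -> R.

(** Sleepers count like active particles, so only jumps change this statistic. *)
Definition lin chi (eta : config) : R :=
  \sum_(x \in [set: int]) chi x * (particles (eta x))%:R.

Lemma linE chi s eta : uniq s -> supp_in s eta ->
  lin chi eta = \sum_(x <- s) chi x * (particles (eta x))%:R.
Proof. by move=> us h; apply: fsumE => // x /h ->; rewrite mulr0. Qed.

Lemma particles_nap A x eta w : particles (nap A x eta w) = particles (eta w).
Proof.
rewrite napE; case: (eqVneq w x) => [->|//] /=; case: (A x) => //=.
by case: (eta x) => [[|[|k]]|].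
Qed.

Lemma particles_jump x y eta w : y != x -> active eta x ->
  (particles (jump x y eta w))%:R =
  (particles (eta w))%:R - (w == x)%:R + (w == y)%:R :> R.
Proof.
move=> yx /activeP[k ek]; rewrite jumpE//.
case: (eqVneq w x) => [->|wx].
  by rewrite ek eq_sym (negbTE yx) /= -natr1; ring.
rewrite subr0; case: (eqVneq w y) => [->|]; last by rewrite addr0.
by case: (eta y) => [l|] /=; rewrite natr1.
Qed.

Lemma lin_nap chi A x eta : lin chi (nap A x eta) = lin chi eta.
Proof. by apply: eq_fsbigr => w _; rewrite particles_nap. Qed.

Lemma lin_jump chi x y eta : finsupp eta -> y != x -> active eta x ->
  lin chi (jump x y eta) = lin chi eta - chi x + chi y.
Proof.
move=> [s hs] yx ax.
have xs : x \in s := active_supp hs ax.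
pose s' := undup (y :: s).
have us' : uniq s' by rewrite undup_uniq.
rewrite (linE _ us')//; last by apply/supp_in_undup/supp_in_jump.
rewrite (linE _ us')//; last first.
  by apply/supp_in_undup; apply: supp_in_sub hs => w; rewrite inE orbC => ->.
under eq_bigr do rewrite particles_jump// mulrDr mulrBr.
rewrite big_split sumrB /= !sum_delta// mem_undup inE ?eqxx// xs orbT//.
Qed.

Lemma finsupp_nap A x eta : finsupp eta -> finsupp (nap A x eta).
Proof. by move=> [s hs]; exists s; apply: supp_in_nap. Qed.

Lemma finsupp_jump x y eta : active eta x -> finsupp eta ->
  finsupp (jump x y eta).
Proof.
move=> ax [s hs]; exists (y :: s); apply: supp_in_jump => //.
exact: active_supp ax.
Qed.

Lemma le_lin chi chi' eta : finsupp eta -> (forall x, chi x <= chi' x) ->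
  lin chi eta <= lin chi' eta.
Proof.
move=> [s /supp_in_undup hs] h; rewrite !(linE _ _ hs) ?undup_uniq//.
by apply: ler_sum => x _; apply: ler_wpM2r.
Qed.

Lemma lin_ge0 chi eta : (forall x, 0 <= chi x) -> 0 <= lin chi eta.
Proof. by move=> h; apply: fsumr_ge0 => x _; apply: mulr_ge0. Qed.

(** The N-particle sector. It is invariant under topplings and bounds the total clock rate, so the
    semigroup estimates are made on it. *)
Definition confN (N : nat) (eta : config) : Prop :=
  finsupp eta /\ lin (fun=> 1) eta = N%:R.

Lemma confN_nap N A x eta : confN N eta -> confN N (nap A x eta).
Proof. by move=> [h1 h2]; split; [exact: finsupp_nap | rewrite lin_nap]. Qed.

Lemma confN_jump N x y eta : y != x -> active eta x -> confN N eta ->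
  confN N (jump x y eta).
Proof.
move=> yx ax [h1 h2]; split; first exact: finsupp_jump.
by rewrite lin_jump// h2 subrK.
Qed.

Lemma confN_le_eq N eta eta' : confN N eta -> confN N eta' ->
  (forall x, (particles (eta x) <= particles (eta' x))%N) ->
  forall x, particles (eta x) = particles (eta' x).
Proof.
move=> [[s hs] e1] [[s' hs'] e2] le_ x.
pose r := undup (x :: s ++ s').
have ur : uniq r by exact: undup_uniq.
have h1 : supp_in r eta.
  by apply/supp_in_undup; apply: supp_in_sub hs => w ws; rewrite inE mem_cat ws orbT.
have h2 : supp_in r eta'.
  by apply/supp_in_undup; apply: supp_in_sub hs' => w ws; rewrite inE mem_cat ws !orbT.
have : \sum_(w <- r) ((particles (eta' w))%:R - (particles (eta w))%:R) = 0 :> R.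
  move: e1 e2; rewrite !(linE _ ur)// => e1 e2.
  rewrite sumrB; apply/eqP; rewrite subr_eq0; apply/eqP.
  under eq_bigr do rewrite -[_%:R]mul1r.
  by under [RHS]eq_bigr do rewrite -[_%:R]mul1r; rewrite e1 e2.
move=> /eqP; rewrite psumr_eq0 => [/allP /(_ x)|w _]; last first.
  by rewrite subr_ge0 ler_nat.
rewrite mem_undup inE eqxx => /(_ isT) /=.
by rewrite subr_eq0 eqr_nat => /eqP.
Qed.

End Lin.
Arguments confN : clear implicits.

(** * The toppling game *)

Definition asleep (a : occupation) : bool := if a is Sleeping then true else false.

Definition sleepers (eta : config) : pred int := fun x => asleep (eta x).

Lemma asleepP a : reflect (a = Sleeping) (asleep a).
Proof. by case: a => [n|]; constructor. Qed.

Section Game.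
Variables (R : realType) (lam : R).
Hypothesis lam_gt0 : 0 < lam.
Variables (tgt : config) (rho : R).
Hypotheses (rho_gt0 : 0 < rho) (rho_lt1 : rho < 1).

Local Notation A := (sleepers tgt).
Local Notation T := (topple lam A).

(** A toppling that is unavoidable on the way to the target: at the site of a target sleeper any
    active particle must still topple, elsewhere only a surplus has to leave. The condition survives
    topplings at other sites and fails everywhere at the target itself. *)
Definition legal (x : int) (xi : config) : bool :=
  if A x then active xi x
  else (active_particles (tgt x) < active_particles (xi x))%N.

Lemma legal_active x xi : legal x xi -> active xi x.
Proof. by rewrite /legal; case: (A x) => // /(leq_ltn_trans (leq0n _)). Qed.

Lemma legal_nap x y xi : x != y -> legal y xi -> legal y (nap A x xi).
Proof. by move=> xy; rewrite /legal /active napE eq_sym (negbTE xy). Qed.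

Lemma legal_jump x y z xi : z != x -> x != y -> legal y xi ->
  legal y (jump x z xi).
Proof.
move=> zx xy ly; have /activeP[k ek] := legal_active ly.
move: ly; rewrite /legal /active jumpE// eq_sym (negbTE xy).
by case: (eqVneq y z) => [<-|//]; rewrite ek /=; case: (A y) => // /ltnW.
Qed.

Definition supersol (g : config -> R) : Prop :=
  [/\ forall xi, 0 <= g xi, 1 <= g tgt &
      forall xi x, active xi x -> rho * T x g xi <= g xi].

(* The least supersolution: the optimal expectation of rho^n, where n is the
   number of moves after which a player choosing freely which active site to
   topple reaches tgt. *)
Definition value (xi : config) : R := inf [set g xi | g in supersol].

Lemma supersol1 : supersol (fun=> 1).
Proof.
by split=> // xi x _; rewrite topple_cst// mulr1 ltW.
Qed.

Lemma value_has_inf xi : has_inf [set g xi | g in supersol].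
Proof.
split; first by exists 1; exists (fun=> 1) => //; exact: supersol1.
by exists 0 => _ [g [g0 _ _] <-].
Qed.

Lemma value_least g xi : supersol g -> value xi <= g xi.
Proof.
by move=> sg; apply: ge_inf; [case: (value_has_inf xi) | exists g].
Qed.

Lemma le_value k xi : (forall g, supersol g -> k <= g xi) -> k <= value xi.
Proof.
move=> h; apply: lb_le_inf; first by case: (value_has_inf xi).
by move=> _ [g sg <-]; apply: h.
Qed.

Lemma value_ge0 xi : 0 <= value xi.
Proof. by apply: le_value => g []. Qed.

Lemma value_le1 xi : value xi <= 1.
Proof. exact: (value_least xi supersol1). Qed.

Lemma value_tgt : 1 <= value tgt.
Proof. by apply: le_value => g []. Qed.

Lemma value_super xi x : active xi x -> rho * T x value xi <= value xi.
Proof.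
move=> ax; apply: le_value => g sg; have [_ _ /(_ _ _ ax)] := sg.
apply: le_trans; rewrite ler_pM2l//; apply: topple_le => //;
  exact: value_least.
Qed.

(* Because topplings of distinct sites commute, every legal toppling is
   optimal: the value does not distinguish the player's order from ours. *)
Lemma value_legal y xi : legal y xi -> value xi <= rho * T y value xi.
Proof.
(* The player is forced to topple y whenever this is legal. As [value] lies below every
   supersolution, it suffices that the forced value is one. *)
pose g xi := if legal y xi then rho * T y value xi else value xi.
suff sg : supersol g by move=> ly; have := value_least xi sg; rewrite /g ly.
have g_le xi' : g xi' <= value xi'.
  by rewrite /g; case: ifP => // /legal_active; exact: value_super.
have T_ge0 x f xi' : (forall xi, 0 <= f xi) -> 0 <= T x f xi'.
  move=> f0; rewrite -(topple_cst lam_gt0 A x 0 xi').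
  by apply: topple_le => //.
split.
- move=> xi'; rewrite /g; case: ifP => _; last exact: value_ge0.
  by apply: mulr_ge0; [exact: ltW | apply: T_ge0; exact: value_ge0].
- rewrite /g ifN ?value_tgt// /legal /active /sleepers.
  by case: (tgt y) => [n|] //=; rewrite ltnn.
move=> xi' x ax; rewrite {2}/g; case: ifPn => ly; last first.
  apply: le_trans (value_super ax); rewrite ler_pM2l//.
  exact: topple_le.
rewrite ler_pM2l//; have [->|xy] := eqVneq x y; first exact: topple_le.
(* y stays legal after a toppling of x, so the two topplings can be exchanged by [toppleC]; the
   inner toppling of x is then bounded by [value_super]. *)
have gE xi1 : legal y xi1 -> g xi1 = rho * T y value xi1.
  by rewrite /g => ->.
have -> : T x g xi' = rho * T y (T x value) xi'.
  rewrite -toppleC ?(legal_active ly)//.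
  rewrite -toppleZ /topple !gE //; [exact: legal_jump.. | exact: legal_nap].
rewrite -toppleZ; apply: topple_le => //; apply: value_super.
- by rewrite active_nap// eq_sym.
- by apply: active_jump => //; rewrite eq_sym.
- by apply: active_jump => //; rewrite eq_sym.
Qed.

End Game.

(** A passage through y leaves no trace unless it wakes a sleeper. A long excursion can thus be
    stored as a single jump from its starting site. *)
Lemma jump_jump x y z eta : y != x -> z != y -> ~~ asleep (eta y) ->
  jump y z (jump x y eta) = jump x z eta.
Proof.
move=> yx zy; case ey : (eta y) => [c|//] _; apply/funext => w.
rewrite jumpE//; case: (eqVneq w y) => [->|wy].
  rewrite jumpE// (negbTE yx) eqxx ey /= /jump /update.
  by rewrite eq_sym (negbTE zy) (negbTE yx) ey.
rewrite jumpE//.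
rewrite (negbTE zy).
have -> : jump x y eta w = if w == x then remove_particle (eta x) else eta w.
  by rewrite jumpE// (negbTE wy).
rewrite /jump /update.
by case: (eqVneq w z).
Qed.

(** * The left-to-right strategy *)

Section Strategy.
Variables (R : realType) (lam : R).
Hypothesis lam_gt0 : 0 < lam.
Variables (tgt : config) (rho : R).
Hypotheses (rho_gt0 : 0 < rho) (rho_lt1 : rho < 1).
Variables (N : nat) (a : seq int).
Hypotheses (confN_tgt : confN R N tgt) (a_sorted : sorted <%O a).

Local Notation A := (sleepers tgt).
Local Notation T := (topple lam A).
Local Notation n := (size a).

Hypotheses (n_gt0 : (0 < n)%N) (mem_a : forall x, (x \in a) = A x).

(* The sites up to and including the k-th sleeper of tgt. *)
Definition settled (k : nat) (x : int) : bool := (0 < k)%N && (x <= a`_k.-1).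

Lemma settled_nth i k : (i < n)%N -> (k <= n)%N -> settled k a`_i = (i < k)%N.
Proof.
rewrite /settled => ilt; case: k => //= k klt.
by rewrite (lt_sorted_leq_nth 0 a_sorted).
Qed.

Lemma A_nth x : A x -> exists2 i, (i < n)%N & x = a`_i.
Proof.
by rewrite -mem_a => xa; exists (index x a); rewrite ?index_mem ?nth_index.
Qed.

Lemma nth_A i : (i < n)%N -> A a`_i.
Proof. by move=> ilt; rewrite -mem_a mem_nth. Qed.

Lemma settledW k x : (k < n)%N -> settled k x -> settled k.+1 x.
Proof.
rewrite /settled /=; case: k => //= k kn /le_trans; apply.
by rewrite (lt_sorted_leq_nth 0 a_sorted) ?inE// ltnW.
Qed.

Lemma settled_next k x : (k < n)%N -> A x -> settled k.+1 x -> ~~ settled k x -> x = a`_k.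
Proof.
move=> kn /A_nth[i ilt ->]; rewrite !settled_nth//; last exact: ltnW.
by rewrite ltnS -leqNgt => h1 h2; congr nth; apply/eqP; rewrite eqn_leq h1.
Qed.

(* In stage k everything up to the k-th sleeper is as in tgt, and nobody sleeps
   to the right of it; [full k] is the stage in which the remaining sleepers of
   tgt are still awake and all other particles have been used up. *)
Definition stage (k : nat) (xi : config) : Prop :=
  [/\ confN R N xi, forall x, settled k x -> xi x = tgt x &
      forall x, ~~ settled k x -> ~~ asleep (xi x)].

Definition full (k : nat) : config :=
  fun x => if settled k x then tgt x else if A x then Active 1 else tgt x.

Lemma asleep_full k x : asleep (full k x) = A x && settled k x.
Proof.
rewrite /full; case: (settled k x); first by rewrite andbT.
by case: ifPn => //= /negbTE.
Qed.

Lemma particles_full k x : particles (full k x) = particles (tgt x).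
Proof.
rewrite /full /sleepers; case: (settled k x) => //.
by case: (tgt x).
Qed.

Lemma stage_full k : stage k (full k).
Proof.
split; first 1 last.
- by move=> x kx; rewrite /full kx.
- by move=> x kx; rewrite asleep_full (negbTE kx) andbF.
have [[s hs] e] := confN_tgt; split.
  by exists s => x xs; rewrite /full /sleepers hs //= if_same.
by rewrite -e; apply: eq_fsbigr => x _; rewrite particles_full.
Qed.

(** Conservation of the number of particles: where no site has a surplus, none can have a
    deficit. *)
Lemma stage_eq_full k xi : stage k xi ->
  (forall x, ~~ settled k x ->
    (active_particles (xi x) <= if A x then 1 else active_particles (tgt x))%N)
  -> xi = full k.
Proof.
move=> [cxi xi_reg xi_nreg] xi_le; apply/funext => x.
have le_ y : (particles (xi y) <= particles (tgt y))%N.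
  have [/xi_reg -> //|ky] := boolP (settled k y).
  move: (xi_nreg _ ky) (xi_le _ ky); rewrite /sleepers.
  by case: (xi y) => // c _ /=; case: (tgt y).
have := confN_le_eq cxi confN_tgt le_ x.
rewrite /full; case: ifPn => [/xi_reg//|kx].
move: (xi_nreg _ kx); rewrite /sleepers.
by case: (xi x) => // c _ /=; case: (tgt x) => [l|] /= ->.
Qed.

Lemma stage_jump k xi y z : z != y -> stage k xi -> ~~ settled k y ->
  active xi y -> ~~ settled k z -> stage k (jump y z xi).
Proof.
move=> zy [cxi xi_reg xi_nreg] ky ay kz; split; first exact: confN_jump.
  move=> x kx; rewrite jumpE//; case: eqP => [xy|_].
    by rewrite -xy kx in ky.
  by case: eqP => [xz|_]; [rewrite -xz kx in kz | exact: xi_reg].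
move=> x kx; rewrite jumpE//; case: eqP => [_|_].
  by have /activeP[c ->] := ay.
by case: eqP => [_|_]; [case: (xi z) | exact: xi_nreg].
Qed.

(** Waking the last sleeper costs only one stage: the sites between the last two sleepers agree with
    the target and carry no sleeper. *)
Lemma stage_jump_back k xi y : (k < n)%N -> stage k.+1 xi ->
  ~~ settled k.+1 y -> active xi y -> stage k (jump y a`_k xi).
Proof.
move=> kn [cxi xi_reg xi_nreg] ky ay.
have zy : a`_k != y by apply: contraNneq ky => <-; rewrite settled_nth.
have kk : ~~ settled k a`_k by rewrite settled_nth ?ltnn// ltnW.
split; first exact: confN_jump.
  move=> x kx; rewrite jumpE// !ifN ?xi_reg ?settledW//.
    by apply: contraTneq kx => ->.
  by apply: contraTneq kx => ->; apply: contra ky; exact: settledW.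
move=> x kx; rewrite jumpE//; case: eqP => [_|_].
  by have /activeP[c ->] := ay.
case: eqP => [_|/eqP xk]; first by case: (xi _).
have [k1x|] := boolP (settled k.+1 x); last exact: xi_nreg.
rewrite xi_reg//; apply: contra xk => /settled_next h.
by apply/eqP; apply: h.
Qed.

Lemma full_next k : (k < n)%N -> full k a`_k = Active 1.
Proof.
by move=> kn; rewrite /full settled_nth ?ltnn ?nth_A// ltnW.
Qed.

Lemma nap_full k : (k < n)%N -> nap A a`_k (full k) = full k.+1.
Proof.
move=> kn; apply/funext => x; rewrite napE nth_A// andbT full_next//.
have tgtk : tgt a`_k = Sleeping by apply/asleepP; exact: nth_A.
case: eqP => [->|/eqP xk]; first by rewrite /full settled_nth// ltnSn tgtk.
rewrite /full; have [kx|kx] := boolP (settled k x); first by rewrite settledW.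
have [k1x|//] := boolP (settled k.+1 x).
case: ifPn => // Ax; move: xk; rewrite (settled_next kn Ax)//.
by rewrite eqxx.
Qed.

Lemma legal_full k : (k < n)%N -> legal tgt a`_k (full k).
Proof. by move=> kn; rewrite /legal nth_A// /active full_next. Qed.

Definition gap (j : nat) : R := (a`_j - a`_j.-1)%:~R.

Lemma gap_gt0 k : (k.+1 < n)%N -> 0 < gap k.+1.
Proof.
move=> kn; rewrite /gap ltr0z subr_gt0 /=.
by rewrite (lt_sorted_ltn_nth 0 a_sorted) ?inE// ltnW.
Qed.

(** Balance at [full k.+1]: sleep, with weight lam, gains [step k.+1]; a jump to the left, with
    weight 1/2, reaches the previous sleeper before returning with probability 1 / [gap k.+1], and
    then loses [step k]. Equality gives the factor 2 lam gap; the last step is normalized to 1. *)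
Definition step (i : nat) : R := \prod_(i.+1 <= j < n) (2 * lam * gap j).

Lemma stepS k : (k.+1 < n)%N -> step k = 2 * lam * gap k.+1 * step k.+1.
Proof. by move=> kn; rewrite /step big_ltn. Qed.

Lemma step_ge0 k : 0 <= step k.
Proof.
rewrite /step big_seq_cond prodr_ge0// => j; rewrite andbT mem_index_iota.
move=> /andP[kj jn]; case: j => // j in kj jn *.
by rewrite !mulr_ge0 ?ltW ?gap_gt0// ltr0n.
Qed.

(* The scale function of the birth-and-death chain that counts the sleepers. *)
Definition scale (k : nat) : R := \sum_(i < k) step i.

Lemma scaleS k : scale k.+1 = scale k + step k.
Proof. by rewrite /scale big_ord_recr. Qed.

Lemma scale_ge0 k : 0 <= scale k.
Proof. by apply: sumr_ge0 => i _; exact: step_ge0. Qed.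

Lemma scale_last : 1 <= scale n.
Proof.
have -> : n = n.-1.+1 by rewrite prednK.
rewrite scaleS [step _]big_geq ?prednK// lerDr; exact: scale_ge0.
Qed.

(** To the left of the first sleeper there is nothing to wake, so stage 0 has gains without losses.
    Each is worth at most [step 0], and the discount sums them as a geometric series. *)
Definition slack : R := step 0 / (1 - rho).

Lemma slack_ge0 : 0 <= slack.
Proof. by rewrite divr_ge0 ?step_ge0// subr_ge0 ltW. Qed.

Local Notation value := (value lam tgt rho).

Let value_le1 := @value_le1 R lam lam_gt0 tgt rho rho_lt1.
Let value_legal := @value_legal R lam lam_gt0 tgt rho rho_gt0 rho_lt1.

Lemma topple_value_le y xi (u b : R) :
  value (nap A y xi) <= b + u ->
  value (jump y (y + 1) xi) <= b ->
  value (jump y (y - 1) xi) <= b ->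
  T y value xi <= b + lam / (1 + lam) * u.
Proof.
move=> h0 h1 h2; rewrite /topple.
have w1 := topple_w1 lam_gt0; have w2 := topple_w2 lam_gt0.
have e := topple_weight lam_gt0.
have -> : b + lam / (1 + lam) * u = lam / (1 + lam) * (b + u) +
   (2 * (1 + lam))^-1 * (b + b).
  transitivity ((lam / (1 + lam) + (2 * (1 + lam))^-1 * 2) * b + lam / (1 + lam) * u).
    by rewrite e mul1r.
  by ring.
by rewrite lerD// ler_wpM2l// lerD.
Qed.

(** After m moves the trivial bound 1 on [value] is used, discounted to rho^m; this replaces a proof
    that the strategy terminates. *)
Definition stage_bound (m : nat) : Prop := forall k xi, (k <= n)%N ->
  stage k xi -> value xi <= scale k + slack + rho ^+ m.

(* A lone walker that left the site a_(k+1) of [full k.+1] either comes back to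
   it or reaches a_k, which wakes the sleeper there; the bound is linear in its
   position p, hence harmonic. *)
Definition walk_bound (m : nat) : Prop := forall k p, (k.+1 < n)%N ->
  a`_k <= p <= a`_k.+1 ->
  value (jump a`_k.+1 p (full k.+1)) <=
  scale k.+1 - step k * ((a`_k.+1 - p)%:~R / gap k.+1) + slack + rho ^+ m.

(** One move: topple a site with a surplus if there is one, otherwise try to settle the next
    sleeper. *)
Lemma stage_step m : stage_bound m -> walk_bound m -> stage_bound m.+1.
Proof.
move=> hs hw k xi kn st.
have sc0 := scale_ge0; have sl0 := slack_ge0.
have rm0 : 0 <= rho ^+ m by rewrite exprn_ge0// ltW.
have [cxi xi_reg xi_nreg] := st.
pose extra y := ~~ settled k y && ((if A y then 1
   else active_particles (tgt y)) < active_particles (xi y))%N.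
have [[y /andP[ky]]|noextra] := pselect (exists y, extra y); last first.
  have {}noextra x : ~~ settled k x ->
    (active_particles (xi x) <= if A x then 1 else active_particles (tgt x))%N.
    move=> kx; rewrite leqNgt; apply/negP => h; apply: noextra.
    by exists x; rewrite /extra kx.
  have -> := stage_eq_full st noextra.
  (* With all sleepers settled the target is reached, and [scale n] is at least 1. *)
  have [->|kn'] := eqVneq k n.
    apply: le_trans (value_le1 _) _.
    have := scale_last; have : 0 <= rho ^+ m.+1 by rewrite exprn_ge0// ltW.
    by have := sl0; lra.
  have {kn'} kn : (k < n)%N by rewrite ltn_neqAle kn'.
  apply: le_trans (value_legal (legal_full kn)) _.
  have ak : active (full k) a`_k by rewrite /active full_next.
  have kk : ~~ settled k a`_k by rewrite settled_nth ?ltnn// ltnW.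
  have h0 : value (nap A a`_k (full k)) <= scale k + step k + slack + rho ^+ m.
    by rewrite nap_full// -scaleS; apply: hs => //; exact: stage_full.
  have h1 : value (jump a`_k (a`_k + 1) (full k)) <= scale k + slack + rho ^+ m.
    apply: hs; first exact: ltnW.
    apply: stage_jump => //; first exact: stage_full.
    apply: contra kk; rewrite /settled => /andP[-> /=]; apply: le_trans.
    by rewrite lerDl.
  have w1 := topple_w1 lam_gt0; have w2 := topple_w2 lam_gt0.
  have e := topple_weight lam_gt0.
  (* From stage 0 both jumps stay in stage 0 and [slack] pays for the gain from sleep; later, the
     left jump starts a walk whose expected loss balances the gain exactly. *)
  case: k => [|k] in kn h0 h1 ak kk cxi xi_reg xi_nreg st extra noextra *.
    have h2 : value (jump a`_0 (a`_0 - 1) (full 0)) <=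
              scale 0 + slack + rho ^+ m.
      apply: hs => //; apply: stage_jump => //; exact: stage_full.
    have := @topple_value_le a`_0 (full 0) (step 0) (scale 0 + slack + rho ^+ m).
    have -> : scale 0 + slack + rho ^+ m + step 0 =
              scale 0 + step 0 + slack + rho ^+ m by ring.
    move=> /(_ h0 h1 h2) h; apply: (le_trans (ler_wpM2l (ltW rho_gt0) h)).
    rewrite exprS; have -> : scale 0 = 0 by rewrite /scale big_ord0.
    have sE : step 0 = (1 - rho) * slack.
      by rewrite /slack mulrC divfK// subr_eq0 gt_eqF.
    rewrite add0r !mulrDr addrAC lerD2r.
    have la1 : lam / (1 + lam) <= 1.
      by rewrite ler_pdivrMr ?mul1r; move: lam_gt0; lra.
    have : rho * (lam / (1 + lam) * step 0) <= step 0.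
      rewrite mulrA ler_piMl ?step_ge0//.
      by apply: mulr_ile1 => //; exact: ltW.
    rewrite {2}sE; lra.
  have h2 := hw k (a`_k.+1 - 1) kn.
  have /h2 {}h2 : a`_k <= a`_k.+1 - 1 <= a`_k.+1.
    have lt_a : a`_k < a`_k.+1.
      by rewrite (lt_sorted_ltn_nth 0 a_sorted) ?inE// ltnW.
    by rewrite lerBrDr -ltzD1 ltrD2r lt_a gerDl.
  rewrite opprB addrCA subrr addr0 in h2.
  have g0 := gap_gt0 kn.
  have sE : step k / gap k.+1 = 2 * lam * step k.+1.
    have g1 : gap k.+1 != 0 by exact: lt0r_neq0.
    by rewrite (stepS kn) mulrAC mulfK.
  have {}h2 : value (jump a`_k.+1 (a`_k.+1 - 1) (full k.+1)) <=
     scale k.+1 - 2 * lam * step k.+1 + slack + rho ^+ m.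
    by move: h2; rewrite mulrA mulr1 sE.
  suff h : T a`_k.+1 value (full k.+1) <= scale k.+1 + slack + rho ^+ m.
    apply: (le_trans (ler_wpM2l (ltW rho_gt0) h)).
    rewrite exprS mulrDr lerD2r.
    by apply: ler_piMl; [exact: addr_ge0 | exact: ltW].
  rewrite /topple.
  apply: (@le_trans _ _ (lam / (1 + lam) * (scale k.+1 + step k.+1 + slack + rho ^+ m) +
    (2 * (1 + lam))^-1 * ((scale k.+1 + slack + rho ^+ m) + (scale k.+1 - 2 * lam * step k.+1 + slack + rho ^+ m)))).
    by rewrite lerD// ler_wpM2l// lerD.
  have l1 : 1 + lam != 0 by apply: lt0r_neq0; move: lam_gt0; lra.
  rewrite le_eqVlt; apply/orP; left; apply/eqP; field.
  by [].
move=> ext.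
have ay : active xi y by apply: leq_ltn_trans ext.
have ly : legal tgt y xi.
  by move: ext; rewrite /legal; case: ifP => // _; exact: ltnW.
apply: le_trans (value_legal ly) _.
have jb z : z = y + 1 \/ z = y - 1 ->
    value (jump y z xi) <= scale k + slack + rho ^+ m.
  move=> zE; have zy : z != y by case: zE => ->.
  have [kz|kz] := boolP (settled k z); last first.
    by apply: hs => //; exact: stage_jump.
  case: k => [//|k] in kn st ky kz hs {cxi xi_reg xi_nreg extra} *.
  (* A settled neighbour of an unsettled site is the last settled sleeper, which the jump wakes. *)
  have zk : z = a`_k.
    move: ky kz; rewrite /settled /=; clear -zE; move: (a`_k) => c.
    by case: zE => ->; lia.
  apply: (@le_trans _ _ (scale k + slack + rho ^+ m)).
    by rewrite zk; apply: hs; [exact: ltnW | exact: stage_jump_back].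
  by rewrite scaleS !lerD// lerDl step_ge0.
(* Sleep has no effect here: it is declined at y, or y has at least two particles. *)
have h0 : value (nap A y xi) <= scale k + slack + rho ^+ m + 0.
  rewrite addr0; suff -> : nap A y xi = xi by exact: hs.
  apply/funext => x; rewrite napE; case: eqP => //= ->.
  case: ifP => // Ay; move: ext; rewrite Ay.
  by case: (xi y) => [[|[|c]]|].
have := topple_value_le h0 (jb _ (or_introl erefl)) (jb _ (or_intror erefl)).
rewrite mulr0 addr0 => h; apply: (le_trans (ler_wpM2l (ltW rho_gt0) h)).
rewrite exprS mulrDr lerD2r.
by apply: ler_piMl; [exact: addr_ge0 | exact: ltW].
Qed.

(** At the two end points no move is made, so the stage bound is needed for [m.+1] already; this
    dictates the order of the induction. In between there is no target sleeper: sleep is declined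
    and the linear bound is harmonic. *)
Lemma walk_step m : stage_bound m.+1 -> walk_bound m -> walk_bound m.+1.
Proof.
move=> hs hw k p kn /andP[lo hi].
have sc0 := scale_ge0; have sl0 := slack_ge0; have g0 := gap_gt0 kn.
have kk1 : ~~ settled k.+1 a`_k.+1 by rewrite settled_nth ?ltnn// ltnW.
have ak : active (full k.+1) a`_k.+1 by rewrite /active full_next.
have lt_a : a`_k < a`_k.+1.
  by rewrite (lt_sorted_ltn_nth 0 a_sorted) ?inE// ltnW.
have [->|phi] := eqVneq p a`_k.+1.
  rewrite subrr mul0r mulr0 subr0; apply: hs; first exact: ltnW.
  suff -> : jump a`_k.+1 a`_k.+1 (full k.+1) = full k.+1 by exact: stage_full.
  apply/funext => x; rewrite /jump /update eqxx full_next//=.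
  by case: eqP => // ->; rewrite full_next.
have [pE|plo] := eqVneq p a`_k.
  rewrite pE -/(gap k.+1) divff ?gt_eqF// mulr1 scaleS addrK.
  apply: hs; first by do 2 apply: ltnW.
  apply: stage_jump_back => //; [exact: ltnW | exact: stage_full].
have nAp : ~~ A p.
  apply/negP => /A_nth[i ilt pE]; move: lo hi phi plo; rewrite pE.
  rewrite !le_eqVlt => lo hi phi plo; move: lo hi.
  rewrite (negbTE phi) eq_sym (negbTE plo) /=.
  by rewrite !(lt_sorted_ltn_nth 0 a_sorted) ?inE//; [lia | exact: ltnW].
have plo' : a`_k < p by rewrite lt_neqAle eq_sym plo.
have phi' : p < a`_k.+1 by rewrite lt_neqAle phi.
have rp : ~~ settled k.+1 p by rewrite /settled /= -ltNge.
have fp : full k.+1 p = tgt p by rewrite /full (negbTE rp) (negbTE nAp).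
set xi := jump a`_k.+1 p (full k.+1).
have xip : xi p = add_particle (tgt p).
  by rewrite /xi jumpE// (negbTE phi) eqxx fp.
have ly : legal tgt p xi.
  rewrite /legal (negbTE nAp) xip; move: nAp; rewrite /sleepers.
  by case: (tgt p) => //= c _.
apply: le_trans (value_legal ly) _.
have jj z : z != p -> jump p z xi = jump a`_k.+1 z (full k.+1).
  by move=> zp; rewrite /xi jump_jump// asleep_full (negbTE nAp).
have rm0 : 0 <= rho ^+ m by rewrite exprn_ge0// ltW.
have h0 := hw k p kn; have h1 := hw k (p + 1) kn; have h2 := hw k (p - 1) kn.
have {}h0 := h0 ltac:(by rewrite lo hi).
have {}h1 := h1 ltac:(by rewrite (le_trans lo) ?lerDl//= addrC lez1D).
have {}h2 := h2 ltac:(by rewrite lerBrDr addrC lez1D plo' (le_trans _ hi)// gerDl).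
rewrite exprS /topple !jj//.
have -> : nap A p xi = xi by rewrite /nap (negbTE nAp).
set q := (a`_k.+1 - p)%:~R / gap k.+1 in h0 *.
have q0 : 0 <= q.
  by apply: divr_ge0; [rewrite ler0z subr_ge0 | exact: ltW].
have q1 : q <= 1.
  by rewrite ler_pdivrMr// mul1r /gap ler_int /=; exact: lerB.
have e1 : (a`_k.+1 - (p + 1))%:~R / gap k.+1 = q - (gap k.+1)^-1.
  by rewrite /q !rmorphB rmorphD /= rmorph1; ring.
have e2 : (a`_k.+1 - (p - 1))%:~R / gap k.+1 = q + (gap k.+1)^-1.
  by rewrite /q !rmorphB /= rmorph1; ring.
rewrite e1 in h1; rewrite e2 in h2.
set g := (gap k.+1)^-1 in h1 h2.
have w1 := topple_w1 lam_gt0; have w2 := topple_w2 lam_gt0.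
have e := topple_weight lam_gt0.
set B := scale k.+1 - step k * q + slack.
have B0 : 0 <= B.
  have : step k * q <= step k by rewrite ler_piMr ?step_ge0.
  by rewrite /B scaleS; move: (sc0 k) sl0; lra.
apply: (@le_trans _ _ (rho * (B + rho ^+ m))); last first.
  by rewrite mulrDr lerD2r ler_piMl// ltW.
rewrite ler_pM2l//.
apply: (@le_trans _ _ (lam / (1 + lam) * (B + rho ^+ m) +
   (2 * (1 + lam))^-1 * ((B + step k * g + rho ^+ m) +
       (B - step k * g + rho ^+ m)))); last first.
  rewrite le_eqVlt; apply/orP; left; apply/eqP.
  transitivity ((lam / (1 + lam) + (2 * (1 + lam))^-1 * 2) * (B + rho ^+ m)).
    by ring.
  by rewrite e mul1r.
rewrite lerD// ler_wpM2l// lerD//.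
- by apply: le_trans h1 _; rewrite /B; lra.
- by apply: le_trans h2 _; rewrite /B; lra.
Qed.

Lemma value_stage xi : stage 0 xi -> value xi <= slack.
Proof.
move=> st.
have H m : stage_bound m /\ walk_bound m.
  elim: m => [|m [h1 h2]].
    have sc0 := scale_ge0; have sl0 := slack_ge0.
    split.
      move=> k xi' _ _; rewrite expr0; apply: le_trans (value_le1 _) _.
      by rewrite lerDr addr_ge0.
    move=> k p kn /andP[lo hi]; rewrite expr0.
    apply: le_trans (value_le1 _) _; rewrite lerDr addr_ge0//.
    rewrite subr_ge0; apply: (@le_trans _ _ (step k)).
      rewrite ler_piMr ?step_ge0// ler_pdivrMr ?gap_gt0// mul1r /gap ler_int /=.
      exact: lerB.
    by rewrite scaleS lerDr.
  have h1' := stage_step h1 h2.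
  by split => //; exact: walk_step.
apply/ler_addgt0Pr => e e0.
have : (rho ^+ m @[m --> \oo] --> 0)%classic.
  by apply: cvg_expr; rewrite ger0_norm// ltW.
move=> /cvgr0Pnorm_lt /(_ e e0)[m _ /(_ m (leqnn m)) /= hm].
have [/(_ 0 xi (leq0n n) st) h _] := H m.
apply: (le_trans h); rewrite /scale big_ord0 add0r lerD2l ltW//.
by apply: le_lt_trans hm; exact: ler_norm.
Qed.

End Strategy.

(** * The semigroup of the finite system *)

Lemma is_derive_monotone (R : realType) (g dg : R -> R) (s t : R) :
  s <= t -> (forall x, is_derive x (1 : R) g (dg x)) ->
  (forall x, s <= x <= t -> 0 <= dg x) -> g s <= g t.
Proof.
move=> st gd dg0.
have [|x xst e] := @MVT_segment R g dg s t st (fun x _ => gd x).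
  apply: derivable_within_continuous => x _; exact: (@ex_derive _ _ _ _ _ _ _ (gd x)).
rewrite -subr_ge0 e mulr_ge0 ?subr_ge0// dg0//.
Qed.

Section Semigroup.
Variables (R : realType) (lam : R).
Hypothesis lam_gt0 : 0 < lam.
Implicit Types (f g : config -> R) (eta xi : config) (N : nat) (s t : R).

Local Notation T := (topple lam predT).
Local Notation L := (generator (symmetric_walk R) lam).
Local Notation S := (semigroup (symmetric_walk R) lam).

Lemma lam1_neq0 : 1 + lam != 0.
Proof. by apply: lt0r_neq0; move: lam_gt0; lra. Qed.

Lemma lam1_ge0 : 0 <= 1 + lam.
Proof. by move: lam_gt0; lra. Qed.

Lemma generatorE (r : seq int) f eta : uniq r -> supp_in r eta ->
  L f eta = \sum_(x <- r) (1 + lam) * (active_particles (eta x))%:R *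
                          (T x f eta - f eta).
Proof.
move=> ur hr; rewrite /generator (@fsumE _ _ r)//; last first.
  by move=> x /hr -> /=; rewrite mulr0 mul0r.
apply: eq_bigr => x _; congr (_ * _).
rewrite (@fsumE _ _ [:: x + 1; x - 1]); last 2 first.
- by rewrite /= inE andbT; apply/negP => /eqP; lia.
- move=> y; rewrite !inE negb_or => /andP[y1 y2].
  rewrite /symmetric_walk ifN ?mul0r//.
  by apply/negP => /eqP h; move/negP: y1; apply; apply/eqP; move/eqP: y2; lia.
rewrite !big_cons big_nil addr0 /symmetric_walk.
have -> : (`|(x + 1 - x)%R|%N == 1%N) by apply/eqP; lia.
have -> : (`|(x - 1 - x)%R|%N == 1%N) by apply/eqP; lia.
rewrite /topple nap_predT.
have l1 := lam1_neq0; by field.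
Qed.

Definition bounded_on N f (C : R) : Prop :=
  forall eta, confN R N eta -> `|f eta| <= C.

Definition rate N : R := (1 + lam) * N%:R.

Lemma rate_ge0 N : 0 <= rate N.
Proof. by rewrite mulr_ge0// lam1_ge0. Qed.

Lemma sum_active_le N eta (r : seq int) : uniq r -> supp_in r eta ->
  confN R N eta -> \sum_(x <- r) (active_particles (eta x))%:R <= N%:R :> R.
Proof.
move=> ur hr [_ <-]; rewrite (linE _ ur hr); apply: ler_sum => x _.
by rewrite mul1r ler_nat; case: (eta x).
Qed.

Lemma inactive eta x : ~~ active eta x -> active_particles (eta x) = 0%N.
Proof. by rewrite /active -eqn0Ngt => /eqP. Qed.

Lemma topple_in N (C1 C2 : R) f eta x :
  (forall xi, confN R N xi -> C1 <= f xi <= C2) ->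
  confN R N eta -> active eta x -> C1 <= T x f eta <= C2.
Proof.
move=> h ce ax.
have h0 := h _ (confN_nap predT x ce).
have h1 := h _ (confN_jump (addr1_neq x) ax ce).
have h2 := h _ (confN_jump (subr1_neq x) ax ce).
rewrite -{1}(topple_cst lam_gt0 predT x C1 eta) -(topple_cst lam_gt0 predT x C2 eta).
by move/andP: h0 h1 h2 => [? ?] /andP[? ?] /andP[? ?]; rewrite !topple_le.
Qed.

Lemma confN_supp N eta : confN R N eta ->
  exists r : seq int, [/\ uniq r & supp_in r eta].
Proof.
by move=> [[r hr] _]; exists (undup r); split; [exact: undup_uniq | exact: supp_in_undup].
Qed.

Lemma generator_le N f g eta : confN R N eta ->
  (forall x, active eta x -> T x f eta - f eta <= T x g eta - g eta) ->
  L f eta <= L g eta.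
Proof.
move=> ce h; have [r [ur hr]] := confN_supp ce.
rewrite !(generatorE _ ur hr); apply: ler_sum => x _.
have [ax|/inactive ->] := boolP (active eta x); last by rewrite mulr0 !mul0r.
by rewrite ler_wpM2l ?h// mulr_ge0// lam1_ge0.
Qed.

Lemma generator_ext N f g eta : confN R N eta ->
  (forall xi, confN R N xi -> f xi = g xi) -> L f eta = L g eta.
Proof.
move=> ce fg; apply/eqP; rewrite eq_le; apply/andP; split.
  by apply: (generator_le ce) => x ax; rewrite /topple !fg//;
     [exact: confN_jump | exact: confN_jump | exact: confN_nap].
by apply: (generator_le ce) => x ax; rewrite /topple !fg//;
     [exact: confN_jump | exact: confN_jump | exact: confN_nap].
Qed.

Lemma generatorD f g eta : finsupp eta ->
  L (fun xi => f xi + g xi) eta = L f eta + L g eta.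
Proof.
move=> [r /supp_in_undup hr]; have ur := undup_uniq r.
rewrite !(generatorE _ ur hr) -big_split; apply: eq_bigr => x _ /=.
by rewrite toppleD; ring.
Qed.

Lemma generatorZ k f eta : finsupp eta ->
  L (fun xi => k * f xi) eta = k * L f eta.
Proof.
move=> [r /supp_in_undup hr]; have ur := undup_uniq r.
rewrite !(generatorE _ ur hr) mulr_sumr; apply: eq_bigr => x _ /=.
by rewrite toppleZ; ring.
Qed.

Lemma generator_cst k eta : finsupp eta -> L (fun=> k) eta = 0.
Proof.
move=> [r /supp_in_undup hr]; have ur := undup_uniq r.
rewrite !(generatorE _ ur hr) big1// => x _.
by rewrite topple_cst// subrr mulr0.
Qed.

(** Uniformization: adding [rate N] times f replaces the negative diagonal of the generator by
    nonnegative weights of total mass [rate N]. *)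
Lemma generator_shifted N f C eta : confN R N eta ->
  (forall xi, confN R N xi -> 0 <= f xi <= C) ->
  0 <= L f eta + rate N * f eta <= rate N * C.
Proof.
move=> ce fC; have [r [ur hr]] := confN_supp ce.
pose a x : R := (active_particles (eta x))%:R.
have a0 x : 0 <= a x by [].
have -> : L f eta + rate N * f eta =
    (1 + lam) * (\sum_(x <- r) a x * T x f eta + (N%:R - \sum_(x <- r) a x) * f eta).
  rewrite (generatorE _ ur hr) mulrBl mulr_suml addrCA -sumrB mulrDr addrC /rate.
  rewrite mulrA; congr (_ + _); rewrite mulr_sumr; apply: eq_bigr => x _.
  by rewrite -/(a x); ring.
have := sum_active_le ur hr ce; rewrite -/a -subr_ge0 => Na.
have /andP[f0 fleC] := fC _ ce.
have term x : 0 <= a x * T x f eta <= a x * C.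
  have [ax|/inactive ax] := boolP (active eta x).
    have /andP[t0 tC] := topple_in fC ce ax.
    by rewrite mulr_ge0//= ler_wpM2l.
  by rewrite /a ax !mul0r lexx.
apply/andP; split.
  rewrite mulr_ge0 ?lam1_ge0// addr_ge0 ?mulr_ge0//.
  by apply: sumr_ge0 => x _; have /andP[] := term x.
rewrite /rate -mulrA ler_wpM2l ?lam1_ge0//.
have -> : N%:R * C = \sum_(x <- r) a x * C + (N%:R - \sum_(x <- r) a x) * C.
  by rewrite -mulr_suml; ring.
rewrite lerD// ?ler_wpM2l//.
by apply: ler_sum => x _; have /andP[] := term x.
Qed.

Lemma generator_bounded N f C : 0 <= C -> bounded_on N f C ->
  bounded_on N (L f) (2 * rate N * C).
Proof.
move=> C0 fC eta ce; have [r [ur hr]] := confN_supp ce.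
rewrite (generatorE _ ur hr).
apply: (le_trans (ler_norm_sum _ _ _)).
pose a x : R := (active_particles (eta x))%:R.
apply: (@le_trans _ _ (\sum_(x <- r) (1 + lam) * a x * (2 * C))).
  apply: ler_sum => x _; rewrite normrM ger0_norm; last first.
    by rewrite mulr_ge0// lam1_ge0.
  have [ax|/inactive ax] := boolP (active eta x); last first.
    by rewrite /a ax mulr0 !mul0r.
  rewrite ler_wpM2l// ?mulr_ge0// ?lam1_ge0//.
  have fC' xi : confN R N xi -> - C <= f xi <= C.
    by move=> /fC; rewrite ler_norml.
  rewrite ler_norml.
  by move: (topple_in fC' ce ax) (fC' _ ce) => /andP[? ?] /andP[? ?]; lra.
have -> : 2 * rate N * C = (1 + lam) * N%:R * (2 * C) by rewrite /rate; ring.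
rewrite -mulr_suml -mulr_sumr; apply: ler_wpM2r; first exact: mulr_ge0.
by apply: ler_wpM2l; [exact: lam1_ge0 | exact: sum_active_le].
Qed.

Lemma iter_generator_bounded N f C n : 0 <= C -> bounded_on N f C ->
  bounded_on N (iter n L f) ((2 * rate N) ^+ n * C).
Proof.
move=> C0 fC; elim: n => [|n IH]; first by rewrite expr0 mul1r.
rewrite exprS -mulrA; apply: generator_bounded => //.
by rewrite mulr_ge0// exprn_ge0// mulr_ge0// rate_ge0.
Qed.

Definition coef f eta n : R := iter n L f eta / n`!%:R.

Lemma semigroupE t f eta : S t f eta = limn (pseries (coef f eta) t).
Proof.
rewrite /semigroup /pseries; congr (limn (series _)); apply/funext => n.
by rewrite /coef /=; ring.
Qed.

Lemma pseries_diffs_coef f eta : pseries_diffs (coef f eta) = coef (L f) eta.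
Proof.
apply/funext => n; rewrite /pseries_diffs /coef iterSr factS natrM invfM.
rewrite mulrCA; congr (_ * _).
by rewrite mulrA divff ?mul1r// pnatr_eq0.
Qed.

Lemma coef_le N f C eta t n : 0 <= C -> bounded_on N f C -> confN R N eta ->
  `|coef f eta n * t ^+ n| <= C * exp_coeff (2 * rate N * `|t|) n.
Proof.
move=> C0 fC ce; rewrite /coef /exp_coeff /= !normrM normrX.
rewrite [`|_^-1|]ger0_norm ?invr_ge0// exprMn.
have := iter_generator_bounded n C0 fC ce => h.
rewrite [leRHS](_ : _ = (2 * rate N) ^+ n * C / n`!%:R * `|t| ^+ n); last by ring.
by rewrite ler_wpM2r ?exprn_ge0// ler_wpM2r.
Qed.

Lemma cvg_exp_coeffZ C (t : R) : cvgn (series (fun n => C * exp_coeff t n)).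
Proof.
have := @is_cvg_seriesZ R (exp_coeff t) C (is_cvg_series_exp_coeff t).
by congr (cvgn (series _)); apply/funext.
Qed.

Lemma lim_exp_coeffZ C (t : R) :
  limn (series (fun n => C * exp_coeff t n)) = C * expR t.
Proof.
have := @lim_seriesZ R (exp_coeff t) C (is_cvg_series_exp_coeff t).
by move=> h; exact: h.
Qed.

Lemma cvg_coef_norm N f C eta t : 0 <= C -> bounded_on N f C ->
  confN R N eta -> cvgn [normed pseries (coef f eta) t].
Proof.
move=> C0 fC ce; apply: series_le_cvg; last exact: (@cvg_exp_coeffZ C (2 * rate N * `|t|)).
- by move=> n; exact: normr_ge0.
- move=> n; rewrite mulr_ge0// exp_coeff_ge0// !mulr_ge0// ?lam1_ge0//.
- by move=> n; exact: coef_le.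
Qed.

Lemma cvg_coef N f C eta t : 0 <= C -> bounded_on N f C ->
  confN R N eta -> cvgn (pseries (coef f eta) t).
Proof. by move=> C0 fC ce; apply: normed_cvg; exact: cvg_coef_norm fC ce. Qed.

Lemma semigroup_bounded N f C eta t : 0 <= C -> bounded_on N f C ->
  confN R N eta -> `|S t f eta| <= C * expR (2 * rate N * `|t|).
Proof.
move=> C0 fC ce; rewrite semigroupE.
apply: (le_trans (@lim_series_norm R R (fun n => coef f eta n * t ^+ n) _)).
  exact: cvg_coef_norm fC ce.
rewrite -lim_exp_coeffZ; apply: lim_series_le.
- exact: cvg_coef_norm fC ce.
- exact: cvg_exp_coeffZ.
- by move=> n; exact: coef_le.
Qed.

(** The Kolmogorov equation by termwise differentiation: the differentiated series has the
    coefficients of [L f]. *)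
Lemma is_derive_semigroup N f C eta t : 0 <= C -> bounded_on N f C ->
  confN R N eta ->
  is_derive t (1 : R) (fun t => S t f eta) (S t (L f) eta).
Proof.
move=> C0 fC ce.
rewrite (_ : (fun t => S t f eta) = (fun t => limn (pseries (coef f eta) t))); last first.
  by apply/funext => u; rewrite semigroupE.
rewrite semigroupE -pseries_diffs_coef.
have C1 : 0 <= 2 * rate N * C by rewrite !mulr_ge0// ?lam1_ge0.
have L1 := generator_bounded C0 fC.
have C2 : 0 <= 2 * rate N * (2 * rate N * C) by rewrite !mulr_ge0// ?lam1_ge0.
have L2 := generator_bounded C1 L1.
apply: (@pseries_snd_diffs _ _ (`|t| + 1)).
- exact: cvg_coef fC ce.
- by rewrite pseries_diffs_coef; exact: cvg_coef L1 ce.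
- by rewrite !pseries_diffs_coef; exact: cvg_coef L2 ce.
- by rewrite [ltRHS]ger0_norm ?addr_ge0// ltrDl.
Qed.

End Semigroup.

Lemma is_derive_expRM (R : realType) (k x : R) :
  is_derive x (1 : R) (fun t => expR (k * t)) (k * expR (k * x)).
Proof.
have h := @is_derive1_comp R expR (fun t => k * t) x (expR (k * x)) k _ _.
have h1 : is_derive x (1 : R) (fun t : R => k * t) k.
  have := @is_deriveZ R R R (fun t => t) k x 1 1 (is_derive_id x 1).
  by rewrite /GRing.scale /= mulr1.
by apply: is_derive_eq (h _ h1) _; rewrite mulrC.
Qed.

Lemma is_derive_exprn (R : realType) (n : nat) (x : R) :
  is_derive x (1 : R) (fun t : R => t ^+ n.+1) (n.+1%:R * x ^+ n).
Proof.
apply: DeriveDef; first exact: exprn_derivable.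
by rewrite exp_derive /GRing.scale /= mulr1.
Qed.

Section Semigroup2.
Variables (R : realType) (lam : R).
Hypothesis lam_gt0 : 0 < lam.
Implicit Types (f g : config -> R) (eta xi : config) (N : nat) (s t : R).

Local Notation L := (generator (symmetric_walk R) lam).
Local Notation S := (semigroup (symmetric_walk R) lam).
Local Notation rate := (rate lam).

Lemma iter_generator_ext N f g n eta : confN R N eta ->
  (forall xi, confN R N xi -> f xi = g xi) -> iter n L f eta = iter n L g eta.
Proof.
move=> + fg; elim: n eta => [|n IH] eta ce; first exact: fg.
by rewrite !iterS; apply: (generator_ext lam_gt0 ce) => xi; exact: IH.
Qed.

Lemma semigroup_ext N f g t eta : confN R N eta ->
  (forall xi, confN R N xi -> f xi = g xi) -> S t f eta = S t g eta.
Proof.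
move=> ce fg; rewrite /semigroup; congr (limn (series _)); apply/funext => n.
by rewrite (iter_generator_ext n ce fg).
Qed.

Lemma iter_generatorD N f g n eta : confN R N eta ->
  iter n L (fun xi => f xi + g xi) eta = iter n L f eta + iter n L g eta.
Proof.
elim: n eta => [//|n IH] eta ce; have [fe _] := ce.
rewrite !iterS -(generatorD lam_gt0)//.
by apply: (generator_ext lam_gt0 ce) => xi cx; rewrite IH.
Qed.

Lemma iter_generatorZ N f k n eta : confN R N eta ->
  iter n L (fun xi => k * f xi) eta = k * iter n L f eta.
Proof.
elim: n eta => [//|n IH] eta ce; have [fe _] := ce.
rewrite !iterS -(generatorZ lam_gt0)//.
by apply: (generator_ext lam_gt0 ce) => xi cx; rewrite IH.
Qed.

Lemma bounded_onD N f g C D : bounded_on N f C -> bounded_on N g D ->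
  bounded_on N (fun xi => f xi + g xi) (C + D).
Proof.
move=> fC gD xi cx; apply: (le_trans (ler_normD _ _)).
by rewrite lerD ?fC ?gD.
Qed.

Lemma bounded_onZ N f k C : bounded_on N f C ->
  bounded_on N (fun xi => k * f xi) (`|k| * C).
Proof. by move=> fC xi cx; rewrite normrM ler_wpM2l ?fC. Qed.

Lemma bounded_on_ge0 N f C eta : confN R N eta -> bounded_on N f C -> 0 <= C.
Proof. by move=> ce /(_ _ ce); apply: le_trans. Qed.

Lemma semigroupD N f g C D t eta : confN R N eta ->
  bounded_on N f C -> bounded_on N g D ->
  S t (fun xi => f xi + g xi) eta = S t f eta + S t g eta.
Proof.
move=> ce fC gD; rewrite !semigroupE.
have C0 := bounded_on_ge0 ce fC; have D0 := bounded_on_ge0 ce gD.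
have cf := cvg_coef (t := t) lam_gt0 C0 fC ce; have cg := cvg_coef (t := t) lam_gt0 D0 gD ce.
rewrite -lim_seriesD//; congr (limn (series _)); apply/funext => n /=.
by rewrite /coef (iter_generatorD _ _ _ ce) /= !mulrDl.
Qed.

Lemma semigroupZ N f k C t eta : confN R N eta -> bounded_on N f C ->
  S t (fun xi => k * f xi) eta = k * S t f eta.
Proof.
move=> ce fC; rewrite !semigroupE.
have C0 := bounded_on_ge0 ce fC; have cf := cvg_coef (t := t) lam_gt0 C0 fC ce.
rewrite -[RHS](lim_seriesZ k cf); congr (limn (series _)); apply/funext => n /=.
change (coef lam (fun xi => k * f xi) eta n * t ^+ n =
  k * (coef lam f eta n * t ^+ n)).
by rewrite /coef (iter_generatorZ _ _ _ ce) !mulrA.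
Qed.

Lemma iter_generator_cst N k n eta : confN R N eta ->
  iter n.+1 L (fun=> k) eta = 0.
Proof.
elim: n eta => [|n IH] eta ce; have [fe _] := ce.
  exact: (generator_cst lam_gt0).
rewrite iterS -(generator_cst lam_gt0 0 fe).
exact: (generator_ext lam_gt0 ce).
Qed.

Lemma lim_series_first (u : R ^nat) : (forall n, u n.+1 = 0) ->
  limn (series u) = u 0%N.
Proof.
move=> u0; apply: cvg_lim => //.
rewrite -(cvg_shiftS (series u)).
rewrite (_ : [sequence _]_n = fun=> u 0%N); first exact: cvg_cst.
apply/funext => n; rewrite /series /= big_nat_recl//= big1_seq ?addr0// => i _.
Qed.

Lemma semigroup_cst N k t eta : confN R N eta -> S t (fun=> k) eta = k.
Proof.
move=> ce; rewrite /semigroup lim_series_first; last first.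
  by move=> n; rewrite (iter_generator_cst _ _ ce) mulr0.
by rewrite expr0 fact0 divr1 mul1r.
Qed.

Lemma semigroup0 f eta : S 0 f eta = f eta.
Proof.
rewrite /semigroup lim_series_first; last first.
  by move=> n; rewrite expr0n /= !mul0r.
by rewrite expr0 fact0 divr1 mul1r.
Qed.

Lemma is_derive_exp_semigroup N k f C eta s : confN R N eta ->
  bounded_on N f C ->
  is_derive s (1 : R) (fun s => expR (k * s) * S s f eta)
    (expR (k * s) * S s (fun xi => L f xi + k * f xi) eta).
Proof.
move=> ce fC; have C0 := bounded_on_ge0 ce fC.
have h1 := is_derive_expRM k s.
have h2 := is_derive_semigroup lam_gt0 s C0 fC ce.
have := @is_deriveM R R (fun s => expR (k * s)) (fun s => S s f eta) s 1 _ _ h1 h2.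
rewrite (@semigroupD N (L f) (fun xi => k * f xi) (2 * rate N * C) (`|k| * C))//.
- rewrite (semigroupZ _ _ ce fC) /GRing.scale /=.
  congr is_derive; ring.
- exact: generator_bounded.
- exact: bounded_onZ.
Qed.

(** With c = [rate N], the function e^(c s) S_s f has derivative e^(c s) S_s (L f + c f), and L f +
    c f again lies between 0 and a constant, c C. Integrating n times improves a crude bound by (c
    s)^n / n!, which tends to 0; positivity of the semigroup results. *)
Lemma exp_semigroup_lower N n f C t eta s : confN R N eta ->
  (forall xi, confN R N xi -> 0 <= f xi <= C) -> 0 <= s <= t ->
  - (C * expR (3 * rate N * t) * exp_coeff (rate N * s) n)
    <= expR (rate N * s) * S s f eta.
Proof.
elim: n f C s => [|n IH] f C s ce fC /andP[s0 st].
  have C0 : 0 <= C by have /andP[] := fC _ ce; exact: le_trans.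
  have fC' : bounded_on N f C.
    by move=> xi /fC /andP[? ?]; rewrite ger0_norm.
  have r0 := rate_ge0 lam_gt0 N.
  rewrite /exp_coeff /= expr0 fact0 divr1 mulr1.
  apply: (@le_trans _ _ (- `|expR (rate N * s) * S s f eta|)); last first.
    by rewrite lerNl -normrN ler_norm.
  rewrite lerN2 normrM ger0_norm ?expR_ge0//.
  have h := semigroup_bounded lam_gt0 s C0 fC' ce.
  apply: (le_trans (ler_wpM2l (expR_ge0 _) h)).
  (* The 3 is 1 for the exponential in front plus 2 for the norm bound on the semigroup. *)
  rewrite mulrCA -expRD ler_wpM2l// ler_expR ger0_norm//.
  have := ler_wpM2l r0 st; lra.
pose g xi := L f xi + rate N * f xi.
have gC xi : confN R N xi -> 0 <= g xi <= rate N * C.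
  by move=> cx; exact: (generator_shifted lam_gt0 cx).
have C0 : 0 <= C by have /andP[] := fC _ ce; exact: le_trans.
have fC' : bounded_on N f C.
  by move=> xi /fC /andP[? ?]; rewrite ger0_norm.
have r0 := rate_ge0 lam_gt0 N.
set B := expR _; set c := rate N.
pose h u := expR (c * u) * S u f eta + C * B * exp_coeff (c * u) n.+1.
pose dh u := expR (c * u) * S u g eta + C * B * (c * exp_coeff (c * u) n).
have hd u : is_derive u (1 : R) h (dh u).
  apply: is_deriveD; first exact: (is_derive_exp_semigroup _ _ ce fC').
  have -> : (fun u => C * B * exp_coeff (c * u) n.+1) =
     (C * B * c ^+ n.+1 / n.+1`!%:R) \*: (fun u : R => u ^+ n.+1).
    apply/funext => v; rewrite /exp_coeff /= exprMn.
    by change (C * B * (c ^+ n.+1 * v ^+ n.+1 / n.+1`!%:R) =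
      C * B * c ^+ n.+1 / n.+1`!%:R * v ^+ n.+1); ring.
  apply: is_derive_eq (is_deriveZ _ (is_derive_exprn n u)) _.
  rewrite /GRing.scale /= /exp_coeff /=; move: (c) => c'.
  rewrite exprMn factS natrM exprS.
  have n1 : (n.+1)%:R != 0 :> R by rewrite pnatr_eq0.
  have n2 : (n`!)%:R != 0 :> R by rewrite pnatr_eq0 -lt0n fact_gt0.
  move: n1 n2; move: (n.+1%:R : R) (n`!%:R : R) => p q n1 n2.
  by field; rewrite ?n1 ?n2.
have : h 0 <= h s.
  apply: is_derive_monotone hd _ => // u /andP[u0 us].
  have := IH g (c * C) u ce gC _; rewrite u0 (le_trans us)// => /(_ isT).
  by rewrite /dh -/B -lerBlDr sub0r; congr (_ <= _); ring.
rewrite /h mulr0 expR0 mul1r semigroup0 [exp_coeff 0 _]/exp_coeff /= expr0n /=.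
rewrite mul0r mulr0 addr0 -lerBlDr; apply: le_trans.
by have /andP[f0 _] := fC _ ce; rewrite lerDr.
Qed.

Lemma semigroup_ge0 N f C t eta : confN R N eta -> bounded_on N f C ->
  (forall xi, confN R N xi -> 0 <= f xi) -> 0 <= t -> 0 <= S t f eta.
Proof.
move=> ce fC f0 t0.
have fC' xi : confN R N xi -> 0 <= f xi <= C.
  by move=> cx; rewrite f0//= -[leLHS]ger0_norm ?f0// fC.
rewrite -(pmulr_rge0 _ (expR_gt0 (rate N * t))).
have tt : 0 <= t <= t by rewrite t0 lexx.
have h := fun n => @exp_semigroup_lower N n f C t eta t ce fC' tt.
set D := C * _ in h.
have cD : (- (D * exp_coeff (rate N * t) n) @[n --> \oo] --> 0)%classic.
  rewrite -[X in _ --> X]oppr0 -(mulr0 D); apply: cvgN.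
  apply: cvgMr; exact: cvg_exp_coeff.
have <- : limn (fun n => - (D * exp_coeff (rate N * t) n)) = 0 by exact: cvg_lim.
apply: limr_le; first by apply/cvg_ex; exists 0.
by near=> n; exact: h.
Unshelve. all: by end_near. Qed.

Lemma semigroup_le N f g C D t eta : confN R N eta ->
  bounded_on N f C -> bounded_on N g D ->
  (forall xi, confN R N xi -> f xi <= g xi) -> 0 <= t ->
  S t f eta <= S t g eta.
Proof.
move=> ce fC gD fg t0.
have hN := bounded_onZ (-1) fC.
have := @semigroup_ge0 N (fun xi => g xi + -1 * f xi) _ t eta ce
  (bounded_onD gD hN) _ t0.
rewrite (semigroupD _ ce gD hN) (semigroupZ _ _ ce fC) mulN1r subr_ge0.
by apply => xi cx; rewrite mulN1r subr_ge0 fg.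
Qed.

Lemma semigroup_sum (I : Type) (r : seq I) (P : pred I) (F : I -> config -> R)
  N C t eta : confN R N eta -> (forall i, bounded_on N (F i) C) ->
  S t (fun xi => \sum_(i <- r | P i) F i xi) eta =
  \sum_(i <- r | P i) S t (F i) eta.
Proof.
move=> ce FC; elim: r => [|i r IH].
  under eq_fun do rewrite big_nil.
  by rewrite big_nil (semigroup_cst _ _ ce).
have C0 := bounded_on_ge0 ce (FC i).
have sb : bounded_on N (fun xi => \sum_(i <- r | P i) F i xi) (\sum_(i <- r | P i) C).
  move=> xi cx; apply: (le_trans (ler_norm_sum _ _ _)); apply: ler_sum => j _.
  exact: FC.
under eq_fun do rewrite big_cons.
rewrite big_cons; case: (P i) => //.
by rewrite (semigroupD _ ce (FC i) sb) IH.
Qed.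

(* Monotonicity of e^(-k t) S_t f, from the Kolmogorov equation. *)
Lemma semigroup_growth_ge N k f C s t eta : confN R N eta ->
  bounded_on N f C -> (forall xi, confN R N xi -> k * f xi <= L f xi) ->
  0 <= s <= t -> expR (k * (t - s)) * S s f eta <= S t f eta.
Proof.
move=> ce fC kf /andP[s0 st]; have C0 := bounded_on_ge0 ce fC.
have hd u := @is_derive_exp_semigroup N (- k) f C eta u ce fC.
have := @is_derive_monotone R _ _ s t st hd.
move=> h; have {}h : expR (- k * s) * S s f eta <= expR (- k * t) * S t f eta.
  apply: h => u /andP[su ut]; rewrite mulr_ge0 ?expR_ge0//.
  apply: (semigroup_ge0 ce); last by exact: le_trans su.
    apply: bounded_onD; [exact: generator_bounded fC | exact: bounded_onZ fC].
  by move=> xi cx; rewrite mulNr subr_ge0 kf.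
have e1 : expR (k * t) * expR (- k * t) = 1.
  by rewrite -expRD mulNr subrr expR0.
have -> : expR (k * (t - s)) = expR (k * t) * expR (- k * s).
  by rewrite -expRD; congr expR; ring.
rewrite -mulrA; apply: (le_trans (ler_wpM2l (expR_ge0 (k * t)) h)).
by rewrite mulrA e1 mul1r.
Qed.

Lemma semigroup_growth_le N k f C t eta : confN R N eta ->
  bounded_on N f C -> (forall xi, confN R N xi -> L f xi <= k * f xi) ->
  0 <= t -> S t f eta <= expR (k * t) * f eta.
Proof.
move=> ce fC kf t0; have fN := bounded_onZ (-1) fC.
have := @semigroup_growth_ge N k (fun xi => -1 * f xi) _ 0 t eta ce fN.
rewrite lexx t0 subr0 semigroup0 (semigroupZ _ _ ce fC) => /(_ _ isT) h.
rewrite -lerN2 -mulN1r -[leRHS]mulN1r [leLHS]mulrCA; apply: h => xi cx.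
have [fx _] := cx.
by rewrite (generatorZ lam_gt0)// mulrCA !mulN1r lerN2 kf.
Qed.

Lemma semigroup_drift N f C m s t eta : confN R N eta -> bounded_on N f C ->
  s <= t -> (forall u, s <= u <= t -> S u (L f) eta <= m) ->
  S t f eta <= S s f eta + m * (t - s).
Proof.
move=> ce fC st hm; have C0 := bounded_on_ge0 ce fC.
pose h u := m * u - S u f eta.
have hd u : is_derive u (1 : R) h (m - S u (L f) eta).
  apply: is_deriveB; last exact: is_derive_semigroup fC ce.
  have := @is_deriveZ R R R (fun t => t) m u 1 1 (is_derive_id u 1).
  by rewrite /GRing.scale /= mulr1.
have := @is_derive_monotone R h _ s t st hd.
move=> {}h'; suff : h s <= h t by rewrite /h; lra.
by apply: h' => u /hm; rewrite subr_ge0.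
Qed.

Lemma semigroup_drift_cst N f C m s t eta : confN R N eta -> bounded_on N f C ->
  0 <= s <= t -> (forall xi, confN R N xi -> L f xi <= m) ->
  S t f eta <= S s f eta + m * (t - s).
Proof.
move=> ce fC /andP[s0 st] hm; have C0 := bounded_on_ge0 ce fC.
apply: (semigroup_drift ce fC st) => u /andP[su ut].
rewrite -[leRHS](semigroup_cst m u ce); apply: (semigroup_le ce) => //.
- exact: generator_bounded fC.
- exact: le_trans su.
Qed.

End Semigroup2.

(** * From the game to the process *)

(** Carries the true dynamics to the game, where sleep is declined off A: a sleeper there becomes
    one active particle. Topplings of active sites respect this because s + 1 = 2 = 1 + 1. *)
Definition wake_outside (A : pred int) (eta : config) : config :=
  fun x => if ~~ A x && asleep (eta x) then Active 1 else eta x.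

Lemma wake_nap A x eta : active eta x ->
  wake_outside A (sleep_at x eta) = nap A x (wake_outside A eta).
Proof.
move=> /activeP[k ek]; apply/funext => w.
rewrite napE -nap_predT /wake_outside napE /= andbT.
case: (eqVneq w x) => [->|//] /=; rewrite ek /=.
by case: (A x) => //=; case: k {ek}.
Qed.

Lemma wake_jump A x y eta : y != x -> active eta x ->
  wake_outside A (jump x y eta) = jump x y (wake_outside A eta).
Proof.
move=> yx /activeP[k ek]; apply/funext => w.
rewrite jumpE// /wake_outside jumpE//.
case: (eqVneq w x) => [->|wx]; first by rewrite ek /= !andbF.
case: (eqVneq w y) => [->|//].
by case: (eta y) => [c|] /=; rewrite ?andbF//; case: (A y).
Qed.

Lemma wake_active A eta x : active eta x -> active (wake_outside A eta) x.
Proof. by move=> /activeP[k ek]; rewrite /active /wake_outside ek andbF. Qed.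

Lemma wake_outside_id (A : pred int) (eta : config) : (forall x, asleep (eta x) -> A x) ->
  wake_outside A eta = eta.
Proof.
move=> h; apply/funext => x; rewrite /wake_outside.
by case: ifP => // /andP[/negP Ax /h].
Qed.

Section KeyBound.
Variables (R : realType) (lam : R).
Hypothesis lam_gt0 : 0 < lam.
Local Notation L := (generator (symmetric_walk R) lam).
Local Notation S := (semigroup (symmetric_walk R) lam).
Local Notation rate := (rate lam).

Lemma indic_bounded N (E : set config) : bounded_on N (\1_E : config -> R) 1.
Proof. by move=> xi _; rewrite indicE; case: (_ \in _); rewrite ?normr1 ?normr0. Qed.

Lemma topple_wake tgt rho x eta : active eta x ->
  topple lam predT x (fun xi => value lam tgt rho (wake_outside (sleepers tgt) xi)) eta
  = topple lam (sleepers tgt) x (value lam tgt rho) (wake_outside (sleepers tgt) eta).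
Proof.
by move=> ax; rewrite /topple nap_predT wake_nap// !wake_jump.
Qed.

Lemma semigroup_target N (a : seq int) (tgt eta : config) (t : R) :
  confN R N tgt -> sorted <%O a -> (0 < size a)%N ->
  (forall x, (x \in a) = sleepers tgt x) ->
  confN R N eta -> (forall x, ~~ asleep (eta x)) -> 0 <= t ->
  S t \1_[set tgt] eta <= expR 1 * (2 + rate N * t) * step lam a 0.
Proof.
move=> ct asort a0 ma ce ns t0.
have r0 := rate_ge0 lam_gt0 N.
(* [value] is a supersolution, so it grows at rate at most [rate N * e] along
   the dynamics, while [value_stage] costs (1 - rho)^-1 = 1 + e^-1. *)
pose e := (1 + rate N * t)^-1; pose rho := (1 + e)^-1.
have rt0 : 0 <= rate N * t by exact: mulr_ge0.
have e0 : 0 < e by rewrite invr_gt0; lra.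
have rho0 : 0 < rho by rewrite invr_gt0; lra.
have rho1 : rho < 1 by rewrite invf_lt1; lra.
pose h xi := value lam tgt rho (wake_outside (sleepers tgt) xi).
have h0 xi : 0 <= h xi by exact: (value_ge0 lam_gt0).
have h1 xi : h xi <= 1 by exact: (value_le1 lam_gt0).
have hb : bounded_on N h 1.
  by move=> xi _; rewrite ger0_norm.
have Lh xi : confN R N xi -> L h xi <= rate N * e * h xi.
  move=> cx; have [r [ur hr]] := confN_supp cx.
  rewrite (generatorE lam_gt0 _ ur hr).
  apply: (@le_trans _ _ (\sum_(x <- r) (1 + lam) * (active_particles (xi x))%:R * (e * h xi))).
    apply: ler_sum => x _.
    have [ax|/inactive ->] := boolP (active xi x); last by rewrite mulr0 !mul0r.
    rewrite ler_wpM2l ?mulr_ge0 ?lam1_ge0//.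
    rewrite lerBlDr topple_wake//.
    have := value_super lam_gt0 tgt rho0 rho1 (wake_active (sleepers tgt) ax).
    rewrite -/(h xi) => hh; rewrite -(ler_pM2l rho0); apply: (le_trans hh).
    have re : rho * (e + 1) = 1 by rewrite addrC mulVf// gt_eqF// addr_gt0.
    by rewrite -[X in _ + X]mul1r -mulrDl mulrA re mul1r.
  rewrite -mulr_suml -mulr_sumr !mulrA ler_wpM2r//.
  apply: ler_wpM2r; first exact: ltW.
  by rewrite ler_wpM2l ?lam1_ge0// sum_active_le.
have tgt_id : wake_outside (sleepers tgt) tgt = tgt.
  exact: wake_outside_id.
apply: (@le_trans _ _ (S t h eta)).
  apply: (semigroup_le lam_gt0 ce (indic_bounded _) hb) => // xi _.
  rewrite indicE; case: (boolP (xi \in _)) => [|_]; last exact: h0.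
  by rewrite inE => ->; rewrite /h tgt_id; exact: value_tgt.
apply: (le_trans (semigroup_growth_le lam_gt0 ce hb Lh t0)).
rewrite -[leRHS]mulrA; apply: ler_pM => //.
  by rewrite ler_expR /e mulrAC ler_pdivrMr ?mul1r; lra.
have eta_id : wake_outside (sleepers tgt) eta = eta.
  by apply: wake_outside_id => x; rewrite (negbTE (ns x)).
rewrite /h eta_id.
have st : stage R tgt N a 0 eta.
  by split => // x; rewrite /settled.
apply: (le_trans (value_stage lam_gt0 rho0 rho1 ct asort a0 ma st)).
rewrite /slack mulrC ler_wpM2r ?step_ge0//.
have e1 : e * (1 + rate N * t) = 1 by rewrite mulVf// gt_eqF//; lra.
have re : rho * (1 + e) = 1 by rewrite mulVf// gt_eqF//; lra.
have -> : (1 - rho)^-1 = 2 + rate N * t; last exact: lexx.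
have eq1 : (1 - rho) * (2 + rate N * t) = 1.
  have -> : 1 - rho = rho * e by rewrite -re; ring.
  by rewrite -mulrA -[RHS]re; congr (_ * _); rewrite -[in RHS]e1; ring.
have u : 1 - rho != 0 by rewrite subr_eq0 gt_eqF.
by apply: (mulfI u); rewrite eq1 mulfV.
Qed.

(** A gap g is at most 2^g, and the gaps add up. *)
Lemma prod_gap_le (a : seq int) k : sorted <%O a -> (k < size a)%N ->
  \prod_(1 <= j < k.+1) gap R a j <= 2 ^+ `|(a`_k - a`_0)%R|%N.
Proof.
move=> asort; elim: k => [|k IH] ka; first by rewrite big_nil subrr.
rewrite big_nat_recr//=.
have lt_k : a`_k < a`_k.+1.
  by rewrite (lt_sorted_ltn_nth 0 asort) ?inE// ltnW.
have le_0 : a`_0 <= a`_k.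
  by rewrite (lt_sorted_leq_nth 0 asort) ?inE//; apply: leq_ltn_trans ka.
have -> : `|(a`_k.+1 - a`_0)%R|%N =
    (`|(a`_k - a`_0)%R| + `|(a`_k.+1 - a`_k)%R|)%N.
  by clear -lt_k le_0; lia.
rewrite exprD; apply: ler_pM.
- rewrite big_seq_cond prodr_ge0// => j; rewrite andbT mem_index_iota => /andP[j1 jk].
  by case: j j1 jk => // j _ jk; apply/ltW/gap_gt0 => //; exact: (leq_ltn_trans (ltnW jk) ka).
- by apply/ltW/gap_gt0.
- exact/IH/ltnW.
rewrite /gap /= -[X in X%:~R]gez0_abs; last by rewrite subr_ge0 ltW.
by rewrite -natrX -pmulrn ler_nat ltnW// ltn_expl.
Qed.

Lemma step_le (a : seq int) W : sorted <%O a -> (0 < size a)%N ->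
  (forall x y, x \in a -> y \in a -> (`|(x - y)%R| <= W)%N) ->
  step lam a 0 <= (2 * lam) ^+ (size a).-1 * 2 ^+ W.
Proof.
move=> asort a0 aW; rewrite /step big_split /=.
rewrite prodr_const_nat subn1 -{2}(prednK a0).
apply: ler_wpM2l; first by rewrite exprn_ge0// mulr_ge0// ltW.
apply: (le_trans (prod_gap_le asort _)); first by rewrite prednK.
rewrite -!natrX ler_nat leq_exp2l// aW// mem_nth//.
by rewrite prednK.
Qed.

(* 1 - 1/(k+1) at k active particles: increasing in k, and decreasing slowly
   enough along the dynamics, whatever the number of particles. *)
Definition psi (x : int) (eta : config) : R :=
  (active_particles (eta x))%:R / (active_particles (eta x)).+1%:R.

Lemma psi_ge0 x eta : 0 <= psi x eta.
Proof. by rewrite divr_ge0. Qed.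

Lemma psi_le1 x eta : psi x eta <= 1.
Proof. by rewrite ler_pdivrMr// mul1r ler_nat. Qed.

Lemma psi_bounded N x : bounded_on N (psi x) 1.
Proof. by move=> xi _; rewrite ger0_norm ?psi_ge0// psi_le1. Qed.

Lemma psi_le_indic x eta : psi x eta <= \1_[set eta | active eta x] eta.
Proof.
rewrite indicE; case: (boolP (_ \in _)); first by rewrite psi_le1.
by rewrite notin_setE /= => /negP /inactive; rewrite /psi => ->; rewrite mul0r.
Qed.

Lemma psi_ge_half x eta : active eta x -> 2^-1 <= psi x eta.
Proof.
rewrite /active /psi; case: (active_particles _) => // k _.
by rewrite ler_pdivlMr// mulrC ler_pdivrMr// -natrM ler_nat; lia.
Qed.

Lemma psi_mono k l : (k <= l)%N -> k%:R / k.+1%:R <= l%:R / l.+1%:R :> R.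
Proof.
move=> kl; rewrite ler_pdivrMr// mulrAC ler_pdivlMr// -!natrM ler_nat.
by nia.
Qed.

Lemma psi_jump x y z eta : y != x -> z != y ->
  psi x eta <= psi x (jump y z eta).
Proof.
move=> yx zy; rewrite /psi jumpE// (eq_sym x) (negbTE yx).
case: (eqVneq x z) => [<-|//]; apply: psi_mono => //.
by case: (eta x) => [k|].
Qed.

Lemma topple_psi x y eta : y != x ->
  psi x eta <= topple lam predT y (psi x) eta.
Proof.
move=> yx; rewrite -{1}(topple_cst lam_gt0 predT y (psi x eta) eta).
apply: topple_le => //; try exact: psi_jump.
by rewrite /psi napE eq_sym (negbTE yx).
Qed.

(** With k active particles, jumps occur at rate k and each loses only 1/(k (k + 1)). For k = 1
    sleep loses 1/2 as well, and equality holds. *)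
Lemma generator_psi_self x eta : active eta x ->
  - (1 + lam) * psi x eta <=
  (1 + lam) * (active_particles (eta x))%:R *
    (topple lam predT x (psi x) eta - psi x eta).
Proof.
move=> /activeP[k ek].
have k1 : k.+1%:R != 0 :> R by rewrite pnatr_eq0.
have k2 : k.+2%:R != 0 :> R by rewrite pnatr_eq0.
have l1 := lam1_neq0 lam_gt0.
rewrite /topple /psi napE !jumpE// eqxx ek /=.
case: k ek k1 k2 => [|k] ek k1 k2 /=.
  by rewrite mul0r !addr0 !mulr0; lra.
have e1 : k.+2%:R = k.+1%:R + 1 :> R by rewrite natr1.
have e2 : k.+3%:R = k.+1%:R + 2 :> R by rewrite -natr1 e1; ring.
rewrite e1 in k2 *; rewrite e2 in k2 *.
have m0 : 0 < k.+1%:R :> R by rewrite ltr0n.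
move: (k.+1%:R : R) k1 k2 m0 => m k1 k2 m0.
have m1 : m + 1 != 0 by apply: lt0r_neq0; lra.
have m2 : m + 2 != 0 by apply: lt0r_neq0; lra.
rewrite -subr_ge0.
have -> : (1 + lam) * (m + 1) * (lam / (1 + lam) * ((m + 1) / (m + 2)) +
   (2 * (1 + lam))^-1 * (m / (m + 1) + m / (m + 1)) - (m + 1) / (m + 2)) -
   - (1 + lam) * ((m + 1) / (m + 2)) =
   ((1 + lam) * (m + 1) - 1) / (m + 2).
  by field; rewrite ?l1 ?m1 ?m2.
rewrite divr_ge0//; last by lra.
have := mulr_gt0 lam_gt0 m0; move: lam_gt0; lra.
Qed.

Lemma generator_psi N x eta : confN R N eta ->
  - (1 + lam) * psi x eta <= L (psi x) eta.
Proof.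
move=> ce; have [r [ur hr]] := confN_supp ce.
pose r' := undup (x :: r); have ur' : uniq r' by exact: undup_uniq.
have hr' : supp_in r' eta.
  by apply/supp_in_undup; apply: supp_in_sub hr => w wr; rewrite inE wr orbT.
rewrite (generatorE lam_gt0 _ ur' hr') (bigD1_seq x)//=; last first.
  by rewrite mem_undup inE eqxx.
rewrite -[leLHS]addr0 lerD//.
  have [ax|/inactive ax] := boolP (active eta x); first exact: generator_psi_self.
  by rewrite /psi ax mulr0n !(mul0r, mulr0).
apply: sumr_ge0 => y yx; rewrite mulr_ge0 ?mulr_ge0 ?lam1_ge0//.
by rewrite subr_ge0 topple_psi.
Qed.

Lemma generator_psi_next N x y eta : confN R N eta -> active eta x ->
  y = x + 1 \/ y = x - 1 ->
  - (2 + lam) * psi y eta + 4^-1 <= L (psi y) eta.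
Proof.
move=> ce ax yx; have [r [ur hr]] := confN_supp ce.
pose r' := undup (y :: r); have ur' : uniq r' by exact: undup_uniq.
have hr' : supp_in r' eta.
  by apply/supp_in_undup; apply: supp_in_sub hr => w wr; rewrite inE wr orbT.
have xy : x != y by rewrite eq_sym; case: yx => ->.
rewrite (generatorE lam_gt0 _ ur' hr') (bigD1_seq y)//=; last first.
  by rewrite mem_undup inE eqxx.
have xr : x \in r' by rewrite mem_undup inE (active_supp hr ax) orbT.
rewrite -big_filter (bigD1_seq x) ?filter_uniq ?mem_filter ?xy//=.
have h1 : - (1 + lam) * psi y eta <=
    (1 + lam) * (active_particles (eta y))%:R *
    (topple lam predT y (psi y) eta - psi y eta).
  have [ay|/inactive ay] := boolP (active eta y); first exact: generator_psi_self.
  by rewrite /psi ay mulr0n !(mul0r, mulr0).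
have h3 : 0 <= \sum_(i <- [seq i <- r' | i != y] | i != x)
   (1 + lam) * (active_particles (eta i))%:R *
     (topple lam predT i (psi y) eta - psi y eta).
  rewrite big_filter_cond; apply: sumr_ge0 => i /andP[iy _].
  by rewrite mulr_ge0 ?mulr_ge0 ?lam1_ge0// subr_ge0 topple_psi.
pose b := add_particle (eta y).
pose pb : R := (active_particles b)%:R / (active_particles b).+1%:R.
have jy : psi y (jump x y eta) = pb.
  have yx' : y != x by rewrite eq_sym.
  by rewrite /psi jumpE// (negbTE yx') eqxx.
have h2 : 2^-1 * (pb - psi y eta) <=
   (1 + lam) * (active_particles (eta x))%:R *
     (topple lam predT x (psi y) eta - psi y eta).
  apply: (@le_trans _ _ ((1 + lam) * 1 *
     (topple lam predT x (psi y) eta - psi y eta))); last first.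
    rewrite ler_wpM2r ?subr_ge0 ?topple_psi// ler_wpM2l ?lam1_ge0//.
    by rewrite ler1n.
  have l1 := lam1_neq0 lam_gt0.
  have -> : 2^-1 * (pb - psi y eta) = (1 + lam) * 1 * ((lam / (1 + lam) * psi y eta +
      (2 * (1 + lam))^-1 * (pb + psi y eta)) - psi y eta).
    by field.
  rewrite ler_wpM2l ?mulr1 ?lam1_ge0// lerB// /topple lerD//.
    rewrite ler_wpM2l ?topple_w1// /psi napE.
    by rewrite eq_sym (negbTE xy).
  rewrite ler_wpM2l ?topple_w2//; case: yx => yE; rewrite -yE jy.
    by rewrite lerD// psi_jump.
  by rewrite addrC lerD// psi_jump.
(* If y is active, psi there is at least 1/2 and the additional psi, from 2 + lam instead of 1 +
   lam, suffices; otherwise an arrival raises psi by at least 1/2. *)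
have h4 : 4^-1 <= 2^-1 * (pb - psi y eta) + psi y eta.
  rewrite /pb /b /psi; case: (eta y) => [[|k]|] /=; try lra.
  have : (k.+1)%:R / (k.+2)%:R <= (k.+2)%:R / (k.+3)%:R :> R by exact: psi_mono.
  have := @psi_mono 1 k.+1 isT; rewrite mulr1n div1r.
  move: (_ / _) (_ / _) => p q; lra.
move: h1 h2 h3 h4; lra.
Qed.

(** A factor 1/4 from the source term in [generator_psi_next], 1/2 from psi at an active site, and
    the decay at rate 2 + lam over one unit of time. *)
Definition wake_prob : R := expR (- (2 + lam)) / 8.

Lemma wake_prob_gt0 : 0 < wake_prob.
Proof. by rewrite divr_gt0 ?expR_gt0. Qed.

Lemma semigroup_psi_self N x eta s t : confN R N eta -> 0 <= s <= t ->
  expR (- (1 + lam) * (t - s)) * S s (psi x) eta <= S t (psi x) eta.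
Proof.
move=> ce st; apply: (semigroup_growth_ge lam_gt0 ce (@psi_bounded N x)) => //.
by move=> xi cx; exact: generator_psi cx.
Qed.

Lemma semigroup_psi_next N x y eta : confN R N eta -> active eta x ->
  y = x + 1 \/ y = x - 1 -> wake_prob <= S 1 (psi y) eta.
Proof.
move=> ce ax yx.
have bd := @psi_bounded N.
(* The source at time u is a quarter of the mean of psi at x, which decays at rate at most 1 + lam;
   the integrating factor e^((2 + lam) u) outweighs this decay. *)
pose h u := expR ((2 + lam) * u) * S u (psi y) eta - 4^-1 * psi x eta * u.
pose g xi := L (psi y) xi + (2 + lam) * psi y xi.
have hd u : is_derive u (1 : R) h
    (expR ((2 + lam) * u) * S u g eta - 4^-1 * psi x eta).
  apply: is_deriveB.
    exact: (is_derive_exp_semigroup lam_gt0 (2 + lam) u ce (bd y)).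
  have := @is_deriveZ R R R (fun t => t) (4^-1 * psi x eta) u 1 1 (is_derive_id u 1).
  by rewrite /GRing.scale /= mulr1.
have gb := bounded_onD (generator_bounded lam_gt0 ler01 (bd y)) (bounded_onZ (2 + lam) (bd y)).
have h01 : h 0 <= h 1.
  apply: (is_derive_monotone _ hd) => // u /andP[u0 u1].
  rewrite subr_ge0.
  apply: (@le_trans _ _ (expR ((2 + lam) * u) * (4^-1 * S u (psi x) eta))).
    rewrite [leRHS]mulrCA ler_wpM2l//.
    have hx := @semigroup_psi_self N x eta 0 u ce.
    rewrite lexx u0 subr0 semigroup0 in hx.
    apply: (le_trans _ (ler_wpM2l (expR_ge0 _) (hx isT))).
    rewrite mulrA -expRD ler_peMl ?psi_ge0// -[leLHS]expR0 ler_expR.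
    by have -> : (2 + lam) * u + - (1 + lam) * u = u by ring.
  rewrite ler_wpM2l ?expR_ge0//.
  rewrite -(semigroupZ lam_gt0 _ _ ce (bd x)).
  apply: (semigroup_le lam_gt0 ce (bounded_onZ _ (bd x)) gb) => // xi cx.
  have [axi|/inactive axi] := boolP (active xi x).
    have := generator_psi_next cx axi yx; rewrite /g.
    by have := psi_le1 x xi; lra.
  rewrite /g {1}/psi axi mul0r mulr0.
  have := generator_psi y cx; have := psi_ge0 y xi; lra.
move: h01; rewrite /h !mulr0 !mulr1 expR0 mul1r subr0 semigroup0.
have p1 := psi_ge_half ax; have p2 := psi_ge0 y eta.
move=> h01; have h02 : 8^-1 <= expR (2 + lam) * S 1 (psi y) eta by lra.
have e0 := expR_gt0 (2 + lam).
rewrite /wake_prob expRN ler_pdivrMr// -(ler_pM2l e0) mulfV ?gt_eqF// mulrA.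
lra.
Qed.

End KeyBound.

(** * Spread and discrepancy *)

Definition dist_itv (p q x : int) : nat :=
  if (x < p) then `|p - x|%N else if (q < x) then `|x - q|%N else 0%N.

Definition tdist (p q : int) (m : nat) (x : int) : nat := minn m (dist_itv p q x).

Lemma tdist_steps (p q : int) m (x : int) : p <= q -> (0 < m)%N ->
  let d := tdist p q m in
  [/\ (d (x + 1)%R <= (d x).+1)%N, (d (x - 1)%R <= (d x).+1)%N
    & (d x = 0 \/ d (x + 1)%R + d (x - 1)%R <= 2 * d x)%N] /\
  ((d x <= (d (x + 1)%R).+1)%N /\ (d x <= (d (x - 1)%R).+1)%N).
Proof.
move=> pq m0 /=; rewrite /tdist /dist_itv.
by split; [split|split]; do ?case: ifP => ?; lia.
Qed.

(** Where the truncated distance is positive it is locally concave with slopes at most 1; where it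
    vanishes, both neighbours are at distance at most 1. *)
Lemma tdist_sqr (p q : int) m (x : int) : p <= q -> (0 < m)%N ->
  (tdist p q m (x + 1)%R ^ 2 + tdist p q m (x - 1)%R ^ 2 <=
   2 * tdist p q m x ^ 2 + 2)%N.
Proof.
move=> pq m0; have /= [[]] := tdist_steps x pq m0.
move: (tdist p q m _) (tdist p q m _) (tdist p q m _) => d u w.
move=> h1 h2 [u0|h3] [h4 h5]; rewrite -!mulnn.
  by rewrite u0 in h1 h2 *; clear h4 h5; case: w d h1 h2 => [|[|w]] [|[|d]].
have [wE|[wE|wE]] : w = u.+1 \/ w = u \/ w.+1 = u by lia.
all: have [dE|[dE|dE]] : d = u.+1 \/ d = u \/ d.+1 = u by lia.
all: nia.
Qed.

Section Drift.
Variables (R : realType) (lam : R).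
Hypothesis lam_gt0 : 0 < lam.
Local Notation L := (generator (symmetric_walk R) lam).
Local Notation S := (semigroup (symmetric_walk R) lam).

Lemma generator_lin chi (r : seq int) eta : uniq r -> supp_in r eta ->
  L (lin chi) eta = \sum_(x <- r) (active_particles (eta x))%:R *
    (2^-1 * (chi (x + 1) + chi (x - 1) - 2 * chi x)).
Proof.
move=> ur hr; rewrite (generatorE lam_gt0 _ ur hr); apply: eq_bigr => x _.
have [ax|/inactive ->] := boolP (active eta x); last by rewrite mulr0 !mul0r.
have fe : finsupp eta by exists r.
rewrite /topple lin_nap !lin_jump//.
have l1 := lam1_neq0 lam_gt0; by field.
Qed.

Lemma generator_lin_le N chi eta : confN R N eta ->
  (forall x, chi (x + 1) + chi (x - 1) - 2 * chi x <= 2) ->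
  L (lin chi) eta <= N%:R.
Proof.
move=> ce hchi; have [r [ur hr]] := confN_supp ce.
rewrite (generator_lin _ ur hr); apply: le_trans (sum_active_le ur hr ce).
apply: ler_sum => x _; rewrite ler_piMr//.
by move: (hchi x); lra.
Qed.

Lemma lin_bounded N chi (B : R) : (forall x, 0 <= chi x <= B) ->
  bounded_on N (lin chi) (B * N%:R).
Proof.
move=> hchi eta [fe eN]; rewrite ger0_norm; last first.
  by apply: lin_ge0 => x; have /andP[] := hchi x.
have [s /supp_in_undup hs] := fe; have us := undup_uniq s.
rewrite -eN !(linE _ us hs) mulr_sumr; apply: ler_sum => x _.
by rewrite mul1r ler_wpM2r//; have /andP[] := hchi x.
Qed.

(** The truncation at m makes the statistic bounded on N particles, as the semigroup estimates
    require, and keeps the drift bound of the square. *)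
Definition spread (p q : int) (m : nat) (x : int) : R := (tdist p q m x ^ 2)%:R.

Lemma spread_bounded N p q m :
  bounded_on N (lin (spread p q m)) ((m ^ 2)%:R * N%:R).
Proof.
apply: lin_bounded => x; rewrite ler0n ler_nat /= leq_sqr.
exact: geq_minl.
Qed.

Lemma semigroup_spread N p q m t eta : confN R N eta -> p <= q -> (0 < m)%N ->
  0 <= t ->
  S t (lin (spread p q m)) eta <= lin (spread p q m) eta + N%:R * t.
Proof.
move=> ce pq m0 t0.
have := semigroup_drift_cst lam_gt0 (m := N%:R) (s := 0) (t := t) ce (@spread_bounded N p q m).
rewrite lexx t0 subr0 semigroup0; apply => // xi cx.
apply: (generator_lin_le cx) => x.
rewrite /spread -!natrD lerBlDr -[2 * _]natrM -natrD ler_nat addnC.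
by rewrite addnC [(2 + _)%N]addnC tdist_sqr.
Qed.

Definition actives (eta : config) : R :=
  \sum_(x \in [set: int]) ((active_particles (eta x))%:R : R).

Lemma activesE (r : seq int) eta : uniq r -> supp_in r eta ->
  actives eta = \sum_(x <- r) (active_particles (eta x))%:R.
Proof. by move=> ur hr; apply: fsumE => // x /hr ->. Qed.

Lemma actives_bounded N : bounded_on N actives N%:R.
Proof.
move=> eta ce; have [r [ur hr]] := confN_supp ce.
rewrite (activesE ur hr) ger0_norm; last exact: sumr_ge0.
exact: sum_active_le.
Qed.

Definition below (u : int) (eta : config) : R := lin (fun x => (x <= u)%R%:R) eta.

Lemma below_le N u eta : confN R N eta -> 0 <= below u eta <= N%:R.
Proof.
move=> [fe <-]; rewrite lin_ge0//=; apply: le_lin => // x.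
by case: (x <= u).
Qed.

Lemma lin_delta x eta : finsupp eta ->
  lin (fun w => (w == x)%:R) eta = (particles (eta x))%:R :> R.
Proof.
move=> [s hs]; pose s' := undup (x :: s); have us' := undup_uniq (x :: s).
have hs' : supp_in s' eta.
  by apply/supp_in_undup; apply: supp_in_sub hs => w ws; rewrite inE ws orbT.
rewrite (linE _ us' hs'); under eq_bigr do rewrite mulrC.
by rewrite sum_delta// mem_undup inE eqxx.
Qed.

Lemma below_step x eta : finsupp eta ->
  below x eta - below (x - 1) eta = (particles (eta x))%:R.
Proof.
move=> fe; rewrite -lin_delta// /below.
have [s /supp_in_undup hs] := fe; have us := undup_uniq s.
rewrite !(linE _ us hs) -sumrB; apply: eq_bigr => w _; rewrite -mulrBl.
congr (_ * _); have [->|wx] := eqVneq w x.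
  by rewrite lexx (_ : x <= x - 1 = false) ?subr0//; lia.
have -> : (w <= x) = (w <= x - 1) by lia.
by rewrite subrr.
Qed.

Lemma below_jump u x y eta : finsupp eta -> y != x -> active eta x ->
  below u (jump x y eta) = below u eta - (x <= u)%R%:R + (y <= u)%R%:R.
Proof. by move=> fe yx ax; rewrite /below lin_jump. Qed.

Variables (v N : nat) (eta0 : config).
Hypotheses (cN0 : confN R N eta0)
  (supp0 : forall x, ~~ (0 <= x < v%:Z) -> eta0 x = Active 0)
  (simple0 : forall x, (particles (eta0 x) <= 1)%N).

(** The levels u whose edge from u to u + 1 meets the sites 0, ..., v - 1. *)
Definition levels : seq int := [seq i%:Z - 1 | i <- iota 0 v.+1].

Lemma levels_uniq : uniq levels.
Proof. by rewrite map_inj_uniq ?iota_uniq// => i j; lia. Qed.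

Lemma mem_levels u : (u \in levels) = (-1 <= u <= v%:Z - 1).
Proof.
apply/mapP/idP => [[i + ->]|hu]; first by rewrite mem_iota; lia.
by exists `|(u + 1)%R|%N; [rewrite mem_iota; lia | lia].
Qed.

(* The squared L2 distance between the current and the initial distribution
   functions; the squares turn the drift into minus the second moment. *)
Definition discrepancy (eta : config) : R :=
  \sum_(u <- levels) (below u eta - below u eta0) ^+ 2.

Lemma discrepancy_ge0 eta : 0 <= discrepancy eta.
Proof. by apply: sumr_ge0 => u _; exact: sqr_ge0. Qed.

Lemma discrepancy_init : discrepancy eta0 = 0.
Proof. by rewrite /discrepancy big1// => u _; rewrite subrr expr0n. Qed.

Lemma discrepancy_bounded :
  bounded_on N discrepancy (\sum_(u <- levels) N%:R ^+ 2).
Proof.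
move=> eta ce; rewrite ger0_norm ?discrepancy_ge0//; apply: ler_sum => u _.
rewrite -[leLHS]real_normK ?num_real// lerXn2r ?nnegrE// ler_norml.
by move: (below_le u ce) (below_le u cN0) => /andP[? ?] /andP[? ?]; lra.
Qed.

Definition diff (u : int) (eta : config) : R := below u eta - below u eta0.

Lemma sum_levels_delta (G : int -> R) x :
  \sum_(u <- levels) G u * (u == x)%:R = (x \in levels)%:R * G x.
Proof.
have [xl|xl] := boolP (x \in levels).
  by rewrite (sum_delta _ levels_uniq)// mul1r.
rewrite mul0r big1_seq// => u /= ul; rewrite (_ : u == x = false) ?mulr0//.
by apply/negP => /eqP ux; rewrite -ux ul in xl.
Qed.

(** A jump to the right lowers the distribution function at level x alone, a jump to the left raises
    it at level x - 1 alone; the two terms are the changes of these squares. *)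
Lemma topple_discrepancy x eta : finsupp eta -> active eta x ->
  (1 + lam) * (topple lam predT x discrepancy eta - discrepancy eta) =
  2^-1 * ((x \in levels)%:R * (1 - 2 * diff x eta) +
          ((x - 1)%R \in levels)%:R * (1 + 2 * diff (x - 1) eta)).
Proof.
move=> fe ax.
have dn : discrepancy (nap predT x eta) = discrepancy eta.
  by apply: eq_bigr => u _; rewrite /below lin_nap.
have dr : discrepancy (jump x (x + 1) eta) =
    discrepancy eta + (x \in levels)%:R * (1 - 2 * diff x eta).
  rewrite -(sum_levels_delta (fun u => 1 - 2 * diff u eta)) -big_split.
  apply: eq_bigr => u _ /=; rewrite below_jump// /diff.
  have [ux|ux] := eqVneq u x.
    by rewrite ux lexx (_ : x + 1 <= x = false) /=; [ring | lia].
  have -> : (x + 1 <= u) = (x <= u) by lia.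
  by rewrite mulr0 addr0 subrK.
have dl : discrepancy (jump x (x - 1) eta) =
    discrepancy eta + ((x - 1)%R \in levels)%:R * (1 + 2 * diff (x - 1) eta).
  rewrite -(sum_levels_delta (fun u => 1 + 2 * diff u eta)) -big_split.
  apply: eq_bigr => u _ /=; rewrite below_jump// /diff.
  have [ux|ux] := eqVneq u (x - 1).
    by rewrite ux lexx (_ : x <= x - 1 = false) /=; [ring | lia].
  have -> : (x - 1 <= u) = (x <= u) by lia.
  by rewrite mulr0 addr0 subrK.
rewrite /topple dn dr dl.
have l1 := lam1_neq0 lam_gt0.
move: (discrepancy eta) ((x \in levels)%:R * (1 - 2 * diff x eta))
  (((x - 1)%R \in levels)%:R * (1 + 2 * diff (x - 1) eta)) => d e1 e2.
by field.
Qed.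

Lemma below0_low u : u < 0 -> below u eta0 = 0.
Proof.
move=> u0; rewrite /below /lin fsbig1// => x _.
have [xu|] := boolP (x <= u); last by rewrite mul0r.
by rewrite supp0 ?mulr0//; lia.
Qed.

Lemma below0_high u : v%:Z - 1 <= u -> below u eta0 = N%:R.
Proof.
move=> uv; rewrite -(cN0.2) /below; apply: eq_fsbigr => x _.
have [//|xu] := boolP (x <= u).
by rewrite supp0 ?mulr0//; lia.
Qed.

Lemma diff_step x eta : finsupp eta ->
  diff x eta - diff (x - 1) eta =
  (particles (eta x))%:R - (particles (eta0 x))%:R.
Proof.
move=> fe; rewrite -(below_step x fe) -(below_step x (cN0.1)) /diff; ring.
Qed.

(** On the block the two terms combine to 1 minus the excess of x over its initial occupation, which
    was at most one. Just outside, the initial distribution function has an extreme value, 0 or N,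
    so the single remaining difference has the favourable sign. *)
Lemma topple_discrepancy_le x eta : confN R N eta -> active eta x ->
  (1 + lam) * (topple lam predT x discrepancy eta - discrepancy eta) <=
  if (0 <= x < v%:Z) then 2 - (active_particles (eta x))%:R else 1.
Proof.
move=> ce ax; have fe := ce.1; rewrite topple_discrepancy// !mem_levels.
have [xv|xv] := boolP (0 <= x < v%:Z).
  have -> : -1 <= x <= v%:Z - 1 by lia.
  have -> : -1 <= x - 1 <= v%:Z - 1 by lia.
  have := diff_step x fe.
  have /activeP[k ek] := ax; rewrite ek /=.
  have : (particles (eta0 x))%:R <= 1 :> R by rewrite (ler_nat _ _ 1).
  by rewrite !mul1r; lra.
have /andP[bl0 blN] := below_le (x - 1) ce; have /andP[b0 bN] := below_le x ce.
have [x1|x1] := boolP (-1 <= x <= v%:Z - 1).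
  have xE : x = -1 by lia.
  rewrite (_ : -1 <= x - 1 <= v%:Z - 1 = false) ?mul0r; last by lia.
  rewrite mul1r addr0 /diff below0_low; last by lia.
  lra.
rewrite mul0r add0r.
have [x2|x2] := boolP (-1 <= x - 1 <= v%:Z - 1); last by rewrite mul0r mulr0.
rewrite mul1r /diff below0_high; last by lia.
lra.
Qed.

Lemma generator_discrepancy eta : confN R N eta ->
  L discrepancy eta <= N%:R.
Proof.
move=> ce; have [r [ur hr]] := confN_supp ce.
rewrite (generatorE lam_gt0 _ ur hr); apply: le_trans (sum_active_le ur hr ce).
apply: ler_sum => x _.
have [ax|/inactive ->] := boolP (active eta x); last by rewrite mulr0 !mul0r.
rewrite mulrAC; apply: (le_trans (ler_wpM2r (ler0n _ _) (topple_discrepancy_le ce ax))).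
rewrite ler_piMl//; case: ifP => // _.
have : 1 <= (active_particles (eta x))%:R :> R by rewrite (ler_nat _ 1).
lra.
Qed.

(* A site of blk with a > 0 active particles contributes at most 2 a - a^2, and
   (a - 9)^2 >= 0; a site off blk is paid for by chi. *)
Lemma generator_discrepancy_act (blk : seq int) chi (rho : R) eta :
  confN R N eta -> uniq blk -> {in blk, forall x, 0 <= x < v%:Z} ->
  (forall x, 0 <= chi x) -> 0 < rho ->
  (forall x, x \notin blk -> rho <= chi x) ->
  L discrepancy eta <= - 16 * actives eta +
    81 * (\sum_(x <- blk) \1_[set xi | active xi x] eta + rho^-1 * lin chi eta).
Proof.
move=> ce ublk hblk chi0 rho0 hchi; have [r0 [_ hr0]] := confN_supp ce.
pose r := undup (blk ++ r0); have ur : uniq r := undup_uniq _.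
have hr : supp_in r eta.
  by apply/supp_in_undup; apply: supp_in_sub hr0 => w wr; rewrite mem_cat wr orbT.
rewrite (generatorE lam_gt0 _ ur hr) (activesE ur hr) (linE _ ur hr).
have -> : \sum_(x <- blk) \1_[set xi | active xi x] eta =
    \sum_(x <- r) (x \in blk)%:R * \1_[set xi | active xi x] eta :> R.
  rewrite [RHS](perm_big (blk ++ [seq x <- r | x \notin blk])) /=.
    rewrite big_cat /= [X in _ + X]big1_seq ?addr0; last first.
      by move=> x; rewrite mem_filter => /= /andP[/negbTE -> _]; rewrite mul0r.
    by apply: eq_big_seq => x ->; rewrite mul1r.
  apply: uniq_perm => //.
    rewrite cat_uniq ublk filter_uniq// andbT /=.
    by apply/hasPn => x; rewrite mem_filter => /andP[].
  move=> x; rewrite mem_cat mem_filter mem_undup mem_cat.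
  by case: (x \in blk).
rewrite !mulr_sumr -big_split /= mulr_sumr -big_split /=.
apply: ler_sum => x _.
have t0 : 0 <= rho^-1 * (chi x * (particles (eta x))%:R).
  by rewrite !mulr_ge0// invr_ge0 ltW.
have i0 : 0 <= (x \in blk)%:R * \1_[set xi | active xi x] eta :> R.
  by rewrite mulr_ge0// indicE.
have [ax|/inactive ax] := boolP (active eta x); last first.
  by rewrite ax mulr0 mul0r mulr0 add0r mulr_ge0// addr_ge0.
rewrite mulrAC; apply: (le_trans (ler_wpM2r (ler0n _ _) (topple_discrepancy_le ce ax))).
have a1 : 1 <= (active_particles (eta x))%:R :> R by rewrite (ler_nat _ 1).
have pa : particles (eta x) = active_particles (eta x).
  by have /activeP[k ->] := ax.
rewrite pa in t0 *.
move: (_%:R) a1 t0 => a a1 t0.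
have [xb|xb] := boolP (x \in blk).
  have -> : \1_[set xi | active xi x] eta = 1 :> R by rewrite indicE mem_set.
  rewrite mul1r (hblk _ xb).
  by have := sqr_ge0 (a - 9); rewrite expr2; lra.
have hc : 1 * a <= rho^-1 * (chi x * a).
  by rewrite mulrA ler_wpM2r//; [lra | rewrite mulrC ler_pdivlMr ?mul1r ?hchi].
rewrite mul0r add0r.
case: ifP => _; last by lra.
have := mulr_ge0 (_ : 0 <= a - 1) (_ : 0 <= a).
move=> /(_ ltac:(lra) ltac:(lra)); lra.
Qed.

End Drift.

(** * Histories of the finite system *)

(** Coding along 0 < s < 1 < 2 < ...; at most N particles at a site have a code below [N.+2]. *)
Definition occ_of_nat (n : nat) : occupation :=
  match n with 0 => Active 0 | 1 => Sleeping | k.+2 => Active k.+1 end.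

Definition nat_of_occ (a : occupation) : nat :=
  match a with Active 0 => 0 | Sleeping => 1 | Active k.+1 => k.+2 end.

Lemma nat_of_occK : cancel nat_of_occ occ_of_nat.
Proof. by case=> [[|k]|]. Qed.

Lemma occ_of_natK : cancel occ_of_nat nat_of_occ.
Proof. by case=> [|[|k]]. Qed.

Lemma nat_of_occ_le a : (nat_of_occ a <= (particles a).+1)%N.
Proof. by case: a => [[|k]|]. Qed.

Section WindowConfigs.
Variables (lo : int) (W N : nat).

Definition window_config (g : {ffun 'I_W -> 'I_N.+2}) : config :=
  fun x => if lo <= x
           then oapp (fun i => occ_of_nat (g i)) (Active 0) (insub `|(x - lo)%R|%N)
           else Active 0.

Lemma window_configE g (i : 'I_W) : window_config g (lo + i%:Z) = occ_of_nat (g i).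
Proof.
rewrite /window_config lerDl lez_nat leq0n.
have -> : `|(lo + i%:Z - lo)%R|%N = i by lia.
by rewrite valK.
Qed.

Lemma window_config_out g x : ~~ (lo <= x < lo + W%:Z) ->
  window_config g x = Active 0.
Proof.
rewrite /window_config; case: ifP => //= lox xW.
by rewrite insubN//; lia.
Qed.

Lemma window_config_inj : injective window_config.
Proof.
move=> g h gh; apply/ffunP => i; apply/val_inj/(can_inj occ_of_natK).
by rewrite -!window_configE gh.
Qed.

Lemma window_configP (eta : config) :
  (forall x, (particles (eta x) <= N)%N) ->
  (forall x, ~~ (lo <= x < lo + W%:Z) -> eta x = Active 0) ->
  exists g, window_config g = eta.
Proof.
move=> eN eout; exists [ffun i : 'I_W => inord (nat_of_occ (eta (lo + i%:Z)))].
apply/funext => x; have [xW|xW] := boolP (lo <= x < lo + W%:Z); last first.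
  by rewrite window_config_out// eout.
have xi : (`|(x - lo)%R| < W)%N by lia.
have -> : x = lo + (Ordinal xi)%:Z by rewrite /=; lia.
rewrite window_configE ffunE inordK ?nat_of_occK//.
by rewrite ltnS (leq_trans (nat_of_occ_le _))// ltnS.
Qed.

End WindowConfigs.

Section Cover.
Variable R : realType.

Lemma particles_le N eta x : confN R N eta -> (particles (eta x) <= N)%N.
Proof.
move=> [fe eN]; rewrite -(@ler_nat R) -eN -(lin_delta R x fe).
by apply: le_lin => // w; case: eqP.
Qed.

Lemma lin_ge_site chi x eta : finsupp eta -> (forall w, 0 <= chi w) ->
  chi x * (particles (eta x))%:R <= lin chi eta :> R.
Proof.
move=> fe chi0; have [s hs] := fe.
pose s' := undup (x :: s); have us' := undup_uniq (x :: s).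
have hs' : supp_in s' eta.
  by apply/supp_in_undup; apply: supp_in_sub hs => w ws; rewrite inE ws orbT.
rewrite (linE _ us' hs') (bigD1_seq x) ?mem_undup ?inE ?eqxx//= lerDl.
by apply: sumr_ge0 => w _; rewrite mulr_ge0.
Qed.

Lemma spread_out (b m : nat) x :
  ~~ (- (b + m)%N%:Z <= x < - (b + m)%N%:Z + (b + m).*2.+1%:Z) ->
  spread R (- b%:Z) b m x = (m ^ 2)%:R.
Proof.
move=> xo; rewrite /spread /tdist /dist_itv; congr ((_ ^ 2)%:R).
by do ?case: ifP => ?; lia.
Qed.

Lemma lin_spread_eq0 (p q : int) m eta :
  (forall x, ~~ (p <= x <= q) -> eta x = Active 0) ->
  lin (spread R p q m) eta = 0.
Proof.
move=> he; rewrite /lin fsbig1// => x _.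
have [xb|/he ->] := boolP (p <= x <= q); last by rewrite mulr0.
rewrite /spread /tdist /dist_itv !ifN ?minn0 ?mul0r//; lia.
Qed.

Lemma supp_bound (s : seq int) : exists b : nat, {in s, forall x, - b%:Z <= x <= b%:Z}.
Proof.
exists (\sum_(x <- s) `|x|)%N => x xs; rewrite (big_rem x)//=.
by move: (\sum_(_ <- _) _)%N => c; lia.
Qed.

Variable lam : R.
Hypothesis lam_gt0 : 0 < lam.
Local Notation S := (semigroup (symmetric_walk R) lam).

(** A substitute for countable additivity, which a power series does not provide by itself: up to e
    the particles stay in a window, and a window carries only finitely many configurations. *)
Lemma semigroup_cover N (E : set config) eta t e : confN R N eta ->
  0 <= t -> 0 < e -> exists G : seq config,
  [/\ uniq G, forall g, g \in G -> E g &
      S t \1_E eta <= \sum_(g <- G) S t \1_[set g] eta + e].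
Proof.
move=> ce t0 e0; have [r [ur hr]] := confN_supp ce.
have [b hb] := supp_bound r.
(* A particle outside the window makes the spread at least m^2, while the mean spread is at most N
   t; the quotient is at most e. *)
pose m := Num.bound (N%:R * t / e).
have Nt0 : 0 <= N%:R * t / e by rewrite divr_ge0 ?mulr_ge0// ltW.
have hm : N%:R * t / e < m%:R by exact: archi_boundP.
have m0 : (0 < m)%N by rewrite -(@ltr_nat R) (le_lt_trans Nt0).
pose lo : int := - (b + m)%N%:Z; pose W := (b + m).*2.+1.
pose G := [seq window_config lo g |
  g <- enum {: {ffun 'I_W -> 'I_N.+2}} & window_config lo g \in E].
have uG : uniq G.
  by rewrite map_inj_uniq; [exact/filter_uniq/enum_uniq | exact: window_config_inj].
have GE g : g \in G -> E g.
  by move=> /mapP[h]; rewrite mem_filter => /andP[/set_mem hE _] ->.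
exists G; split => //.
pose chi := spread R (- b%:Z) b m.
have bs := @spread_bounded R N (- b%:Z) b m.
have b1 (g : config) : bounded_on N (\1_[set g] : config -> R) 1.
  exact: indic_bounded.
have sumb : bounded_on N (fun xi => \sum_(g <- G) \1_[set g] xi : R) (\sum_(g <- G) 1).
  move=> xi cx; apply: (le_trans (ler_norm_sum _ _ _)); apply: ler_sum => g _.
  exact: b1.
have mb := bounded_onZ (m ^ 2)%:R^-1 bs.
rewrite -(semigroup_sum lam_gt0 G xpredT t ce b1).
apply: (@le_trans _ _ (S t (fun xi => \sum_(g <- G) \1_[set g] xi +
    (m ^ 2)%:R^-1 * lin chi xi) eta)); last first.
  rewrite (semigroupD lam_gt0 _ ce sumb mb) lerD2l.
  rewrite (semigroupZ lam_gt0 _ _ ce bs).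
  have pq : - b%:Z <= b%:Z by lia.
  apply: (le_trans (ler_wpM2l _ (semigroup_spread lam_gt0 ce pq m0 t0))).
    by rewrite invr_ge0.
  rewrite lin_spread_eq0 ?add0r; last first.
    by move=> x xb; apply: hr; apply: contra xb; exact: hb.
  have m1 : 0 < m%:R :> R by rewrite ltr0n.
  rewrite mulrC ler_pdivrMr ?ltr0n ?expn_gt0 ?m0//.
  move: hm; rewrite ltr_pdivrMr// => /ltW hm.
  apply: (le_trans hm); rewrite [leRHS]mulrC; apply: ler_wpM2r; first exact: ltW.
  by rewrite ler_nat -mulnn leq_pmulr.
apply: (semigroup_le lam_gt0 ce (indic_bounded _) (bounded_onD sumb mb)) => // xi cx.
have s0 : 0 <= \sum_(g <- G) \1_[set g] xi :> R.
  by apply: sumr_ge0 => g _; rewrite indicE.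
have l0 : 0 <= (m ^ 2)%:R^-1 * lin chi xi.
  by rewrite mulr_ge0 ?invr_ge0// lin_ge0// => x; exact: ler0n.
rewrite indicE; case: (boolP (xi \in E)) => [xE|_]; last by rewrite addr_ge0.
have [hin|] := pselect (forall x, ~~ (lo <= x < lo + W%:Z) -> xi x = Active 0).
  have [g gE] := window_configP (fun x => particles_le x cx) hin.
  have xG : xi \in G.
    apply/mapP; exists g => //; rewrite mem_filter mem_enum andbT.
    by rewrite gE.
  rewrite (big_rem xi)//= indicE mem_set// -addrA lerDl addr_ge0//.
  by apply: sumr_ge0 => g' _; rewrite indicE.
move=> /existsNP[x /not_implyP[xo xa]].
rewrite ler_wpDl//.
have := @lin_ge_site chi x xi cx.1 (fun w => ler0n _ _).
rewrite /chi spread_out// => hl.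
rewrite mulrC ler_pdivlMr ?ltr0n ?expn_gt0 ?m0// mul1r.
apply: le_trans hl; rewrite ler_peMr// (ler_nat _ 1).
by case: (xi x) xa => [[|k]|].
Qed.

End Cover.

(** * Countable decompositions of path events *)

Section MeasureEnum.
Context d (T : measurableType d) (R : realType).
Variables (mu : {measure set T -> \bar R}) (I : eqType).

(** The enumerations come from [unpickle] and repeat values; a sum over them counts first
    occurrences only. *)
Definition fresh (e : nat -> I) (k : nat) : bool :=
  all (fun j => e j != e k) (iota 0 k).

Lemma freshP (e : nat -> I) k : exists j, [/\ (j <= k)%N, e j = e k & fresh e j].
Proof.
have h : exists j, e j == e k by exists k.
exists (ex_minn h); case: ex_minnP => j /eqP jk jmin; split => //.
  by apply: jmin.
apply/allP => i; rewrite mem_iota add0n => /= ij; apply/negP => /eqP eij.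
by have := jmin i; rewrite eij jk eqxx => /(_ isT); rewrite leqNgt ij.
Qed.

Lemma measure_enum (e : nat -> I) (al : I -> set T) :
  (forall i, measurable (al i)) ->
  (forall i j, i != j -> al i `&` al j = set0) ->
  mu (\bigcup_k al (e k)) =
  (\sum_(k <oo) if fresh e k then mu (al (e k)) else 0)%E.
Proof.
move=> mal dal; pose F k := if fresh e k then al (e k) else set0.
have -> : \bigcup_k al (e k) = \bigcup_k F k.
  apply/seteqP; split => [x [k _ xk]|x [k _]]; last first.
    by rewrite /F; case: ifP => // _ xk; exists k.
  have [j [_ jk fj]] := freshP e k.
  by exists j => //; rewrite /F fj jk.
have mF k : measurable (F k) by rewrite /F; case: ifP.
rewrite measure_semi_bigcup//; last exact: bigcupT_measurable.
  by apply: eq_eseriesr => k _; rewrite /F; case: ifP => // _; rewrite measure0.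
apply/trivIsetP => i j _ _; wlog ij : i j / (i < j)%N.
  move=> wh ne; move: (ne); rewrite neq_ltn => /orP[h|h]; first exact: wh.
  by rewrite setIC wh// eq_sym.
move=> _; rewrite /F; case: ifP => // _; last by rewrite set0I.
case: ifP => [|_]; last by rewrite setI0.
move=> /allP /(_ i); rewrite mem_iota add0n ij => /(_ isT); exact: dal.
Qed.

Lemma sum_le_measure (G : seq I) (al : I -> set T) (Y : set T) :
  uniq G -> (forall i, measurable (al i)) -> measurable Y ->
  (forall i j, i != j -> al i `&` al j = set0) ->
  (forall i, i \in G -> al i `<=` Y) ->
  (\sum_(i <- G) mu (al i) <= mu Y)%E.
Proof.
move=> uG mal + dal; elim: G uG Y => [|i G IH] /= uG Y mY sY.
  by rewrite big_nil.
move/andP: uG => [iG uG]; rewrite big_cons.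
have iY : al i `<=` Y by apply: sY; rewrite mem_head.
have -> : Y = al i `|` (Y `\` al i) by rewrite setDUK.
rewrite measureU//; last 2 first.
- exact: measurableD.
- by apply/seteqP; split => // x [xi [_]].
apply: leeD => //; apply: IH => //; first exact: measurableD.
move=> j jG x xj; split; first by apply: sY xj; rewrite inE jG orbT.
move=> xi; have : (al i `&` al j) x by [].
by rewrite dal//; apply: contraNneq iG => ->.
Qed.

End MeasureEnum.

Section PathEvents.
Variable R : realType.
Implicit Types (w : raw_path R) (t : R) (n : nat).

Lemma measurable_coord t (x : int) (a : occupation) : 0 <= t ->
  measurable ([set w : raw_path R | w t x = a] : set (Defs.path R)).
Proof. by move=> t0; apply: sub_sigma_algebra; exists x, t, a. Qed.

Lemma measurable_state t (eta : config) : 0 <= t ->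
  measurable ([set w : raw_path R | w t = eta] : set (Defs.path R)).
Proof.
move=> t0; rewrite (_ : [set w : raw_path R | w t = eta] =
    ~` \bigcup_(x in [set: int]) ~` ([set w : raw_path R | w t x = eta x] : set (Defs.path R))).
  apply: measurableC; apply: countable_bigcupT_measurable => // x.
  by apply: measurableC; exact: measurable_coord.
apply/seteqP; split => w /= h; first by move=> [x _]; apply; rewrite /= h.
apply/funext => x; apply: contrapT => wx; apply: h; by exists x.
Qed.

Variable t : nat -> R.
Hypotheses (t0 : t 0%N = 0) (t_mono : forall i, t i <= t i.+1).

Lemma t_ge0 i : 0 <= t i.
Proof. by elim: i => [|i IH]; [rewrite t0 | exact: le_trans (t_mono i)]. Qed.

Definition hist n w : seq config := mkseq (fun i => w (t i)) n.+1.

Definition hist_event n (s : seq config) : set (Defs.path R) :=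
  [set w : raw_path R | hist n w = s].

Lemma hist_eventE n (eta : nat -> config) :
  hist_event n (mkseq eta n.+1) =
  [set w : raw_path R | forall i, (i <= n)%N -> w (t i) = eta i].
Proof.
apply/seteqP; split => w /= => [h i ni|h].
  by have := congr1 (fun s => nth (eta 0%N) s i) h; rewrite !nth_mkseq.
apply: (@eq_from_nth _ (eta 0%N)); rewrite !size_mkseq// => i ni.
by rewrite !nth_mkseq//; apply: h.
Qed.

Lemma hist_eventE' n (s : seq config) (c : config) : size s = n.+1 ->
  hist_event n s =
  [set w : raw_path R | forall i, (i <= n)%N -> w (t i) = nth c s i].
Proof.
move=> ss; rewrite -hist_eventE; congr hist_event.
by rewrite -ss mkseq_nth.
Qed.

Lemma measurable_hist n s : measurable (hist_event n s).
Proof.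
have [ss|ss] := eqVneq (size s) n.+1; last first.
  rewrite (_ : hist_event n s = set0)//; apply/seteqP; split => // w /= ws.
  by rewrite -ws size_mkseq eqxx in ss.
rewrite (hist_eventE' (fun=> Active 0) ss).
rewrite (_ : [set w | _] = \bigcap_(i in [set i | (i <= n)%N])
   ([set w : raw_path R | w (t i) = nth (fun=> Active 0) s i] : set (Defs.path R))).
  apply: bigcap_measurableType => i _; apply: measurable_state; exact: t_ge0.
by apply/seteqP; split => w h i ni; apply: h.
Qed.

Lemma hist_disjoint n s s' : s != s' -> hist_event n s `&` hist_event n s' = set0.
Proof.
move=> ne; apply/seteqP; split => // w [/= h h'].
by move: ne; rewrite -h -h' eqxx.
Qed.

End PathEvents.

Section Enumeration.

(** Sites missing from the list get the default code 0, that is, they are empty. The code makes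
    finitely supported configurations countable. *)
Definition config_of_code (s : seq (int * nat)) : config :=
  fun x => occ_of_nat (nth 0%N (map snd s) (index x (map fst s))).

Lemma config_of_code_fin s : finsupp (config_of_code s).
Proof.
exists (map fst s) => x xs; rewrite /config_of_code nth_default//.
by rewrite size_map; move: xs; rewrite -index_mem size_map -leqNgt.
Qed.

Definition config_enum (k : nat) : config :=
  config_of_code (odflt [::] (unpickle k)).

Lemma config_enum_fin k : finsupp (config_enum k).
Proof. exact: config_of_code_fin. Qed.

Lemma config_enumP eta : finsupp eta -> exists k, config_enum k = eta.
Proof.
move=> [s hs]; exists (pickle [seq (x, nat_of_occ (eta x)) | x <- s]).
rewrite /config_enum pickleK /=; apply/funext => x.
rewrite /config_of_code -!map_comp /= (_ : fst \o _ = id) ?map_id//.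
have [xs|xs] := boolP (x \in s).
  by rewrite (nth_map 0) ?index_mem//= nth_index// nat_of_occK.
by rewrite nth_default ?hs// size_map leqNgt index_mem.
Qed.

Definition history_enum (k : nat) : seq config :=
  map config_enum (odflt [::] (unpickle k)).

Lemma history_enum_fin k : {in history_enum k, forall eta, finsupp eta}.
Proof. by move=> eta /mapP[j _ ->]; exact: config_enum_fin. Qed.

Lemma history_enumP (s : seq config) : {in s, forall eta, finsupp eta} ->
  exists k, history_enum k = s.
Proof.
move=> hs; suff [l <-] : exists l, map config_enum l = s.
  by exists (pickle l); rewrite /history_enum pickleK.
elim: s hs => [|eta s IH] hs; first by exists [::].
have [l <-] := IH (fun x xs => hs x (mem_behead (s := eta :: s) xs)).
have [k <-] := config_enumP (hs eta (mem_head _ _)).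
by exists (k :: l).
Qed.

End Enumeration.

Lemma finsupp_confN (R : realType) eta : finsupp eta -> exists N, confN R N eta.
Proof.
move=> [s /supp_in_undup hs]; exists (\sum_(x <- undup s) particles (eta x))%N.
split; first by exists (undup s).
rewrite (linE _ (undup_uniq s) hs) natr_sum; apply: eq_bigr => x _.
by rewrite mul1r.
Qed.

(** * The Markov property of the finite system *)

Section FiniteLaw.
Variables (R : realType) (lam : R).
Hypothesis lam_gt0 : 0 < lam.
Local Notation S := (semigroup (symmetric_walk R) lam).
Variables (nu : probability config R) (V : set int) (P : probability (Defs.path R) R).
Hypotheses (Vfin : finite_set V)
  (lawP : finite_ARW_law (symmetric_walk R) lam nu V P).
Variable t : nat -> R.
Hypotheses (t0 : t 0%N = 0) (t_mono : forall i, t i <= t i.+1).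

Lemma law_hist n (eta : nat -> config) :
  P (hist_event t n (mkseq eta n.+1)) =
  (nu (restrict V @^-1` [set eta 0%N]) *
   (\prod_(i < n) transition (symmetric_walk R) lam (t i.+1 - t i) (eta i) (eta i.+1))%:E)%E.
Proof. by rewrite hist_eventE; exact: lawP. Qed.

Lemma law_hist_rcons n (eta : nat -> config) (g : config) :
  P (hist_event t n.+1 (rcons (mkseq eta n.+1) g)) =
  (P (hist_event t n (mkseq eta n.+1)) *
   (S (t n.+1 - t n) \1_[set g] (eta n))%:E)%E.
Proof.
pose eta' i := if i == n.+1 then g else eta i.
have e1 : mkseq eta n.+1 = mkseq eta' n.+1.
  apply: (@eq_from_nth _ g); rewrite !size_mkseq// => i ni.
  by rewrite !nth_mkseq// /eta' ltn_eqF.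
have -> : rcons (mkseq eta n.+1) g = mkseq eta' n.+2.
  by rewrite [RHS]mkseqS -e1 /eta' eqxx.
rewrite e1 !law_hist big_ord_recr /= EFinM muleA; congr (_ * _)%E.
by rewrite /transition /eta' eqxx ltn_eqF.
Qed.

(** Finitely many points of E carry the semigroup up to e; each extends the history by one step, and
    the extended histories are disjoint events. *)
Lemma markov_lower n (eta : nat -> config) (E : set config) :
  finsupp (eta n) ->
  measurable ([set w : raw_path R | E (w (t n.+1))] : set (Defs.path R)) ->
  (P (hist_event t n (mkseq eta n.+1)) * (S (t n.+1 - t n) \1_E (eta n))%:E <=
   P (hist_event t n (mkseq eta n.+1) `&` [set w : raw_path R | E (w (t n.+1))]))%E.
Proof.
move=> fe mE; have [N ce] := finsupp_confN R fe.
set H := hist_event _ _ _; set Q := [set w : raw_path R | _].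
have mH : measurable H := measurable_hist t0 t_mono n _.
have d0 : 0 <= t n.+1 - t n by rewrite subr_ge0.
have PHf := fin_num_measure P _ mH.
apply/lee_addgt0Pr => e e0.
have [G [uG GE hG]] := semigroup_cover lam_gt0 E ce d0 e0.
apply: (@le_trans _ _ (P H * (\sum_(g <- G) S (t n.+1 - t n) \1_[set g] (eta n) + e)%:E)%E).
  by rewrite lee_wpmul2l ?lee_fin.
rewrite EFinD muleDr ?fin_num_adde_defl//; apply: leeD; last first.
  rewrite -[leRHS]mul1e; apply: lee_wpmul2r; first by rewrite lee_fin ltW.
  exact: probability_le1.
rewrite -sumEFin ge0_sume_distrr; last first.
  move=> g _; rewrite lee_fin; exact: (semigroup_ge0 lam_gt0 ce (indic_bounded _)).
under eq_bigr do rewrite -law_hist_rcons.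
pose al (g : config) := hist_event t n.+1 (rcons (mkseq eta n.+1) g).
apply: (@sum_le_measure _ _ _ P _ G al) => //.
- by move=> g; exact: measurable_hist.
- exact: measurableI.
- move=> g g' gg'; apply: hist_disjoint.
  by apply: contra gg' => /eqP /rcons_inj[->].
move=> g gG w hw.
have : rcons (hist t n w) ((w : raw_path R) (t n.+1)) = rcons (mkseq eta n.+1) g.
  by rewrite -[LHS](mkseqS (fun i => (w : raw_path R) (t i)) n.+1).
move=> /rcons_inj e1; have h1 := congr1 fst e1; have h2 := congr1 snd e1.
by split; [exact: h1 | rewrite /Q /= [X in E X]h2; exact: GE].
Qed.

End FiniteLaw.

Lemma measurable_site (x : int) (a : occupation) :
  measurable ([set eta : int -> occupation | eta x = a] : set config).
Proof. by apply: sub_sigma_algebra; exists x, a. Qed.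

Lemma measurable_restrict (V : set int) (c : config) :
  measurable (restrict V @^-1` [set c] : set config).
Proof.
rewrite (_ : restrict V @^-1` [set c] = ~` \bigcup_(x in [set: int])
    ~` ([set eta : config | restrict V eta x = c x] : set config)).
  apply: measurableC; apply: countable_bigcupT_measurable => // x.
  apply: measurableC; have [xV|xV] := boolP (x \in V).
    rewrite (_ : [set eta : config | _] = [set eta : config | eta x = c x]).
      exact: measurable_site.
    by apply/seteqP; split => eta; rewrite /restrict /= xV.
  have [e|e] := pselect (Active 0 = c x).
    rewrite (_ : [set eta : config | _] = setT); first exact: measurableT.
    by apply/seteqP; split => eta //=; rewrite /restrict (negbTE xV).
  rewrite (_ : [set eta : config | _] = set0); first exact: measurable0.
  by apply/seteqP; split => eta //=; rewrite /restrict (negbTE xV).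
apply/seteqP; split => eta /= h; first by move=> [x _]; apply; rewrite /= h.
apply/funext => x; apply: contrapT => wx; apply: h; by exists x.
Qed.

Lemma finsupp_restrict (V : set int) eta : finite_set V -> finsupp (restrict V eta).
Proof.
move=> /finite_seqP[s ->]; exists s => x xs.
by rewrite /restrict ifN//; apply: contra xs; rewrite inE.
Qed.

Definition empty_config : config := fun=> Active 0.

Lemma probability_setI1 d (T : measurableType d) (R : realType)
  (P : probability T R) (A H : set T) :
  measurable A -> measurable H -> P H = 1%E -> P (A `&` H) = P A.
Proof.
move=> mA mH PH; rewrite (measureDI P mA mH).
rewrite [X in (X + _)%E](_ : _ = 0%E) ?add0e//.
apply/eqP; rewrite -measure_le0 (@le_trans _ _ (P (~` H)))//.
  by apply: le_measure; rewrite ?inE//; [exact: measurableD | exact: measurableC].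
by rewrite probability_setC// PH subee.
Qed.

Section FiniteMarkov.
Variables (R : realType) (lam : R).
Hypothesis lam_gt0 : 0 < lam.
Local Notation S := (semigroup (symmetric_walk R) lam).
Variables (nu : probability config R) (V : set int) (P : probability (Defs.path R) R).
Hypotheses (Vfin : finite_set V)
  (lawP : finite_ARW_law (symmetric_walk R) lam nu V P).
Variable t : nat -> R.
Hypotheses (t0 : t 0%N = 0) (t_mono : forall i, t i <= t i.+1).

(** Only histories of finitely supported configurations are kept, so this is a countable union and
    measurable for every Q. *)
Definition hist_in n (Q : set (seq config)) : set (Defs.path R) :=
  \bigcup_k (if history_enum k \in Q then hist_event t n (history_enum k) else set0).

Let piece n (Q : set (seq config)) (s : seq config) : set (Defs.path R) :=
  if s \in Q then hist_event t n s else set0.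

Lemma measurable_piece n Q s : measurable (piece n Q s).
Proof. by rewrite /piece; case: ifP => // _; exact: measurable_hist. Qed.

Lemma piece_disjoint n Q s s' : s != s' -> piece n Q s `&` piece n Q s' = set0.
Proof.
move=> ss; rewrite /piece; case: ifP => _; last by rewrite set0I.
by case: ifP => _; [exact: hist_disjoint | rewrite setI0].
Qed.

Lemma measurable_hist_in n Q : measurable (hist_in n Q).
Proof. by apply: bigcupT_measurable => k; exact: measurable_piece. Qed.

Lemma hist_inP n Q (w : raw_path R) : Q (hist t n w) ->
  (forall i, (i <= n)%N -> finsupp (w (t i))) -> hist_in n Q w.
Proof.
move=> Qw fw; have [k hk] : exists k, history_enum k = hist t n w.
  apply: history_enumP => eta /mapP[i]; rewrite mem_iota add0n ltnS => /andP[_ ni] ->.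
  exact: fw.
by exists k => //; rewrite hk mem_set.
Qed.

Lemma hist_in_fin n Q (w : raw_path R) : hist_in n Q w ->
  Q (hist t n w) /\ forall i, (i <= n)%N -> finsupp (w (t i)).
Proof.
move=> [k _]; case: ifP => // /set_mem Qk /= hk; rewrite hk; split => // i ni.
apply: (@history_enum_fin k); rewrite -hk; apply/mapP; exists i => //.
by rewrite mem_iota add0n.
Qed.

Lemma markov_hist_in n (Q : set (seq config)) (E : set config) (c : R) :
  0 <= c -> measurable ([set w : raw_path R | E (w (t n.+1))] : set (Defs.path R)) ->
  (forall s : seq config, Q s -> size s = n.+1 -> finsupp (nth empty_config s n) ->
     c <= S (t n.+1 - t n) \1_E (nth empty_config s n)) ->
  (c%:E * P (hist_in n Q) <=
   P (hist_in n Q `&` [set w : raw_path R | E (w (t n.+1))]))%E.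
Proof.
move=> c0 mE hc; set EE := [set w : raw_path R | _].
have -> : hist_in n Q `&` EE = \bigcup_k (piece n Q (history_enum k) `&` EE).
  by rewrite setI_bigcupl.
rewrite (measure_enum P history_enum (al := piece n Q)); last 2 first.
- exact: measurable_piece.
- exact: piece_disjoint.
rewrite (measure_enum P history_enum (al := fun s => piece n Q s `&` EE)); last 2 first.
- by move=> s; apply: measurableI => //; exact: measurable_piece.
- by move=> s s' ss; rewrite setIACA piece_disjoint// set0I.
rewrite -nneseriesZl; last by move=> k _; case: ifP.
apply: lee_nneseries => [k _ _|k _].
  by case: ifP => _; rewrite ?mule0// mule_ge0.
case: ifP => _; last by rewrite mule0.
rewrite /piece; case: ifP => [/set_mem Qk|_]; last by rewrite set0I measure0 mule0.
have [ss|ss] := eqVneq (size (history_enum k)) n.+1; last first.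
  rewrite (_ : hist_event t n (history_enum k) = set0) ?set0I ?measure0 ?mule0//.
  apply/seteqP; split => // w /= ws.
  by move: ss; rewrite -ws size_mkseq eqxx.
have fn : finsupp (nth empty_config (history_enum k) n).
  by apply: (@history_enum_fin k); rewrite mem_nth// ss.
have eS : history_enum k = mkseq (nth empty_config (history_enum k)) n.+1.
  by rewrite -ss mkseq_nth.
have := @markov_lower R lam lam_gt0 nu V P lawP t t0 t_mono n
  (nth empty_config (history_enum k)) E fn mE.
rewrite -eS; apply: le_trans; rewrite muleC; apply: lee_wpmul2l => //.
by rewrite lee_fin; exact: hc.
Qed.

(** The point masses are shown to exhaust the law. At time 0 they do because every restriction to V
    has finite support; afterwards finite support persists by the Markov bound with c = 1. *)
Lemma hist_in_full n : P (hist_in n setT) = 1%E.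
Proof.
elim: n => [|n IH].
  pose bt (s : seq config) : set config :=
    if s is [:: c] then restrict V @^-1` [set c] else set0.
  have mbt s : measurable (bt s).
    by case: s => [|c [|c' s]] //=; exact: measurable_restrict.
  have dbt s s' : s != s' -> bt s `&` bt s' = set0.
    case: s s' => [|c [|c2 s]] [|c' [|c2' s']] //= cc; rewrite ?set0I ?setI0//.
    apply/seteqP; split => // eta [/= h h'].
    by move: cc; rewrite -h -h' eqxx.
  rewrite /hist_in (measure_enum P history_enum (al := piece 0 setT)); last 2 first.
  - exact: measurable_piece.
  - exact: piece_disjoint.
  rewrite (@eq_eseriesr _ _ (fun k => if fresh history_enum k
      then nu (bt (history_enum k)) else 0%E)); last first.
    move=> k _; case: ifP => // _; rewrite /piece mem_set//.
    case: (history_enum k) => [|c [|c2 s]] /=.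
    - rewrite measure0 (_ : hist_event _ _ _ = set0) ?measure0//.
      by apply/seteqP; split.
    - have := @law_hist R lam nu V P lawP t t0 t_mono 0 (fun=> c).
      by rewrite big_ord0 mule1.
    - rewrite measure0 (_ : hist_event _ _ _ = set0) ?measure0//.
      by apply/seteqP; split.
  rewrite -(measure_enum nu history_enum mbt dbt).
  rewrite (_ : \bigcup_k _ = setT); first exact: probability_setT.
  apply/seteqP; split => // eta _.
  have [k hk] : exists k, history_enum k = [:: restrict V eta].
    apply: history_enumP => x; rewrite inE => /eqP ->.
    exact: finsupp_restrict.
  by exists k => //; rewrite hk.
pose E : set config := finsupp.
have mE : measurable ([set w : raw_path R | E (w (t n.+1))] : set (Defs.path R)).
  rewrite (_ : [set w : raw_path R | _] = \bigcup_k
     ([set w : raw_path R | w (t n.+1) = config_enum k] : set (Defs.path R))).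
    apply: bigcupT_measurable => k; apply: measurable_state.
    exact: (t_ge0 t0 t_mono).
  apply/seteqP; split => w /=.
    by move=> /config_enumP[k hk]; exists k => //=; rewrite hk.
  by move=> [k _ /= hk]; rewrite /E [X in finsupp X]hk; exact: config_enum_fin.
have := @markov_hist_in n setT E 1 ler01 mE _.
rewrite mul1e IH => h; apply/eqP; rewrite eq_le probability_le1/=; last first.
  exact: measurable_hist_in.
apply: (le_trans (h _)).
  move=> s _ _ fs; have [N cN] := finsupp_confN R fs.
  rewrite (semigroup_ext lam_gt0 (g := fun=> 1) _ cN).
    by rewrite (semigroup_cst lam_gt0 _ _ cN).
  by move=> xi [fx _]; rewrite indicE mem_set.
apply: le_measure; rewrite ?inE.
- by apply: measurableI => //; exact: measurable_hist_in.
- exact: measurable_hist_in.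
move=> w [/hist_in_fin [_ fw] Ew]; apply: hist_inP => // i.
by rewrite leq_eqVlt => /predU1P[->//|]; rewrite ltnS; exact: fw.
Qed.

Lemma markov_hist n (Q : set (seq config)) (E : set config) (c : R) :
  0 <= c -> measurable ([set w : raw_path R | E (w (t n.+1))] : set (Defs.path R)) ->
  measurable ([set w : raw_path R | Q (hist t n w)] : set (Defs.path R)) ->
  (forall s : seq config, Q s -> size s = n.+1 -> finsupp (nth empty_config s n) ->
     c <= S (t n.+1 - t n) \1_E (nth empty_config s n)) ->
  (c%:E * P [set w : raw_path R | Q (hist t n w)] <=
   P ([set w : raw_path R | Q (hist t n w)] `&`
      [set w : raw_path R | E (w (t n.+1))]))%E.
Proof.
move=> c0 mE mQ hc; have := markov_hist_in c0 mE hc.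
have -> : P (hist_in n Q) = P [set w : raw_path R | Q (hist t n w)].
  have -> : hist_in n Q =
      [set w : raw_path R | Q (hist t n w)] `&` hist_in n setT.
    apply/seteqP; split => w.
      by move=> /hist_in_fin[Qw fw]; split => //; exact: hist_inP.
    by move=> [Qw /hist_in_fin[_ fw]]; exact: hist_inP.
  by rewrite probability_setI1//; [exact: measurable_hist_in | exact: hist_in_full].
move=> h; apply: (le_trans h); apply: le_measure; rewrite ?inE.
- by apply: measurableI => //; exact: measurable_hist_in.
- exact: measurableI.
by move=> w [/hist_in_fin[Qw _] Ew].
Qed.

End FiniteMarkov.

(** * Borel-Cantelli *)

Section Events.
Variable R : realType.
Implicit Types (w : raw_path R) (t T : R) (x y : int) (n m : nat).

Definition act_event (t : R) (x : int) : set (Defs.path R) :=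
  [set w : raw_path R | active (w t) x].

Definition quiet_event (y : int) (m n : nat) : set (Defs.path R) :=
  [set w : raw_path R | forall j, (m <= j <= n)%N -> ~~ active (w j%:R) y].

Section SubSigma.
Variable G : set (set (raw_path R)).
Local Notation MG := (@measurable _ (g_sigma_algebraType G)).

(** For an arbitrary generating family, to serve both for measurability and for [determined_by]. *)
Lemma sub_act_event t x : (forall a, G [set w | w t x = a]) ->
  MG (act_event t x).
Proof.
move=> hG; rewrite (_ : act_event t x =
    \bigcup_k [set w : raw_path R | w t x = Active k.+1]).
  by apply: bigcupT_measurable => k; apply: sub_sigma_algebra; exact: hG.
apply/seteqP; split => w; first by move=> /activeP[k hk]; exists k.
by move=> [k _ hk]; apply/activeP; exists k.
Qed.

Lemma sub_quiet_event y m n :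
  (forall j, (m <= j <= n)%N -> MG (act_event j%:R y)) ->
  MG (quiet_event y m n).
Proof.
move=> h; rewrite (_ : quiet_event y m n =
    \bigcap_(j in [set j | (m <= j <= n)%N]) ~` act_event j%:R y).
  by apply: bigcap_measurableType => j jn; apply: measurableC; exact: h.
by apply/seteqP; split => w hw j jn; [apply/negP; exact: hw | apply/negP; exact: hw].
Qed.

End SubSigma.

Lemma determined_act (B : set int) T t x : B x -> 0 <= t <= T ->
  determined_by B T (act_event t x).
Proof.
move=> Bx tT; apply: (sub_act_event (G := path_cylinders B `[0, T])) => a.
by exists x, t, a; split => //=; rewrite in_itv.
Qed.

Lemma determined_quiet (B : set int) T y m n : B y -> n%:R <= T ->
  determined_by B T (quiet_event y m n).
Proof.
move=> By nT; apply: (sub_quiet_event (G := path_cylinders B `[0, T])) => j /andP[_ jn].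
by apply: determined_act => //; rewrite ler0n (le_trans _ nT)// ler_nat.
Qed.

Lemma determined_setI (B : set int) T (A A' : set (Defs.path R)) :
  determined_by B T A -> determined_by B T A' -> determined_by B T (A `&` A').
Proof.
exact: (@measurableI _ (g_sigma_algebraType (path_cylinders B `[0, T]))).
Qed.

Lemma measurable_act t x : 0 <= t -> measurable (act_event t x).
Proof.
move=> t0; apply: (sub_act_event (G := path_cylinders setT [set t | 0 <= t])).
by move=> a; exists x, t, a.
Qed.

Lemma measurable_quiet y m n : measurable (quiet_event y m n).
Proof.
apply: (sub_quiet_event (G := path_cylinders setT [set t | 0 <= t])) => j _.
exact: measurable_act.
Qed.

(** Right-continuity in the discrete topology: activity at a real time lasts until a later rational
    one. Measurability follows. *)
Lemma stays_activeE : @stays_active R = \bigcap_(x in [set: int])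
  \bigcap_n \bigcup_(q in [set: rat])
    (if n%:R <= ratr q :> R then act_event (ratr q) x else set0).
Proof.
apply/seteqP; split => w.
  case: w => w cw /= hw x _ n _; have [t nt at_] := hw x n%:R (ler0n _ _).
  have [wr _] := cw x; have t0 : 0 <= t by rewrite (le_trans _ nt).
  have [e /= e0 he] := wr t t0; have te : t < t + e by rewrite ltrDl.
  have [q] := rat_in_itvoo te; rewrite in_itv /= => /andP[tq qe].
  exists q => //; rewrite ifT ?(le_trans nt (ltW tq))//.
  rewrite /act_event /active /= he//=.
  by rewrite distrC ger0_norm ?subr_ge0 ?ltW// ltrBlDl.
move=> hw x T T0; have := hw x I (Num.bound T) I.
move=> [q _]; case: ifP => // Tq aq; exists (ratr q) => //.
by apply: le_trans Tq; apply/ltW/archi_boundP.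
Qed.

Lemma measurable_stays_active : measurable (@stays_active R).
Proof.
rewrite stays_activeE -[X in measurable X]setCK setC_bigcap.
apply/measurableC/countable_bigcupT_measurable => // x.
apply/measurableC/bigcapT_measurable => n.
apply: bigcupT_measurable_rat => q; case: ifP => // nq.
by apply: measurable_act; rewrite (le_trans _ nq).
Qed.

End Events.

(** * Infinite volume and recurrence *)

Section Infinite.
Variables (R : realType) (lam : R).
Hypothesis lam_gt0 : 0 < lam.
Local Notation S := (semigroup (symmetric_walk R) lam).
Local Notation law := (finite_ARW_law (symmetric_walk R) lam).

Section OneVolume.
Variables (nu : probability config R) (V : set int) (P : probability (Defs.path R) R).
Hypotheses (Vfin : finite_set V) (lawP : law nu V P).

Lemma markov_quiet (x y : int) m n : y = x + 1 \/ y = x - 1 ->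
  ((wake_prob lam)%:E * P (quiet_event y m n `&` act_event n%:R x) <=
   P (quiet_event y m n `&` act_event n%:R x `&` act_event n.+1%:R y))%E.
Proof.
move=> xy; pose t i : R := i%:R.
have t0 : t 0%N = 0 by [].
have t_mono i : t i <= t i.+1 by rewrite ler_nat.
pose Q (s : seq config) := (forall j, (m <= j <= n)%N ->
   ~~ active (nth empty_config s j) y) /\ active (nth empty_config s n) x.
pose E : set config := [set eta | active eta y].
have QE : [set w : raw_path R | Q (hist t n w)] =
    quiet_event y m n `&` act_event n%:R x.
  apply/seteqP; split => w [h1 h2]; split.
  - move=> j jn; have := h1 j jn; rewrite nth_mkseq//.
    by move/andP: jn => [_]; rewrite ltnS.
  - by move: h2; rewrite nth_mkseq.
  - move=> j jn; rewrite nth_mkseq; first exact: h1.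
    by move/andP: jn => [_]; rewrite ltnS.
  - by rewrite nth_mkseq.
rewrite -QE.
apply: (markov_hist lam_gt0 Vfin lawP t0 t_mono (E := E)).
- exact/ltW/wake_prob_gt0.
- exact: (measurable_act y (ler0n R n.+1)).
- by rewrite QE; apply: measurableI; [exact: measurable_quiet | exact: measurable_act].
move=> s [_ ax] ss fs; have [N ce] := finsupp_confN R fs.
have -> : t n.+1 - t n = 1 by rewrite /t -natr1 addrAC subrr add0r.
apply: (le_trans (semigroup_psi_next lam_gt0 ce ax xy)).
apply: (semigroup_le lam_gt0 ce (@psi_bounded R N y) (indic_bounded _)) => // xi _.
exact: psi_le_indic.
Qed.

Lemma semigroup_act_le (eta : config) (x : int) n : finsupp eta ->
  (nu (restrict V @^-1` [set eta]) * (S n%:R \1_[set xi | active xi x] eta)%:E <=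
   P (act_event n%:R x))%E.
Proof.
(* The times 0, n, n, ...: the Markov bound is used for one step of length n. *)
move=> fe; pose t i : R := if i is 0 then 0 else n%:R.
have t0 : t 0%N = 0 by [].
have t_mono i : t i <= t i.+1 by case: i => /=.
have := markov_lower lam_gt0 lawP t0 t_mono (n := 0) (eta := fun=> eta)
  (E := [set xi | active xi x]) fe (measurable_act x (ler0n R n)).
rewrite (law_hist lawP t0 t_mono) big_ord0 mule1 /= subr0 => h.
apply: (le_trans h); apply: le_measure; rewrite ?inE.
- apply: measurableI; first exact: measurable_hist.
  exact: measurable_act.
- exact: measurable_act.
by move=> w [].
Qed.

End OneVolume.

Section Limit.
Variables (nu : probability config R) (P : probability (Defs.path R) R).
Variable PV : set int -> probability (Defs.path R) R.
Hypotheses (lawPV : forall V, finite_set V -> law nu V (PV V))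
  (limPV : forall (B : set int) (T : R) (A : set (Defs.path R)),
      finite_set B -> determined_by B T A ->
      PV V A @[V --> finite_sets_up] --> P A).

Lemma ARW_approx (B : set int) (T : R) (A : set (Defs.path R)) (e : R) :
  finite_set B -> determined_by B T A -> measurable A -> 0 < e ->
  exists2 V0 : set int, finite_set V0 &
    forall V, finite_set V -> V0 `<=` V -> `|fine (P A) - fine (PV V A)| < e.
Proof.
move=> Bf dA mA e0; have h := limPV Bf dA.
have PA : P A \is a fin_num := fin_num_measure P _ mA.
rewrite -(fineK PA) in h.
have FF : Filter finite_sets_up.
  apply: filter_from_filter; first by exists set0.
  move=> V1 V2 f1 f2; exists (V1 `|` V2); first by rewrite finite_setU.
  by move=> V [fV]; rewrite subUset => -[s1 s2].
have h' := @fine_fcvg _ _ (fmap_filter _ FF) _ h.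
have [V0 fV0 hV0] := (@cvgrPdist_lt _ _ _ _ FF _ _).1 h' e e0.
by exists V0 => // V fV V0V; apply: hV0.
Qed.

(** The infinite process is known only as a limit on local events, so Markov bounds are carried over
    event by event. *)
Lemma limit_le (B : set int) (T : R) (A A' : set (Defs.path R)) (c : R) :
  finite_set B -> determined_by B T A -> determined_by B T A' ->
  measurable A -> measurable A' -> 0 <= c ->
  (forall V, finite_set V -> (c%:E * PV V A <= PV V A')%E) ->
  (c%:E * P A <= P A')%E.
Proof.
move=> Bf dA dA' mA mA' c0 hV.
have PA : P A \is a fin_num := fin_num_measure P _ mA.
have PA' : P A' \is a fin_num := fin_num_measure P _ mA'.
rewrite -(fineK PA) -(fineK PA') -EFinM lee_fin; apply/ler_addgt0Pr => e e0.
have e1 : 0 < e / (1 + c) by rewrite divr_gt0// ltr_pwDl.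
have [V0 fV0 h0] := ARW_approx Bf dA mA e1.
have [V1 fV1 h1] := ARW_approx Bf dA' mA' e1.
pose V := V0 `|` V1.
have fV : finite_set V by rewrite finite_setU.
have {}h0 := h0 V fV (@subsetUl _ _ _); have {}h1 := h1 V fV (@subsetUr _ _ _).
have := hV V fV.
have QA : PV V A \is a fin_num := fin_num_measure (PV V) _ mA.
have QA' : PV V A' \is a fin_num := fin_num_measure (PV V) _ mA'.
rewrite -(fineK QA) -(fineK QA') -EFinM lee_fin.
move: h0 h1; rewrite !ltr_norml => /andP[_ h0] /andP[h1 _] h.
have h2 : c * fine (P A) <= c * (fine (PV V A) + e / (1 + c)).
  by rewrite ler_wpM2l//; lra.
have h3 : e / (1 + c) + c * (e / (1 + c)) = e.
  rewrite -[X in X + _]mul1r -mulrDl mulrC divfK// gt_eqF// ltr_pwDl//.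
rewrite mulrDr in h2; lra.
Qed.

Lemma markov_quiet_limit (x y : int) m n : y = x + 1 \/ y = x - 1 ->
  ((wake_prob lam)%:E * P (quiet_event y m n `&` act_event n%:R x) <=
   P (quiet_event y m n `&` act_event n%:R x `&` act_event n.+1%:R y))%E.
Proof.
move=> xy; pose B : set int := [set` [:: x; y]].
have Bx : B x by rewrite /B /= mem_head.
have By : B y by rewrite /B /= inE mem_head orbT.
have dA : determined_by B n.+1%:R (quiet_event y m n `&` act_event n%:R x : set (Defs.path R)).
  apply: determined_setI.
    by apply: determined_quiet => //; rewrite ler_nat.
  by apply: determined_act => //; rewrite ler0n ler_nat /=.
apply: (@limit_le B n.+1%:R) => //.
- exact: finite_seq.
- apply: determined_setI => //.
  by apply: determined_act => //; rewrite ler0n lexx.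
- by apply: measurableI; [exact: measurable_quiet | exact: measurable_act].
- apply: measurableI; last exact: measurable_act.
  by apply: measurableI; [exact: measurable_quiet | exact: measurable_act].
- exact/ltW/wake_prob_gt0.
- by move=> V fV; exact: (markov_quiet fV (lawPV fV)).
Qed.

(** Integer times only, to match the unit steps of the Markov bound. *)
Definition recurrent (x : int) : set (Defs.path R) :=
  lim_sup_set (fun n => act_event n%:R x).

Lemma measurable_recurrent x : measurable (recurrent x).
Proof.
apply: bigcapT_measurable => n; apply: bigcup_measurable => k _.
exact: measurable_act.
Qed.

(* Each time x is active while y has stayed quiet since time m, y is active one
   unit of time later with probability at least [wake_prob]; these second events
   are disjoint for fixed m, so the first ones happen finitely often. *)
Lemma recurrent_next (x y : int) : y = x + 1 \/ y = x - 1 ->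
  P.-negligible (recurrent x `\` recurrent y).
Proof.
move=> xy.
pose F m k := quiet_event y m (m + k) `&` act_event (m + k)%:R x : set (Defs.path R).
pose X m k := F m k `&` act_event (m + k).+1%:R y.
have mF m k : measurable (F m k).
  by apply: measurableI; [exact: measurable_quiet | exact: measurable_act].
have mX m k : measurable (X m k).
  by apply: measurableI => //; exact: measurable_act.
have Xdisj m : trivIset setT (X m).
  apply/trivIsetP => i j _ _; wlog ij : i j / (i < j)%N.
    move=> wh ne; move: (ne); rewrite neq_ltn => /orP[h|h]; first exact: wh.
    by rewrite setIC wh// eq_sym.
  move=> _; apply/seteqP; split => // w [[_ ay] [[q _] _]].
  have := q (m + i).+1; rewrite -addnS leq_addr leq_add2l ij => /(_ isT).
  by rewrite addnS ay.
have c0 := wake_prob_gt0 lam.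
have Pls m : P (lim_sup_set (F m)) = 0%E.
  apply: lim_sup_set_cvg0 => //.
  have h : ((wake_prob lam)%:E * \sum_(k <oo) P (F m k) <= 1)%E.
    rewrite -nneseriesZl//.
    apply: (@le_trans _ _ (\sum_(k <oo) P (X m k))%E).
      apply: lee_nneseries => [k _ _|k _]; first by rewrite mule_ge0// lee_fin ltW.
      exact: markov_quiet_limit.
    rewrite -measure_semi_bigcup//; last exact: bigcupT_measurable.
    by apply: probability_le1; exact: bigcupT_measurable.
  rewrite ltey; apply/negP => /eqP e; move: h.
  by rewrite e gt0_muley ?lte_fin// leNgt ltey.
have : P.-negligible (\bigcup_m lim_sup_set (F m)).
  apply: negligible_bigcup => m; apply/negligibleP; last exact: Pls.
  apply: bigcapT_measurable => n; exact: bigcup_measurable.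
apply: negligibleS => w [xw /existsNP[m /not_implyP[_ ym]]].
exists m => // n _; have [k /= nk ak] := xw (m + n)%N I.
exists (k - m)%N => /=; first by lia.
have mk : (m + (k - m))%N = k by lia.
rewrite /F mk; split => // j /andP[mj jk]; apply/negP => aj.
by apply: ym; exists j.
Qed.

Lemma recurrent_all (x : int) : P.-negligible (recurrent 0 `\` recurrent x).
Proof.
have tr (y z : int) : P.-negligible (recurrent 0 `\` recurrent y) ->
    P.-negligible (recurrent y `\` recurrent z) ->
    P.-negligible (recurrent 0 `\` recurrent z).
  move=> h1 h2; apply: negligibleS (negligibleU h1 h2) => w [w0 wz].
  by have [wy|wy] := pselect (recurrent y w); [right | left].
have pos n : P.-negligible (recurrent 0 `\` recurrent n%:Z).
  elim: n => [|n IH]; first by rewrite setDv; exact: negligible_set0.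
  by apply: (tr _ _ IH); apply: recurrent_next; left; lia.
have neg n : P.-negligible (recurrent 0 `\` recurrent (- n%:Z)).
  elim: n => [|n IH]; first by rewrite oppr0 setDv; exact: negligible_set0.
  by apply: (tr _ _ IH); apply: recurrent_next; right; lia.
have [x0|x0] := leP 0 x; first by rewrite -(gez0_abs x0).
by have := neg `|x|%N; rewrite (_ : - `|x|%N%:Z = x)//; lia.
Qed.

Lemma recurrent_stays_active : \bigcap_(x in [set: int]) recurrent x `<=` @stays_active R.
Proof.
move=> w hw x T T0; have [n /= Tn an] := hw x I (Num.bound T) I.
exists n%:R => //; apply: (@le_trans _ _ (Num.bound T)%:R); last by rewrite ler_nat.
exact/ltW/archi_boundP.
Qed.

(** Off a null set, recurrence of 0 entails recurrence of every site and hence sustained activity,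
    so it has probability 0. Continuity from above then bounds activity at any integer time from n0
    on. *)
Lemma fixation_decay (e : R) : P (@stays_active R) = 0%E -> 0 < e ->
  exists n0 : nat, forall n, (n0 <= n)%N -> (P (act_event n%:R 0) < e%:E)%E.
Proof.
move=> P0 e0.
have rec0 : P (recurrent 0) = 0%E.
  apply/negligibleP; first exact: measurable_recurrent.
  have h1 : P.-negligible (@stays_active R).
    by apply/negligibleP => //; exact: measurable_stays_active.
  have h2 : P.-negligible (\bigcup_(x in [set: int]) (recurrent 0 `\` recurrent x)).
    have : P.-negligible (\bigcup_n (recurrent 0 `\` recurrent n%:Z `|`
                                    recurrent 0 `\` recurrent (- n%:Z))).
      by apply: negligible_bigcup => n; apply: negligibleU; exact: recurrent_all.
    apply: negligibleS => w [x _ hx]; exists `|x|%N => //.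
    have [x0|x0] := leP 0 x; [left|right]; first by rewrite gez0_abs.
    by rewrite ltz0_abs// opprK.
  apply: negligibleS (negligibleU h1 h2) => w w0.
  have [h|/existsNP[x /not_implyP[_ hx]]] :=
    pselect (forall x : int, [set: int] x -> recurrent x w).
    by left; exact: recurrent_stays_active.
  by right; exists x.
have mE k : measurable (act_event k%:R 0 : set (Defs.path R)) by exact: measurable_act.
have mU n : measurable (\bigcup_(k in [set k | (n <= k)%N]) (act_event k%:R 0 : set (Defs.path R))).
  by apply: bigcup_measurable.
have fin0 : (P (\bigcup_(k in [set k | (0 <= k)%N]) (act_event k%:R 0 : set (Defs.path R))) < +oo)%E.
  by rewrite (le_lt_trans (probability_le1 _ _))// ltry.
have h := lim_sup_set_cvg P _ mE fin0.
have {}h := eq_ind _ (fun l => _ --> l) h _ rec0.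
have h' := @fine_fcvg _ _ (fmap_filter _ eventually_filter) _ h.
have [n0 _ hn0] := (@cvgrPdist_lt _ _ _ _ _ _ _).1 h' e e0.
exists n0 => n n0n; have := hn0 n0 (leqnn _).
rewrite /= sub0r normrN ger0_norm ?fine_ge0// => hlt.
apply: (@le_lt_trans _ _ (P (\bigcup_(k in [set k | (n0 <= k)%N])
    (act_event k%:R 0 : set (Defs.path R))))).
  apply: le_measure; rewrite ?inE//.
  by move=> w aw; exists n.
by rewrite -(fineK (fin_num_measure P _ (mU n0))) lte_fin.
Qed.

End Limit.
End Infinite.

(** * Entropy against energy *)

(* Undoes the shadowing by the translation maps of normed modules. *)
Local Notation shift := Defs.shift.
Implicit Types (x y z : int) (eta : config).

Lemma shiftE z (eta : config) x : shift z eta x = eta (x + z).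
Proof. by []. Qed.

Lemma supp_in_shift z s eta : supp_in s eta ->
  supp_in [seq x - z | x <- s] (shift z eta).
Proof.
move=> hs x xs; apply: hs; apply: contra xs => xs.
by apply/mapP; exists (x + z); rewrite ?addrK.
Qed.

Lemma nap_shift z x eta : nap predT x (shift z eta) = shift z (nap predT (x + z) eta).
Proof.
apply/funext => w; rewrite shiftE !napE shiftE !andbT.
by rewrite (inj_eq (addIr z)).
Qed.

Lemma jump_shift z x y eta : y != x ->
  jump x y (shift z eta) = shift z (jump (x + z) (y + z) eta).
Proof.
move=> yx; apply/funext => w; rewrite shiftE !jumpE ?(inj_eq (addIr z))//.
Qed.

Section Shift.
Variables (R : realType) (lam : R).
Hypothesis lam_gt0 : 0 < lam.
Local Notation L := (generator (symmetric_walk R) lam).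
Local Notation S := (semigroup (symmetric_walk R) lam).

Lemma generator_shift z f eta : finsupp eta ->
  L f (shift z eta) = L (f \o shift z) eta.
Proof.
move=> [s /supp_in_undup hs]; have us := undup_uniq s.
have us' : uniq [seq x - z | x <- undup s] by rewrite map_inj_uniq//; exact: addIr.
rewrite (generatorE lam_gt0 _ us' (supp_in_shift hs)) (generatorE lam_gt0 _ us hs).
rewrite big_map; apply: eq_bigr => x _.
rewrite shiftE subrK /topple nap_shift !jump_shift//= subrK.
by rewrite ![x - z + _ + z]addrAC subrK.
Qed.

Lemma iter_generator_shift n z f eta : finsupp eta ->
  iter n L f (shift z eta) = iter n L (f \o shift z) eta.
Proof.
elim: n eta => [//|n IH] eta fe /=; rewrite generator_shift//.
have [N ce] := finsupp_confN R fe.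
by apply: (generator_ext lam_gt0 ce) => xi [fx _]; exact: IH.
Qed.

Lemma semigroup_shift t z f eta : finsupp eta ->
  S t f (shift z eta) = S t (f \o shift z) eta.
Proof.
move=> fe; rewrite /semigroup; congr (limn (series _)); apply/funext => n.
by rewrite iter_generator_shift.
Qed.

Lemma semigroup_act_shift t z x eta : finsupp eta ->
  S t \1_[set xi | active xi x] (shift z eta) =
  S t \1_[set xi | active xi (x + z)] eta.
Proof. by move=> fe; rewrite semigroup_shift. Qed.

End Shift.

(** * Counting the targets and the box bound *)

Section Entropy.
Variable R : realType.

(* Weight 2^-n for n particles: 1 + (1/2 + 1/4 + ...) + 1/2 <= 3. *)
Lemma sum_weights N :
  \sum_(k < N.+2) (2^-1 : R) ^+ particles (occ_of_nat k) <= 3.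
Proof.
suff h : \sum_(k < N.+2) (2^-1 : R) ^+ particles (occ_of_nat k) = 5/2 - 2^-1 ^+ N.
  by rewrite h; have : 0 <= (2^-1 : R) ^+ N by []; lra.
elim: N => [|N IH]; first by rewrite !big_ord_recr big_ord0 /=; lra.
by rewrite big_ord_recr /= {}IH exprS; lra.
Qed.

Lemma lin_window_config lo W N (g : {ffun 'I_W -> 'I_N.+2}) :
  lin (fun=> 1 : R) (window_config lo g) =
  (\sum_(i < W) particles (occ_of_nat (g i)))%:R.
Proof.
have ul : uniq [seq lo + i%:Z | i : 'I_W <- enum 'I_W].
  by rewrite map_inj_uniq ?enum_uniq// => i j h; apply/val_inj => /=; lia.
rewrite (linE _ ul); last first.
  move=> x xl; apply: window_config_out; apply: contra xl => xl.
  have xi : (`|(x - lo)%R| < W)%N by lia.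
  by apply/mapP; exists (Ordinal xi); rewrite ?mem_enum//=; lia.
rewrite big_map big_enum /= natr_sum; apply: eq_bigr => i _.
by rewrite mul1r window_configE.
Qed.

(** Every counted configuration has weight 2^-N, and the total weight of all codes factorizes over
    the W sites, each contributing at most 3. *)
Lemma count_configs lo W N (G : {set {ffun 'I_W -> 'I_N.+2}}) :
  (forall g, g \in G -> confN R N (window_config lo g)) ->
  #|G|%:R <= 2 ^+ N * 3 ^+ W :> R.
Proof.
move=> hG; pose wt k : R := 2^-1 ^+ particles (occ_of_nat k).
have wt0 k : 0 <= wt k by rewrite exprn_ge0.
have n2 : (2 : R) ^+ N != 0 by rewrite expf_neq0.
rewrite -[leLHS](mulKf n2) mulrCA.
rewrite ler_wpM2l ?exprn_ge0//.
apply: (@le_trans _ _ (\prod_(i < W) \sum_(k < N.+2) wt k)); last first.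
  rewrite prodr_const card_ord lerXn2r ?nnegrE ?sumr_ge0//.
  exact: sum_weights.
rewrite bigA_distr_bigA /=.
apply: (@le_trans _ _ (\sum_(g in G) \prod_i wt (g i))); last first.
  rewrite [leRHS](bigID (mem G)) /= lerDl; apply: sumr_ge0 => g _.
  by apply: prodr_ge0.
rewrite mulr_natr -sumr_const; apply: ler_sum => g gG.
rewrite -exprVn /wt.
have [_ /eqP] := hG g gG; rewrite lin_window_config eqr_nat => /eqP gN.
by rewrite -[in leLHS]gN (big_morph _ (exprD _) (expr0 _)).
Qed.

End Entropy.

Section Box.
Variables (R : realType) (lam : R).
Hypotheses (lam_gt0 : 0 < lam) (lam_small : 2 * lam <= 1).
Local Notation S := (semigroup (symmetric_walk R) lam).

Lemma sleepers_list (lo : int) W N M eta : confN R N eta ->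
  (forall x, ~~ (lo <= x < lo + W%:Z) -> eta x = Active 0) ->
  actives R eta < M%:R -> (M.*2 <= N)%N ->
  exists a : seq int, [/\ sorted <%O a, (M < size a)%N,
    forall x, (x \in a) = sleepers eta x &
    forall x y, x \in a -> y \in a -> (`|(x - y)%R| <= W)%N].
Proof.
move=> [_ ceN] eout eact MN.
pose l : seq int := [seq lo + i%:Z | i <- iota 0 W].
have memw x : (x \in l) = (lo <= x < lo + W%:Z).
  apply/mapP/idP => [[i + ->]|hx]; first by rewrite mem_iota; lia.
  by exists `|(x - lo)%R|%N; [rewrite mem_iota; lia | lia].
have ul : uniq l by rewrite map_inj_uniq ?iota_uniq// => i j; lia.
have sl : supp_in l eta by move=> x; rewrite memw; exact: eout.
exists [seq x <- l | sleepers eta x]; split.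
- apply: sorted_filter; first exact: lt_trans.
  rewrite sorted_map; apply: sub_sorted (iota_ltn_sorted 0 W) => i j /= ij.
  by rewrite ltrD2l ltz_nat.
- have : \sum_(x <- l) (particles (eta x))%:R = N%:R :> R.
    by rewrite -ceN (linE _ ul sl); apply: eq_bigr => x _; rewrite mul1r.
  have -> : \sum_(x <- l) (particles (eta x))%:R =
            actives R eta + (size [seq x <- l | sleepers eta x])%:R :> R.
    rewrite (activesE _ ul sl) size_filter -sum1_count natr_sum.
    rewrite [X in _ + X]big_mkcond -big_split; apply: eq_bigr => x _ /=.
    rewrite /sleepers.
    by case: (eta x) => [k|] /=; rewrite ?addr0 ?add0r.
  move=> hN; have : (M + M)%:R <= N%:R :> R by rewrite ler_nat addnn.
  by rewrite -hN natrD -(ltr_nat R) => ?; lra.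
- move=> x; rewrite mem_filter memw andb_idr// => ex.
  by apply/negPn/negP => /eout e; move: ex; rewrite /sleepers e.
by move=> x y; rewrite !mem_filter !memw => /andP[_ ?] /andP[_ ?]; lia.
Qed.

Variables (v M : nat) (eta0 : config).
Let N := M.*2.
Let W := (v + v).*2.+1.
Hypotheses (c0 : confN R N eta0) (v_gt0 : (0 < v)%N) (M_gt0 : (0 < M)%N).
Hypothesis supp0 : forall x, ~~ (0 <= x < v%:Z) -> eta0 x = Active 0.
Hypothesis awake0 : forall x, ~~ asleep (eta0 x).

(** A union bound: at least M active particles (Markov's inequality), a particle outside [-2 v, 2 v]
    (its spread from [-v, v] is v^2), or one of the counted targets, which have more than M
    sleepers. *)
Lemma box_bound t : 0 <= t ->
  1 <= M%:R^-1 * S t (actives R) eta0 + N%:R * t / v%:R ^+ 2 +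
    2 ^+ N * 3 ^+ W * (expR 1 * (2 + rate lam N * t) * ((2 * lam) ^+ M * 2 ^+ W)).
Proof.
move=> t0; pose lo : int := - (v + v)%N%:Z.
pose cfg := @window_config lo W N.
pose G : {set {ffun 'I_W -> 'I_N.+2}} :=
  finset (fun g => `[< confN R N (cfg g) /\ actives R (cfg g) < M%:R >]).
pose sp := spread R (- v%:Z) v%:Z v.
pose f1 (xi : config) := M%:R^-1 * actives R xi.
pose f2 (xi : config) := (v%:R ^+ 2)^-1 * lin sp xi.
pose f3 xi := \sum_(g in G) \1_[set cfg g] xi : R.
have M0 : 0 < M%:R :> R by rewrite ltr0n.
have v0 : 0 < v%:R ^+ 2 :> R by rewrite exprn_gt0// ltr0n.
have sp0 x : 0 <= sp x by rewrite /sp/spread ler0n.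
have b1 : bounded_on N f1 _ := bounded_onZ M%:R^-1 (@actives_bounded R N).
have b2 : bounded_on N f2 _ := bounded_onZ (v%:R ^+ 2)^-1 (@spread_bounded R N (- v%:Z) v%:Z v).
have b3 : bounded_on N f3 #|G|%:R.
  move=> xi _; apply: (le_trans (ler_norm_sum _ _ _)).
  rewrite -sumr_const; apply: ler_sum => g _; rewrite indicE.
  by case: (_ \in _); rewrite ?normr1 ?normr0.
have cover xi : confN R N xi -> 1 <= (f1 xi + f2 xi) + f3 xi.
  move=> cx; have g1 : 0 <= f1 xi.
    by rewrite mulr_ge0 ?invr_ge0 ?ler0n// /actives; apply: fsumr_ge0.
  have g2 : 0 <= f2 xi by rewrite mulr_ge0 ?invr_ge0 ?(ltW v0)//; exact: lin_ge0.
  have g3 : 0 <= f3 xi by apply: sumr_ge0 => g _.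
  have [h|h] := leP M%:R (actives R xi).
    have : 1 <= f1 xi by rewrite /f1 mulrC ler_pdivlMr// mul1r.
    by move: g2 g3; lra.
  have [hin|hout] := pselect (forall x, ~~ (lo <= x < lo + W%:Z) -> xi x = Active 0).
    have [g gx] := window_configP (fun x => particles_le x cx) hin.
    have : 1 <= f3 xi.
      rewrite /f3 (bigD1 g) /=; last by rewrite inE; apply/asboolP; rewrite /cfg gx.
      rewrite indicE mem_set ?lerDl; last by rewrite /cfg gx.
      by apply: sumr_ge0.
    by move: g1 g2; lra.
  have [x /not_implyP[xo xne]] : exists x, ~ (~~ (lo <= x < lo + W%:Z) -> xi x = Active 0).
    by apply/existsNP.
  have : 1 <= f2 xi.
    rewrite /f2 mulrC ler_pdivlMr// mul1r.
    apply: le_trans (lin_ge_site x cx.1 sp0).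
    rewrite /sp spread_out// natrX ler_peMr ?(ltW v0)// ler1n.
    by case: (xi x) xne => [[|k]|].
  by move: g1 g3; lra.
have bsum : bounded_on N (fun xi => f1 xi + f2 xi) _ := bounded_onD b1 b2.
have h1 : 1 <= S t (fun xi => (f1 xi + f2 xi) + f3 xi) eta0.
  rewrite -[leLHS](semigroup_cst lam_gt0 1 t c0).
  apply: (semigroup_le (C := 1) lam_gt0 c0 _ (bounded_onD bsum b3)) => //.
  by move=> xi _; rewrite normr1.
apply: (le_trans h1).
rewrite (semigroupD lam_gt0 t c0 bsum b3) (semigroupD lam_gt0 t c0 b1 b2).
apply: lerD; first apply: lerD.
- by rewrite (semigroupZ lam_gt0 _ t c0 (@actives_bounded R N)).
- rewrite (semigroupZ lam_gt0 _ t c0 (@spread_bounded R N _ _ _)) mulrC.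
  rewrite ler_pM2r ?invr_gt0//.
  have := semigroup_spread lam_gt0 (p := - v%:Z) (q := v%:Z) c0 _ v_gt0 t0.
  rewrite lin_spread_eq0 ?add0r; first by apply; lia.
  by move=> x hx; apply: supp0; lia.
rewrite /f3 (semigroup_sum lam_gt0 _ _ t c0 (fun g => indic_bounded (N := N) [set cfg g])).
apply: (@le_trans _ _ (\sum_(g in G)
   (expR 1 * (2 + rate lam N * t) * ((2 * lam) ^+ M * 2 ^+ W)))).
  apply: ler_sum => g; rewrite inE => /asboolP[cg ag].
  have [a [sa Ma ha da]] := sleepers_list cg (@window_config_out lo W N g) ag (leqnn _).
  have a0 : (0 < size a)%N by exact: leq_ltn_trans Ma.
  apply: (le_trans (semigroup_target lam_gt0 cg sa a0 ha c0 awake0 t0)).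
  apply: ler_wpM2l.
    by rewrite mulr_ge0 ?expR_ge0// addr_ge0// mulr_ge0// rate_ge0.
  apply: (le_trans (step_le lam_gt0 sa a0 da)).
  apply: ler_wpM2r; first exact: exprn_ge0.
  (* More than M sleepers give at least M factors 2 lam, none above 1. *)
  apply: ler_wiXn2l => //; first by rewrite mulr_ge0// ltW.
  by rewrite -ltnS prednK.
rewrite [leLHS]sumr_const -[leLHS]mulr_natl; apply: ler_wpM2r.
  rewrite !mulr_ge0 ?expR_ge0 ?exprn_ge0 ?(ltW lam_gt0)//.
  - by rewrite addr_ge0// mulr_ge0// rate_ge0.
  - by rewrite mulr_ge0// ltW.
by apply: (@count_configs R lo) => g; rewrite inE => /asboolP[].
Qed.

End Box.

(** * A time with few active particles *)

Section QuietTime.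
Variables (R : realType) (lam : R).
Hypothesis lam_gt0 : 0 < lam.
Local Notation L := (generator (symmetric_walk R) lam).
Local Notation S := (semigroup (symmetric_walk R) lam).

(** psi is at least half the indicator of activity and decays at rate at most 1 + lam. So activity
    at a real time is still visible at the next integer, where the infinite system gives
    information. *)
Lemma semigroup_act_between N x eta n u : confN R N eta ->
  n%:R <= u <= n.+1%:R ->
  S u \1_[set xi | active xi x] eta <=
  2 * expR (1 + lam) * S n.+1%:R \1_[set xi | active xi x] eta.
Proof.
move=> ce /andP[nu un]; have u0 : 0 <= u by apply: le_trans nu.
apply: (@le_trans _ _ (2 * S u (psi R x) eta)).
  rewrite -(semigroupZ lam_gt0 _ u ce (@psi_bounded R N x)).
  apply: (semigroup_le lam_gt0 ce (indic_bounded _)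
    (bounded_onZ 2 (@psi_bounded R N x))) => // xi _.
  rewrite indicE; case: (boolP (_ \in _)) => [/set_mem /= ax|_].
    by have := psi_ge_half lam_gt0 ax; lra.
  by rewrite mulr_ge0 ?psi_ge0.
rewrite -mulrA ler_wpM2l//.
have un' : 0 <= u <= n.+1%:R by rewrite u0.
have h := semigroup_psi_self lam_gt0 x ce un'.
have h2 : S n.+1%:R (psi R x) eta <= S n.+1%:R \1_[set xi | active xi x] eta.
  apply: (semigroup_le lam_gt0 ce (@psi_bounded R N x) (indic_bounded _)) => //.
  by move=> xi _; exact: psi_le_indic.
apply: le_trans (ler_wpM2l (expR_ge0 _) h2).
have p0 : 0 <= S u (psi R x) eta.
  by apply: (semigroup_ge0 lam_gt0 ce (@psi_bounded R N x)) => // xi _; exact: psi_ge0.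
apply: le_trans (ler_wpM2l (expR_ge0 _) h).
rewrite mulrA -expRD ler_peMl// -[leLHS]expR0 ler_expR.
have : (1 + lam) * (n.+1%:R - u) <= (1 + lam) * 1.
  by rewrite ler_wpM2l//; [move: lam_gt0; lra | move: nu; rewrite -natr1; lra].
by rewrite mulNr mulr1; lra.
Qed.

Variables (v N : nat) (eta0 : config).
Hypotheses (c0 : confN R N eta0) (N_gt0 : (0 < N)%N).
Hypothesis supp0 : forall x, ~~ (0 <= x < v%:Z) -> eta0 x = Active 0.
Hypothesis simple0 : forall x, (particles (eta0 x) <= 1)%N.

(** The discrepancy starts at 0 and is at most N s on average at time s. Were more than N/8
    particles active on average throughout [s, 2 s + 1], its drift there would be at most -16 N/8 +
    N = -N, and its mean would end below N s - N (s + 1) + N/2 < 0. *)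
Lemma quiet_time (blk : seq int) p q m (rho s : R) :
  uniq blk -> {in blk, forall x, 0 <= x < v%:Z} -> 0 < rho ->
  (forall x, x \notin blk -> rho <= spread R p q m x) -> 0 <= s ->
  (forall u, s <= u <= 2 * s + 1 ->
     81 * (\sum_(x <- blk) S u \1_[set xi | active xi x] eta0 +
           rho^-1 * S u (lin (spread R p q m)) eta0) <= N%:R) ->
  exists u, s <= u <= 2 * s + 1 /\ S u (actives R) eta0 <= N%:R / 8.
Proof.
move=> ub hb rho0 hout s0 hu; apply: contrapT => hno.
pose D := discrepancy R v eta0.
have bD : bounded_on N D _ := discrepancy_bounded v c0.
have D0 : 0 <= \sum_(u <- levels v) (N%:R ^+ 2 : R) by apply: sumr_ge0 => i _; exact: sqr_ge0.
have st : s <= 2 * s + 1 by lra.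
have drift u : s <= u <= 2 * s + 1 -> S u (L D) eta0 <= - N%:R.
  move=> su; have u0 : 0 <= u by move: su s0; lra.
  have act_gt : N%:R / 8 < S u (actives R) eta0.
    by rewrite ltNge; apply/negP => h; apply: hno; exists u.
  pose f1 (xi : config) := -16 * actives R xi.
  pose f2 (xi : config) := 81 * (\sum_(x <- blk) \1_[set eta | active eta x] xi : R).
  pose f3 (xi : config) := (81 * rho^-1) * lin (spread R p q m) xi.
  have bind : bounded_on N (fun xi => \sum_(x <- blk) \1_[set eta | active eta x] xi : R) (size blk)%:R.
    move=> xi _; apply: (le_trans (ler_norm_sum _ _ _)).
    rewrite -sum1_size natr_sum; apply: ler_sum => g _; rewrite indicE.
    by case: (_ \in _); rewrite ?normr1 ?normr0.
  have b1 : bounded_on N f1 _ := bounded_onZ (-16) (@actives_bounded R N).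
  have b2 : bounded_on N f2 _ := bounded_onZ 81 bind.
  have b3 : bounded_on N f3 _ := bounded_onZ (81 * rho^-1) (@spread_bounded R N p q m).
  have b12 : bounded_on N (fun xi => f1 xi + f2 xi) _ := bounded_onD b1 b2.
  have b123 := bounded_onD b12 b3.
  apply: (@le_trans _ _ (S u (fun xi => (f1 xi + f2 xi) + f3 xi) eta0)).
    apply: (semigroup_le lam_gt0 c0 (generator_bounded lam_gt0 D0 bD) b123) => //.
    move=> xi cx.
    apply: (le_trans (generator_discrepancy_act lam_gt0 c0 supp0 simple0 cx ub hb _ rho0 hout)).
      by move=> x; rewrite /spread ler0n.
    by rewrite /f1 /f2 /f3 mulrDr mulrA addrA.
  rewrite (semigroupD lam_gt0 u c0 b12 b3) (semigroupD lam_gt0 u c0 b1 b2).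
  rewrite (semigroupZ lam_gt0 _ u c0 (@actives_bounded R N)).
  rewrite (semigroupZ lam_gt0 _ u c0 (@spread_bounded R N p q m)).
  rewrite (semigroupZ lam_gt0 _ u c0 bind).
  rewrite (semigroup_sum lam_gt0 _ _ u c0 (fun x => indic_bounded (N := N) [set xi | active xi x])).
  by have := hu u su; lra.
have h1 := semigroup_drift lam_gt0 c0 bD st drift.
have h0 : 0 <= S (2 * s + 1) D eta0.
  apply: (semigroup_ge0 lam_gt0 c0 bD) => [xi _|]; first exact: discrepancy_ge0.
  by move: s0; lra.
have := @semigroup_drift_cst R lam lam_gt0 N D _ N%:R 0 s eta0 c0 bD.
rewrite lexx s0 semigroup0 /D discrepancy_init => /(_ isT).
have N1 : 1 <= N%:R :> R by rewrite ler1n.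
have Ns : 0 <= N%:R * s by rewrite mulr_ge0.
have e1 : N%:R * (2 * s + 1 - s) = N%:R * s + N%:R by ring.
move=> h2; have {}h2 : S s D eta0 <= 0 + N%:R * (s - 0).
  by apply: h2 => xi cx; exact: (generator_discrepancy lam_gt0 c0 supp0 simple0 cx).
by move: h0 h1 h2; rewrite mulNr e1 subr0; lra.
Qed.

End QuietTime.

Definition lattice (K : nat) : config :=
  fun y => if (K%:Z %| y)%Z then Active 1 else Active 0.

Definition int_range (v : nat) : seq int := [seq i%:Z | i <- iota 0 v].

Lemma mem_int_range v x : (x \in int_range v) = (0 <= x < v%:Z).
Proof.
apply/mapP/idP => [[i + ->]|hx]; first by rewrite mem_iota; lia.
by exists `|x|%N; [rewrite mem_iota; lia | lia].
Qed.

Lemma int_range_uniq v : uniq (int_range v).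
Proof. by rewrite map_inj_uniq ?iota_uniq// => i j; lia. Qed.

(** * Activity of long lattice blocks *)

Section Lattice.
Variables (R : realType) (lam : R) (K : nat).
Hypotheses (lam_gt0 : 0 < lam) (K_gt0 : (0 < K)%N).
Hypothesis lam_small : 32 * 6 ^+ (8 * K) * lam <= 1.
Local Notation S := (semigroup (symmetric_walk R) lam).

Definition block (v : nat) : config := restrict [set` int_range v] (lattice K).

Lemma blockE v x : block v x = if 0 <= x < v%:Z then lattice K x else Active 0.
Proof. by rewrite /block /restrict mem_setE mem_int_range. Qed.

Lemma block_supp v : supp_in (int_range v) (block v).
Proof. by move=> x; rewrite mem_int_range blockE => /negbTE ->. Qed.

Lemma block_simple v x : (particles (block v x) <= 1)%N.
Proof. by rewrite blockE /lattice; case: ifP => // _; case: ifP. Qed.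

Lemma block_awake v x : ~~ asleep (block v x).
Proof. by rewrite blockE /lattice; case: ifP => // _; case: ifP. Qed.

Lemma block_confN N : (0 < N)%N -> confN R N (block (K * N)).
Proof.
move=> N0; split; first by exists (int_range (K * N)); exact: block_supp.
rewrite (linE _ (int_range_uniq _) (@block_supp _)) big_map.
rewrite (eq_big_seq (fun i => (K %| i)%:R)); last first.
  move=> i; rewrite mem_iota add0n => /= iv.
  rewrite blockE mul1r lez_nat ltz_nat iv /= /lattice /= dvdzE /=.
  by case: (K %| i)%N.
rewrite -natr_sum; congr (_%:R).
have -> : iota 0 (K * N) = index_iota 0 (K * N) by rewrite /index_iota subn0.
rewrite big_ltn ?muln_gt0 ?K_gt0//.
rewrite dvdn0 -[(K * N)%N]prednK ?muln_gt0 ?K_gt0// -divn_count_dvd.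
case: N N0 => // N _; have -> : (K * N.+1).-1 = (N * K + K.-1)%N.
  by rewrite mulnS (mulnC K); case: (K) K_gt0 => // k _; rewrite addSn addnC.
by rewrite divnMDl// divn_small ?addn0// prednK.
Qed.

(** The window has 8 K M + 1 sites, so the powers collect to 6 (8 * 6^(8 K) lam)^M, with base at
    most 1/4 by [lam_small]. Of the two factors 2^-M in 4^-M, one absorbs the growth of the rate
    with M, the other the prefactor, itself at most M/4. *)
Lemma tail_small (M n1 : nat) u : (0 < M)%N -> 0 <= u <= n1%:R ->
  24 * expR 1 * (2 + 2 * (1 + lam) * n1%:R) <= M%:R ->
  2 ^+ M.*2 * 3 ^+ (K * M.*2 + K * M.*2).*2.+1 *
    (expR 1 * (2 + rate lam M.*2 * u) *
     ((2 * lam) ^+ M * 2 ^+ (K * M.*2 + K * M.*2).*2.+1)) <= 4^-1.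
Proof.
move=> M0 /andP[u0 un] hM.
have M1 : 1 <= M%:R :> R by rewrite ler1n.
have Mp : 0 < M%:R :> R by rewrite ltr0n.
have l0 := ltW lam_gt0.
pose A : R := 2 + 2 * (1 + lam) * n1%:R.
have n0 : 0 <= n1%:R :> R by [].
have e0 := expR_ge0 (1 : R).
have -> : ((K * M.*2 + K * M.*2).*2.+1 = 8 * K * M + 1)%N by lia.
have -> : (M.*2 = 2 * M)%N by lia.
have -> : 2 ^+ (2 * M) * 3 ^+ (8 * K * M + 1) *
    (expR 1 * (2 + rate lam (2 * M) * u) * ((2 * lam) ^+ M * 2 ^+ (8 * K * M + 1)))
  = (6 * expR 1 * (2 + rate lam (2 * M) * u)) * (4 * 6 ^+ (8 * K) * (2 * lam)) ^+ M.
  have -> : (6 : R) = 3 * 2 by ring.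
  rewrite (exprM 2 2 M) (_ : 2 ^+ 2 = 4); last by ring.
  move: (8 * K)%N => n; rewrite !exprD !expr1 !exprMn -!exprM.
  move: (_ ^+ (n * M)) (_ ^+ (n * M)) (lam ^+ M) (2 ^+ M) (4 ^+ M) => *.
  by ring.
have q0 : 0 <= 4 * 6 ^+ (8 * K) * (2 * lam).
  by rewrite !mulr_ge0// exprn_ge0.
have h1 : (4 * 6 ^+ (8 * K) * (2 * lam)) ^+ M <= (4^-1) ^+ M.
  by rewrite lerXn2r ?nnegrE//; move: lam_small; lra.
have h2 : M%:R * (2^-1 : R) ^+ M <= 1.
  rewrite exprVn ler_pdivrMr ?exprn_gt0// mul1r -natrX ler_nat.
  exact/ltnW/ltn_expl.
have h3 : 2 + rate lam (2 * M) * u <= A * M%:R.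
  rewrite /rate /A natrM.
  have : (1 + lam) * M%:R * u <= (1 + lam) * M%:R * n1%:R.
    by rewrite ler_wpM2l// mulr_ge0// addr_ge0.
  by nra.
have A0 : 0 <= A by rewrite /A addr_ge0// !mulr_ge0// addr_ge0.
have r0 : 0 <= 2 + rate lam (2 * M) * u.
  by rewrite addr_ge0// mulr_ge0// rate_ge0.
apply: (@le_trans _ _ ((6 * expR 1 * (A * M%:R)) * (4^-1) ^+ M)).
  apply: ler_pM => //; first by rewrite !mulr_ge0.
    exact: exprn_ge0.
  by rewrite ler_wpM2l// mulr_ge0.
have -> : (4^-1 : R) = 2^-1 * 2^-1 by rewrite -invfM; congr (_^-1); ring.
rewrite exprMn.
have -> : 6 * expR 1 * (A * M%:R) * (2^-1 ^+ M * 2^-1 ^+ M) =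
   6 * expR 1 * A * (M%:R * 2^-1 ^+ M) * 2^-1 ^+ M by ring.
have t0 : 0 <= (2^-1 : R) ^+ M by rewrite exprn_ge0.
have h4 : 6 * expR 1 * A <= 4^-1 * M%:R by move: hM; rewrite -/A; lra.
apply: (@le_trans _ _ (4^-1 * M%:R * 2^-1 ^+ M)).
  apply: ler_wpM2r => //; apply: le_trans h4.
  by rewrite ler_piMr// !mulr_ge0.
have : 4^-1 * (M%:R * 2^-1 ^+ M) <= 4^-1 * 1 :> R by apply: ler_wpM2l.
by rewrite mulr1 mulrA -invfM; lra.
Qed.

(** Only the p sites at each end contribute, with at most one particle each. *)
Lemma spread_block (v p m : nat) : (p.*2 < v)%N ->
  lin (spread R p%:Z (v%:Z - 1 - p%:Z) m) (block v) <= (p.*2 * m ^ 2)%:R.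
Proof.
move=> pv; rewrite (linE _ (int_range_uniq _) (@block_supp _)) big_map.
have -> : v = (p + ((v - p.*2) + p))%N by lia.
rewrite !iotaD !big_cat /= add0n.
set v' := (p + _)%N.
have le1 i : spread R p%:Z (v'%:Z - 1 - p%:Z) m i%:Z * (particles (block v' i%:Z))%:R
    <= (m ^ 2)%:R.
  rewrite -[leRHS]mulr1 ler_pM ?ler0n//.
    by rewrite /spread ler_nat leq_sqr geq_minl.
  by rewrite lern1 block_simple.
have ends j : \sum_(i <- iota j p) spread R p%:Z (v'%:Z - 1 - p%:Z) m i%:Z *
    (particles (block v' i%:Z))%:R <= (p * m ^ 2)%:R.
  apply: (le_trans (ler_sum _ (fun i _ => le1 i))).
  by rewrite big_const_seq count_predT size_iota iter_addr_0 mulnC natrM mulr_natr.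
rewrite [X in _ + (X + _)]big1_seq ?add0r; last first.
  move=> i /=; rewrite mem_iota => hi.
  rewrite /spread /tdist /dist_itv !ifN ?minn0 ?mul0r//; rewrite /v'; lia.
by rewrite -addnn mulnDl natrD; apply: lerD.
Qed.

Lemma spread_error (p m n1 N : nat) : (324 * n1 <= m)%N -> (0 < m)%N ->
  (p.*2 * m ^ 2)%:R + N%:R * n1%:R <= (m ^ 2)%:R * (p.*2%:R + N%:R / 324) :> R.
Proof.
move=> nm m0; rewrite natrM mulrDr [X in X + _]mulrC lerD2l mulrA.
rewrite ler_pdivlMr ?(ltr0Sn R 323)// -!natrM ler_nat [leqRHS]mulnC -mulnA leq_mul2l.
by rewrite mulnC (leq_trans nm) ?orbT// -mulnn leq_pmulr.
Qed.

(** If every inner site had activity at most delta at these integer times, [quiet_time] would yield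
    a time with at most M/4 active particles on average, and the three terms of [box_bound] would be
    at most 1/4 each. It matters that delta is chosen before n0 and b. *)
Lemma lattice_active : exists2 delta : R, 0 < delta & forall n0 b : nat,
  exists N x n, [/\ (n0 <= n <= n0.*2.+2)%N, b%:Z <= x < (K * N)%N%:Z - b%:Z &
    delta < S n%:R \1_[set xi | active xi x] (block (K * N))].
Proof.
have K0 : 0 < K%:R :> R by rewrite ltr0n.
(* The budget of [quiet_time]: K N sites at 2 e^(1 + lam) / c each make N/162, hence N/2 after the
   factor 81. The spread gets the rest, N/4 for the ends of the block and N/4 for diffusion. *)
pose c : R := 324 * K%:R * expR (1 + lam).
have c0 : 0 < c := mulr_gt0 (mulr_gt0 (ltr0Sn R 323) K0) (expR_gt0 _).
exists c^-1 => [|n0 b]; first by rewrite invr_gt0.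
pose n1 := n0.*2.+1.
have [m [mn m324]] : exists m, (324 * n1 <= m)%N /\ (324 <= m)%N.
  by exists (324 * n1)%N; rewrite leq_pmulr.
(* Sites within b of an end of the block, or beyond it, are then at least m away from [p, v - 1 - p]
   and have the full spread m^2. *)
have [p pE] : exists p, p = (b + m)%N by exists (b + m)%N.
pose A : R := 24 * expR 1 * (2 + 2 * (1 + lam) * n1%:R).
have [M [AM pM nM]] : exists M, [/\ A <= M%:R, (648 * p <= M)%N & (4 * n1 <= M)%N].
  exists (648 * p + 4 * n1 + Num.bound A)%N; split.
  - apply: (@le_trans _ _ (Num.bound A)%:R); last by rewrite ler_nat leq_addl.
    apply/ltW/archi_boundP; rewrite !mulr_ge0 ?expR_ge0// addr_ge0// !mulr_ge0//.
    by rewrite addr_ge0// ltW.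
  - by rewrite -addnA leq_addr.
  - by rewrite addnAC leq_addl.
have mp : (m <= p)%N by rewrite pE leq_addl.
have M0 : (0 < M)%N by clear -pM m324 mp; lia.
have n1E : n1%:R = 2 * n0%:R + 1 :> R by rewrite /n1 -natr1 -mul2n natrM.
exists M.*2; apply: contrapT => hno.
pose N := M.*2; pose v := (K * N)%N.
have vN : (N <= v)%N by rewrite leq_pmull.
have N0 : (0 < N)%N by rewrite double_gt0.
have cN := block_confN N0.
have v0 : (0 < v)%N by exact: leq_trans vN.
have supp x : ~~ (0 <= x < v%:Z) -> block v x = Active 0.
  by rewrite blockE => /negbTE ->.
pose blk : seq int := [seq i%:Z | i <- iota b (v - b.*2)].
have mblk x : (x \in blk) = (b%:Z <= x < v%:Z - b%:Z).
  apply/mapP/idP => [[i + ->]|hx]; first by rewrite mem_iota; clear; lia.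
  by exists `|x|%N; [rewrite mem_iota; clear -hx; lia | clear -hx; lia].
have ublk : uniq blk by rewrite map_inj_uniq ?iota_uniq// => i j; lia.
have bblk : {in blk, forall x, 0 <= x < v%:Z} by by move=> x; rewrite mblk; clear; lia.
have mgt : (0 < m)%N by clear -m324; lia.
have p2 : (p.*2 < v)%N by rewrite (leq_trans _ vN)// /N; clear -pM mp mgt; lia.
have pq : p%:Z <= v%:Z - 1 - p%:Z by clear -p2; lia.
have m0 : 0 < (m ^ 2)%:R :> R by rewrite ltr0n expn_gt0 mgt.
have hout x : x \notin blk -> (m ^ 2)%:R <= spread R p%:Z (v%:Z - 1 - p%:Z) m x.
  rewrite mblk => hx; rewrite /spread ler_nat leq_sqr /tdist /dist_itv.
  by clear -hx pE p2; do ?case: ifP => ?; lia.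
have small x n : x \in blk -> (n0 <= n <= n0.*2.+2)%N ->
    S n%:R \1_[set xi | active xi x] (block v) <= c^-1.
  rewrite mblk => hx hn; rewrite leNgt; apply/negP => h; apply: hno.
  by exists x, n.
have [|u [un act]] := quiet_time lam_gt0 cN N0 supp (block_simple _) ublk bblk m0 hout
    (ler0n R n0).
  move=> u /andP[nu un]; have u0 : 0 <= u by exact: le_trans nu.
  have h1 : \sum_(x <- blk) S u \1_[set xi | active xi x] (block v) <=
            v%:R * (2 * expR (1 + lam) * c^-1).
    apply: (@le_trans _ _ (\sum_(x <- blk) (2 * expR (1 + lam) * c^-1))).
      rewrite big_seq [leRHS]big_seq; apply: ler_sum => x xb.
      (* The integer following u is at most 2 n0 + 2, whence the range of n in the statement. *)
      have /andP[ku uk] := Num.Theory.truncn_itv u0.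
      set k := Num.truncn u in ku uk.
      have ku' : k%:R <= u <= k.+1%:R by rewrite ku ltW.
      apply: (le_trans (semigroup_act_between lam_gt0 x cN ku')).
      apply: ler_wpM2l; first by rewrite mulr_ge0 ?expR_ge0.
      apply: small => //; apply/andP; split.
        by rewrite -ltnS -(ltr_nat R); apply: le_lt_trans nu _; rewrite (lt_le_trans uk)// ler_nat.
      rewrite ltnS -(ler_nat R); apply: (le_trans ku); apply: (le_trans un).
      by rewrite -n1E.
    rewrite big_const_seq count_predT iter_addr_0 -[leLHS]mulr_natl.
    apply: ler_wpM2r; first by rewrite !mulr_ge0 ?expR_ge0// invr_ge0 ltW.
    by rewrite ler_nat size_map size_iota leq_subr.
  have h2 : S u (lin (spread R p%:Z (v%:Z - 1 - p%:Z) m)) (block v) <=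
      (p.*2 * m ^ 2)%:R + N%:R * n1%:R.
    apply: (le_trans (semigroup_spread lam_gt0 cN pq mgt u0)).
    apply: lerD; first exact: spread_block.
    rewrite ler_wpM2l//; apply: (le_trans un).
    by rewrite n1E.
  have e1 : v%:R * (2 * expR (1 + lam) * c^-1) = N%:R / 162.
    have K1 : K%:R != 0 :> R by rewrite lt0r_neq0.
    have E1 : expR (1 + lam) != 0 by rewrite lt0r_neq0 ?expR_gt0.
    by rewrite /v natrM /c; field; rewrite K1 E1.
  have h3 : (m ^ 2)%:R^-1 * S u (lin (spread R p%:Z (v%:Z - 1 - p%:Z) m)) (block v) <=
      p.*2%:R + N%:R / 324.
    rewrite ler_pdivrMl//; exact: le_trans h2 (spread_error _ _ mn mgt).
  have h4 : 324 * p.*2%:R <= N%:R :> R by rewrite -natrM ler_nat /N; clear -pM; lia.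
  by move: h1 h3 h4; rewrite e1; lra.
have u0 : 0 <= u by case/andP: un => + _; exact: le_trans.
have un1 : 0 <= u <= n1%:R by rewrite u0 n1E; case/andP: un.
have lam2 : 2 * lam <= 1.
  apply: le_trans lam_small; rewrite ler_pM2r//.
  have : 1 <= 6 ^+ (8 * K) :> R by rewrite exprn_ege1// ler1n.
  by lra.
have := box_bound lam_gt0 lam2 cN v0 M0 supp (block_awake _) u0.
have := tail_small M0 un1 AM; rewrite -/N -/v.
move: (_ * _ * (_ * _ * _)) => tl htl.
have hM : 0 < M%:R :> R by rewrite ltr0n.
have f1 : M%:R^-1 * S u (actives R) (block v) <= 4^-1.
  rewrite ler_pdivrMl//; apply: (le_trans act).
  by rewrite /N -muln2 natrM; lra.
have f2 : N%:R * u / v%:R ^+ 2 <= 4^-1.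
  rewrite ler_pdivrMr ?exprn_gt0 ?ltr0n//.
  apply: (@le_trans _ _ (N%:R * n1%:R)).
    by rewrite ler_wpM2l//; case/andP: un1.
  have h5 : 4 * n1%:R <= N%:R :> R by rewrite -natrM ler_nat /N; clear -nM; lia.
  have h6 : N%:R * (4 * n1%:R) <= N%:R * N%:R :> R by rewrite ler_wpM2l.
  have h7 : N%:R * N%:R <= v%:R ^+ 2 :> R by rewrite expr2 ler_pM ?ler_nat.
  by rewrite ler_pdivlMl//; apply: le_trans h7; move: h6; rewrite mulrCA.
by move: f1 f2 htl; lra.
Qed.

End Lattice.

(** * The shifted lattice *)

Section Average.
Variables (R : realType) (c : nat -> config) (k : nat).

Definition average : set config -> \bar R :=
  mscale (k.+1%:R^-1)%:nng (msum (fun j => dirac (c j)) k.+1).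

HB.instance Definition _ := Measure.on average.

Lemma averageE A :
  average A = (k.+1%:R^-1 * \sum_(j < k.+1) (\1_A (c j) : R))%:E.
Proof. by rewrite EFinM -sumEFin. Qed.

Lemma average_cst A (a : R) : (forall j, \1_A (c j) = a) -> average A = a%:E.
Proof.
move=> h; rewrite averageE; under eq_bigr do rewrite h.
by rewrite sumr_const card_ord -[X in _ * X]mulr_natl mulKf.
Qed.

Lemma average_setT : average setT = 1%E.
Proof. by apply: average_cst => j; rewrite indicE in_setT. Qed.

HB.instance Definition _ := Measure_isProbability.Build _ _ _ average average_setT.

Lemma average_invariant (h : int -> config) :
  (forall j : nat, c j = h j) -> (forall i, h (i + k.+1%:Z) = h i) ->
  (forall z i, shift z (h i) = h (i + z)) -> translation_invariant average.
Proof.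
move=> ch hper hs z A mA; change (average (shift z @^-1` A) = average A).
rewrite !averageE; congr (_ * _)%:E.
pose F i : R := \1_A (h i).
pose G z := \sum_(j < k.+1) F (j%:Z + z).
have -> : \sum_(j < k.+1) \1_(shift z @^-1` A) (c j) = G z.
  by apply: eq_bigr => j _; rewrite /F !indicE ch -hs.
have -> : \sum_(j < k.+1) \1_A (c j) = G 0.
  by apply: eq_bigr => j _; rewrite addr0 /F ch.
have G1 y : G (y + 1) = G y.
  rewrite /G big_ord_recr big_ord_recl /= addrC; congr (_ + _).
    by rewrite (_ : k%:Z + (y + 1) = 0%:Z + y + k.+1%:Z) /F ?hper//; lia.
  by apply: eq_bigr => j _; congr F; rewrite /bump /=; lia.
have pos n : G n%:Z = G 0.
  by elim: n => // n IH; rewrite -[RHS]IH -[RHS]G1; congr G; lia.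
have neg n : G (- n%:Z) = G 0.
  by elim: n => [|n IH]; [rewrite oppr0 | rewrite -[RHS]IH -[LHS]G1; congr G; lia].
have [z0|z0] := leP 0 z; first by rewrite -(gez0_abs z0).
by rewrite -[z]opprK -(ltz0_abs z0).
Qed.

(** The atoms lie on one orbit, so an invariant event contains all of them or none. *)
Lemma average_ergodic : (forall j, exists z, c j = shift z (c 0%N)) ->
  forall A : set config, measurable A ->
    (forall z : int, shift z @^-1` A = A) -> average A = 0%E \/ average A = 1%E.
Proof.
move=> hc A _ hA; have h j : \1_A (c j) = \1_A (c 0%N) :> R.
  by have [z ->] := hc j; rewrite -[in RHS](hA z) !indicE.
rewrite (average_cst h) indicE; case: (_ \in _); by [right|left].
Qed.

Lemma average_initially_active : (forall j x, c j x <> Sleeping) ->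
  initially_active average.
Proof.
by move=> h; apply: average_cst => j; rewrite indicE mem_set// => x; exact: h.
Qed.

Lemma measurable_occupation (g : occupation -> \bar R) (x : int) :
  measurable_fun setT ((fun eta => g (eta x)) : config -> \bar R).
Proof.
move=> _ Y mY; rewrite setTI (_ : _ @^-1` Y =
  \bigcup_n (if g (occ_of_nat n) \in Y
             then [set eta : int -> occupation | eta x = occ_of_nat n] else set0)).
  apply: bigcupT_measurable => n; case: ifP => // _.
  exact: (measurable_site x).
apply/seteqP; split => eta /=.
  move=> Yx; exists (nat_of_occ (eta x)) => //.
  by rewrite nat_of_occK mem_set.
by move=> [n _]; case: ifP => // /set_mem Yn /= ->.
Qed.

Lemma density_average :
  density average = (k.+1%:R^-1 * \sum_(j < k.+1) ((particles (c j 0))%:R : R))%:E.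
Proof.
have mf := measurable_occupation (fun a => ((particles a)%:R)%:E) 0.
rewrite /density ge0_integral_mscale//= ge0_integral_measure_sum//.
rewrite EFinM -sumEFin; congr (_ * _)%E; apply: eq_bigr => j _.
by rewrite integral_dirac// diracT mul1e.
Qed.

Lemma average_ge (j : 'I_k.+1) A : A (c j) -> (k.+1%:R^-1%:E <= average A)%E.
Proof.
move=> Aj; rewrite averageE lee_fin ler_peMr// (bigD1 j)//= indicE mem_set//.
by rewrite lerDl; apply: sumr_ge0.
Qed.

End Average.

Section LatticeLaw.
Variables (R : realType) (k : nat).
Local Notation K := k.+1.

Definition lattice_shift (j : nat) : config := shift j%:Z (lattice K).

Lemma lattice_shift_mod (x : int) :
  shift x (lattice K) = lattice_shift `|(x %% K%:Z)%Z|%N.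
Proof.
apply/funext => y; rewrite /lattice_shift /Defs.shift /lattice.
rewrite gez0_abs ?modz_ge0//; congr (if _ then _ else _).
by rewrite {1}(divz_eq x K) addrCA rpredDl// dvdz_mull.
Qed.

Lemma lattice_ergodic : translation_ergodic (average R lattice_shift k).
Proof.
split.
  apply: (@average_invariant R lattice_shift k (fun i => shift i (lattice K))) => //.
    move=> i; apply/funext => y; rewrite /Defs.shift /lattice addrA.
    by rewrite rpredDr// dvdzz.
  by move=> z i; apply/funext => y; rewrite /Defs.shift; congr (lattice K _); lia.
apply: average_ergodic => j; exists j%:Z; apply/funext => y.
by rewrite /lattice_shift /Defs.shift addr0.
Qed.

Lemma lattice_initially_active : initially_active (average R lattice_shift k).
Proof.
by apply: average_initially_active => j x; rewrite /lattice_shift /Defs.shift /lattice; case: ifP.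
Qed.

Lemma lattice_density : density (average R lattice_shift k) = (K%:R^-1)%:E.
Proof.
rewrite density_average; congr (_%:E); rewrite big_ord_recl big1 => [|j _].
  by rewrite addr0 /lattice_shift /Defs.shift /lattice add0r dvdz0 mulr1.
rewrite /lattice_shift /Defs.shift /lattice add0r dvdzE /=.
by rewrite gtnNdvd// /bump /= add1n ltnS.
Qed.

End LatticeLaw.

(** * Bounds on the critical density *)

Section CriticalBounds.
Variables (R : realType) (lam zc : R).
Hypotheses (lam_gt0 : 0 < lam)
  (zcP : critical_density (symmetric_walk R) lam zc).
Local Notation S := (semigroup (symmetric_walk R) lam).

Lemma critical_le k : 32 * 6 ^+ (8 * k.+1) * lam <= 1 -> zc <= k.+1%:R^-1.
Proof.
move=> lam_small; rewrite leNgt; apply/negP => zgt.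
pose nu : probability config R := average R (lattice_shift k) k.
have [P [PV [lawPV limPV]] [+ _]] := zcP (lattice_ergodic R k)
  (lattice_initially_active R k) (lattice_density R k).
move=> /(_ zgt) P0.
have [delta delta0 hdelta] := lattice_active lam_gt0 (ltn0Sn k) lam_small.
(* Half of the activity forced in finite volume: delta for the shifted block, times 1/K for the
   matching translate of the lattice. The other half covers the approximation error. *)
pose e := delta / k.+1%:R / 2.
have e0 : 0 < e by rewrite !divr_gt0.
have [n0 hn0] := fixation_decay lam_gt0 lawPV limPV P0 e0.
pose B : set int := [set` [:: 0 : int]].
have B0 : B 0 by rewrite /B /= mem_head.
have /choice [sf hsf] : forall n : nat, exists s : seq int, forall V,
    finite_set V -> [set` s] `<=` V ->
    `|fine (P (act_event n%:R 0)) - fine (PV V (act_event n%:R 0))| < e.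
  move=> n; have dA : determined_by B n%:R (act_event (n%:R : R) 0).
    by apply: determined_act; rewrite // ler0n lexx.
  have [V0 /finite_seqP[s sE] hV0] :=
    ARW_approx limPV (finite_seq _) dA (measurable_act 0 (ler0n _ n)) e0.
  by exists s => V fV sV; apply: hV0; rewrite // sE.
(* Sites that a volume must contain to approximate the process at every time up to 2 n0 + 2, since n
   is not known yet. *)
pose s := flatten [seq sf n | n <- iota 0 n0.*2.+3].
have [b hb] := supp_bound s.
have [N [x [n [/andP[n0n nn] hx hact]]]] := hdelta n0 b.
pose v := (k.+1 * N)%N.
pose V : set int := [set` [seq i - x | i <- int_range v]].
have memV y : (y \in V) = (0 <= y + x < v%:Z).
  rewrite /V mem_setE; apply/mapP/idP => [[i + ->]|h].
    by rewrite mem_int_range subrK.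
  by exists (y + x); rewrite ?addrK// mem_int_range.
have fV : finite_set V := finite_seq _.
have sV : [set` sf n] `<=` V.
  move=> y /= ys; apply/set_mem; rewrite memV.
  have /hb : y \in s.
    apply/flattenP; exists (sf n) => //; apply/mapP; exists n => //.
    by rewrite mem_iota.
  by move: hx; clear; rewrite -/v; lia.
have j_lt : (`|(x %% k.+1%:Z)%Z| < k.+1)%N.
  by have := @ltz_pmod x k.+1%:Z isT; have := @modz_ge0 x k.+1%:Z isT; clear; lia.
pose eta := restrict V (shift x (lattice k.+1)).
have etaE : eta = shift x (block k.+1 v).
  by apply/funext => y; rewrite /eta /restrict memV /Defs.shift blockE.
have feta : finsupp eta by exact: finsupp_restrict.
have nuA : (k.+1%:R^-1%:E <= nu (restrict V @^-1` [set eta]))%E.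
  apply: (@average_ge _ _ _ (Ordinal j_lt)) => /=.
  by rewrite /eta lattice_shift_mod.
have fb : finsupp (block k.+1 v) by exact: finsupp_restrict (finite_seq _).
have Sx : delta < S n%:R \1_[set xi | active xi 0] eta.
  by rewrite etaE semigroup_act_shift// add0r.
have := semigroup_act_le lam_gt0 (lawPV V fV) 0 n feta.
have PVf : PV V (act_event n%:R 0) \is a fin_num :=
  fin_num_measure (PV V) _ (measurable_act 0 (ler0n R n)).
have Pf : P (act_event n%:R 0) \is a fin_num :=
  fin_num_measure P _ (measurable_act 0 (ler0n R n)).
have := hsf n V fV sV; have := hn0 n n0n.
rewrite -{1}(fineK Pf) -{2}(fineK PVf) lte_fin ltr_norml => h1 /andP[h2 _] h3.
have : ((k.+1%:R^-1 * delta)%:E <= (fine (PV V (act_event n%:R 0)))%:E)%E.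
  apply: le_trans h3; rewrite EFinM; apply: lee_pmul => //.
  - by rewrite lee_fin ltW.
  - by rewrite lee_fin ltW.
have e2 : k.+1%:R^-1 * delta = e + e by rewrite /e -splitr mulrC.
by rewrite lee_fin e2; move: h1 h2; lra.
Qed.

(** With a negative value the empty configuration, of density 0, would have to stay active. *)
Lemma critical_ge0 : 0 <= zc.
Proof.
rewrite leNgt; apply/negP => zlt.
pose c (j : nat) := empty_config.
pose nu : probability config R := average R c 0.
have cs z : shift z empty_config = empty_config by [].
have erg : translation_ergodic nu.
  split; first exact: (@average_invariant R c 0 (fun=> empty_config)).
  by apply: average_ergodic => j; exists 0.
have act : initially_active nu by apply: average_initially_active.
have dens : density nu = (0 : R)%:E.
  by rewrite density_average big_ord1 mulr0.
have [P [PV [lawPV limPV]] [_ P1]] := zcP erg act dens.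
have {}P1 := P1 zlt.
have cE : confN R 0 empty_config.
  by split; [exists [::] | rewrite /lin fsbig1// => x _; rewrite mulr0].
have empty0 xi : confN R 0 xi -> xi = empty_config.
  move=> cx; apply/funext => x; have := particles_le x cx.
  by rewrite leqn0 /empty_config; case: (xi x) => [[|m]|].
have PV0 V t : finite_set V -> 0 <= t -> PV V (act_event t 0) = 0%E.
  move=> fV t0; pose u i : R := if i is 0 then 0 else t.
  have u1 i : u i <= u i.+1 by case: i => /=.
  have := law_hist (lawPV V fV) erefl u1 1 (fun=> empty_config).
  rewrite big_ord1 /= subr0 /transition.
  have -> : S t \1_[set empty_config] empty_config = 1.
    rewrite -[RHS](semigroup_cst lam_gt0 1 t cE).
    by apply: (semigroup_ext lam_gt0 _ cE) => xi /empty0 ->; rewrite indicE mem_set.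
  rewrite mule1.
  have -> : nu (restrict V @^-1` [set empty_config]) = 1%E.
    apply: average_cst => j; rewrite indicE mem_set//=.
    by apply/funext => x; rewrite /restrict; case: ifP.
  move=> h.
  have mH := measurable_hist erefl u1 1 (mkseq (fun=> empty_config) 2).
  have mA : measurable (act_event t 0 : set (Defs.path R)) by exact: measurable_act.
  have HC0 : PV V (~` hist_event u 1 (mkseq (fun=> empty_config) 2)) = 0%E.
    by rewrite probability_setC// h subee.
  apply/eqP; rewrite eq_le measure_ge0 andbT -HC0.
  apply: le_measure; rewrite ?inE//; first exact: measurableC.
  by move=> w aw; rewrite hist_eventE => /(_ 1%N isT) /= wt; move: aw; rewrite /act_event /= wt.
have Pt t : 0 <= t -> P (act_event t 0) = 0%E.
  move=> t0; pose B : set int := [set` [:: 0 : int]].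
  have B0 : B 0 by rewrite /B /= mem_head.
  have dA : determined_by B t (act_event t 0) by apply: determined_act; rewrite // t0 lexx.
  have fA : P (act_event t 0) \is a fin_num := fin_num_measure P _ (measurable_act 0 t0).
  rewrite -(fineK fA); congr (_%:E); apply/eqP; rewrite -normr_eq0 eq_le normr_ge0 andbT.
  apply/ler_addgt0Pl => e e0; rewrite addr0.
  have [V0 fV0 /(_ V0 fV0 (@subset_refl _ _))] :=
    ARW_approx limPV (finite_seq _) dA (measurable_act 0 t0) e0.
  by rewrite PV0// subr0 => /ltW.
have : P.-negligible (@stays_active R).
  pose F n : set (Defs.path R) :=
    oapp (fun q : rat => if 0 <= ratr q :> R then act_event (ratr q) 0 else set0)
      set0 (unpickle n).
  have : P.-negligible (\bigcup_n F n).
    apply: negligible_bigcup => n; rewrite /F.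
    case: (unpickle n) => [q|] /=; last exact: negligible_set0.
    case: ifP => [q0|_]; last exact: negligible_set0.
    by apply/negligibleP; [exact: measurable_act | exact: Pt].
  apply: negligibleS => w; rewrite stays_activeE => /(_ 0 I 0%N I) [q _].
  case: ifP => [q0 aq|_ []]; exists (pickle q); first exact: I.
  by rewrite /F pickleK /= q0.
have mS := @measurable_stays_active R.
move=> /(negligibleP _ mS) P0; have := P1; rewrite [LHS]P0 => /esym/eqP.
by rewrite onee_eq0.
Qed.

End CriticalBounds.

Theorem theorem5p1 (R : realType) (zeta_c : R -> R)
  (zeta_cP : forall lambda : R, 0 < lambda ->
    critical_density (symmetric_walk R) lambda (zeta_c lambda)) :
  zeta_c lambda @[lambda --> 0^'+] --> (0 : R).
Proof.
apply/cvgrPdist_lt => e e0; pose k := Num.bound e^-1.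
have ke : k.+1%:R^-1 < e.
  rewrite invf_plt ?posrE//; apply: (@lt_trans _ _ k%:R); last by rewrite ltr_nat.
  by apply: archi_boundP; rewrite invr_ge0 ltW.
pose c : R := 32 * 6 ^+ (8 * k.+1).
have c0 : 0 < c by rewrite mulr_gt0// exprn_gt0.
near=> lam.
have lam0 : 0 < lam by near: lam; exact: nbhs_right_gt.
have lamc : lam <= c^-1 by near: lam; apply: nbhs_right_le; rewrite invr_gt0.
have z0 := critical_ge0 lam0 (zeta_cP lam lam0).
rewrite sub0r normrN ger0_norm//; apply: le_lt_trans ke.
apply: (critical_le lam0 (zeta_cP lam lam0)).
by rewrite -/c -(@divff _ c) ?lt0r_neq0// ler_pM2l.
Unshelve. all: by end_near.
Qed.
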